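(* Let $0<q\le 1$ and $q\le p<+\infty$. Let $0<\eta\leq 1$ and let $\delta\geq\left\lfloor d\left(\frac{1}{q}-1\right)\right\rfloor$ be an integer. Then there is a constant $C>0$ such that, for all sequences $\{(\mathbf{a}_n, Q^n)\}_{n\geq 0}$ in $\mathcal{A}_{\mathrm{loc}}(q,\infty,\delta)$ and all sequences of scalars $\{\lambda_n\}_{n\geq 0}$ such that $$\left\|\sum_{n\geq 0}\left(\frac{|\lambda_n|}{\|\chi_{Q^n}\|_{q}}\right)^{\eta}\chi_{Q^{n}}\right\|_{\frac{q}{\eta},\frac{p}{\eta}}<+\infty,$$ the series $f:=\sum_{n\geq 0}\lambda_n\mathbf{a}_n$ converges in $\mathcal{S}'$ and in $\mathcal{H}_{\mathrm{loc}}^{(q,p)}$, with $$\|f\|_{\mathcal{H}_{\mathrm{loc}}^{(q,p)}}\leq C\left\|\sum_{n\geq 0}\left(\frac{|\lambda_n|}{\|\chi_{Q^n}\|_{q}}\right)^{\eta}\chi_{Q^{n}}\right\|_{\frac{q}{\eta},\frac{p}{\eta}}^{\frac{1}{\eta}}.$$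
   Context: All functions are on $\mathbb{R}^d$ and complex valued; $\mathcal{S}$ is the Schwartz space and $\mathcal{S}'$ the space of tempered distributions with the weak-$*$ topology. $\chi_E$ is the characteristic function and $|E|$ the Lebesgue measure of $E$. Cubes are closed with edges parallel to the coordinate axes. Amalgam quasi-norms: for $0<s,t\le+\infty$ and measurable $f$, $\|f\|_s$ is the usual $L^s(\mathbb{R}^d)$ (quasi-)norm and $\|f\|_{s,t}:=\big\|\{\|f\chi_{Q_k}\|_s\}_{k\in\mathbb{Z}^d}\big\|_{\ell^t(\mathbb{Z}^d)}$, where $Q_k:=k+[0,1)^d$. The space $(L^s,\ell^t)$ consists of measurable $f$ with $\|f\|_{s,t}<+\infty$. Local Hardy-amalgam space: fix $\varphi\in\mathcal{S}$ with $\mathrm{supp}(\varphi)\subset B(0,1)$ and $\int_{\mathbb{R}^d}\varphi(x)\,dx=1$, and put $\varphi_t(x)=t^{-d}\varphi(x/t)$. For $0<q,p<+\infty$, $\mathcal{H}_{\mathrm{loc}}^{(q,p)}$ is the space of $f\in\mathcal{S}'$ such that $\mathcal{M}_{\mathrm{loc}_\varphi}(f):=\sup_{0<t\le1}|f*\varphi_t|$ belongs to $(L^q,\ell^p)$, with quasi-norm $\|f\|_{\mathcal{H}_{\mathrm{loc}}^{(q,p)}}:=\|\mathcal{M}_{\mathrm{loc}_\varphi}(f)\|_{q,p}$ (different choices of $\varphi$ give equivalent quasi-norms). Atoms: for $1<r\le+\infty$ and an integer $s\ge\lfloor d(\frac1q-1)\rfloor$, $\mathcal{A}_{\mathrm{loc}}(q,r,s)$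 is the set of pairs $(\mathbf{a},Q)$ where $Q$ is a cube and $\mathbf{a}$ is a function with (1) $\mathrm{supp}(\mathbf{a})\subset Q$; (2) $\|\mathbf{a}\|_r\le|Q|^{\frac1r-\frac1q}$; (3) if $|Q|<1$, $\int_{\mathbb{R}^d}x^\beta\mathbf{a}(x)\,dx=0$ for all multi-indices $\beta$ with $|\beta|\le s$ (no moment condition is required if $|Q|\ge1$). Such an $\mathbf{a}$ is called a $(q,r,s)$-atom for $\mathcal{H}_{\mathrm{loc}}^{(q,p)}$. The constant $C$ in the claim does not depend on the sequences. *)

(* Defs.v *)
From HB Require Import structures.
From mathcomp Require Import all_boot all_order all_algebra.
From mathcomp Require Import all_classical all_reals all_analysis.
From mathcomp Require Import measurable_realfun complex.

Set Implicit Arguments.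
Unset Strict Implicit.
Unset Printing Implicit Defensive.
Import Order.TTheory GRing.Theory Num.Theory.
Import numFieldNormedType.Exports.

Local Open Scope classical_set_scope.
Local Open Scope ring_scope.
Local Open Scope complex_scope.

(* Borel sigma-algebra of R^d, generated by the coordinates; R^d is the type
   ['rV[R]_d] of row vectors. *)
Definition rV_display : measure_display. Proof. by []. Qed.

Section measurable_rV.
Context (R : realType) (d : nat).

Definition rV_coord (i : 'I_d) (x : 'rV[R]_d) : R := x ord0 i.

Let rV_set0 : g_sigma_preimage rV_coord set0.
Proof. exact: sigma_algebra0. Qed.

Let rV_setC A : g_sigma_preimage rV_coord A -> g_sigma_preimage rV_coord (~` A).
Proof. exact: sigma_algebraC. Qed.

Let rV_bigcup (F : (set 'rV[R]_d)^nat) :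
  (forall i, g_sigma_preimage rV_coord (F i)) ->
  g_sigma_preimage rV_coord (\bigcup_i (F i)).
Proof. exact: sigma_algebra_bigcup. Qed.

HB.instance Definition _ := @isMeasurable.Build rV_display
  'rV[R]_d (g_sigma_preimage rV_coord) rV_set0 rV_setC rV_bigcup.

Lemma measurable_rV_coord i : measurable_fun [set: 'rV[R]_d] (rV_coord i).
Proof.
move=> _ Y mY; rewrite setTI; apply: sub_sigma_algebra => /=.
rewrite -bigcup_seq/=; exists i => /=; first by rewrite mem_index_enum.
by exists Y => //; rewrite setTI.
Qed.

Lemma measurable_fun_rVP d1 (T1 : measurableType d1) (f : T1 -> 'rV[R]_d) :
  measurable_fun [set: T1] f <->
  forall i, measurable_fun [set: T1] (rV_coord i \o f).
Proof.
split=> [mf i|mf].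
  exact: measurableT_comp (measurable_rV_coord i) mf.
suff S : <<s \big[setU/set0]_(i < d)
    preimage_set_system setT (rV_coord i) measurable >> `<=`
    [set A | measurable (f @^-1` A)].
  by move=> _ A mA; rewrite setTI; exact: S.
apply: smallest_sub.
  split=> /=; first by rewrite preimage_set0.
    by move=> A mA; rewrite setTD preimage_setC; exact: measurableC.
  by move=> F mF; rewrite preimage_bigcup; exact: bigcupT_measurable.
rewrite -bigcup_seq => A [i _ [B mB <-]] /=.
rewrite setTI -comp_preimage -[X in measurable X]setTI; exact: mf.
Qed.

End measurable_rV.

Section lebesgue_rV.
Context (R : realType).

Definition rV_cons (n : nat) (z : R * 'rV[R]_n) : 'rV[R]_n.+1 :=
  row_mx (const_mx z.1 : 'rV_1) z.2.

Lemma rV_cons0 n z (j : 'I_1) : @rV_cons n z ord0 (@lshift 1 n j) = z.1.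
Proof.
transitivity ((const_mx z.1 : 'rV[R]_1) ord0 j); last by rewrite mxE.
exact: (@row_mxEl _ 1 1 n).
Qed.

Lemma rV_consS n z (j : 'I_n) : rV_cons z ord0 (@rshift 1 n j) = z.2 ord0 j.
Proof. exact: (@row_mxEr _ 1 1 n). Qed.

Lemma measurable_rV_cons n : measurable_fun setT (@rV_cons n).
Proof.
apply/measurable_fun_rVP => i.
rewrite /comp /rV_coord.
case: (@splitP 1 n i) => j ij.
  rewrite (_ : (fun _ => _) = fst); first exact: measurable_fst.
  apply/funext => z; rewrite (_ : i = @lshift 1 n j :> 'I_(1 + n)).
    exact: rV_cons0.
  exact: ord_inj.
rewrite (_ : (fun _ => _) = (@rV_coord R n j) \o snd).
  exact: measurableT_comp (@measurable_rV_coord R n j) measurable_snd.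
apply/funext => z; rewrite (_ : i = @rshift 1 n j :> 'I_(1 + n)).
  exact: rV_consS.
exact: ord_inj.
Qed.

Section product_step.
Context (n : nat) (m : {sigma_finite_measure set 'rV[R]_n -> \bar R}).

Definition rV_measureS : set 'rV[R]_n.+1 -> \bar R :=
  pushforward (@lebesgue_measure R \x m)%E (@rV_cons n).

Let pre (A : set 'rV[R]_n.+1) :
  measurable A -> measurable (@rV_cons n @^-1` A).
Proof. by move=> mA; rewrite -[X in measurable X]setTI; exact: measurable_rV_cons. Qed.

Let measS0 : rV_measureS set0 = 0%E.
Proof. by rewrite /rV_measureS /pushforward preimage_set0 measure0. Qed.

Let measS_ge0 A : (0 <= rV_measureS A)%E.
Proof. by rewrite /rV_measureS /pushforward; exact: measure_ge0. Qed.

Let measS_sigma_additive : semi_sigma_additive rV_measureS.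
Proof.
move=> F mF tF mUF; rewrite /rV_measureS /pushforward preimage_bigcup.
apply: measure_semi_sigma_additive.
- by move=> k; exact: pre.
- apply/trivIsetP => /= i j _ _ ij; rewrite -preimage_setI.
  by move/trivIsetP : tF => /(_ _ _ _ _ ij) ->//; rewrite preimage_set0.
- by rewrite -preimage_bigcup; exact: pre.
Qed.

HB.instance Definition _ := isMeasure.Build _ _ _ rV_measureS
  measS0 measS_ge0 measS_sigma_additive.

Let tail (x : 'rV[R]_n.+1) : 'rV[R]_n := \row_j x ord0 (rshift 1 j).
Let head (x : 'rV[R]_n.+1) : R := x ord0 ord0.

Let rV_consK z : (head (rV_cons z), tail (rV_cons z)) = z.
Proof.
case: z => a v; congr pair.
  rewrite /head (_ : ord0 = @lshift 1 n ord0 :> 'I_(1 + n)).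
    exact: rV_cons0.
  exact: ord_inj.
by apply/rowP => j; rewrite mxE rV_consS.
Qed.

Let measurable_split : measurable_fun setT (fun x => (head x, tail x)).
Proof.
apply: measurable_fun_pair => /=; first exact: measurable_rV_coord.
apply/measurable_fun_rVP => i; rewrite /comp.
rewrite (_ : (fun _ => _) = rV_coord (rshift 1 i)).
  exact: measurable_rV_coord.
by apply/funext => x; rewrite /rV_coord mxE.
Qed.

Let measS_sigma_finite : sigma_finite setT rV_measureS.
Proof.
have /sigma_finiteP[F [TF ndF Foo]] := sigma_finiteT (@lebesgue_measure R).
have /sigma_finiteP[G [TG ndG Goo]] := sigma_finiteT m.
exists (fun k => (fun x => (head x, tail x)) @^-1` (F k `*` G k)).
  rewrite predeqE => x; split => // _.
  have [k _ Fk] : (\bigcup_i F i) (head x) by rewrite -TF.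
  have [l _ Gl] : (\bigcup_i G i) (tail x) by rewrite -TG.
  exists (maxn k l) => //; split => /=.
  - by move: (head x) Fk; exact/subsetPset/ndF/leq_maxl.
  - by move: (tail x) Gl; exact/subsetPset/ndG/leq_maxr.
move=> k; have [mFk Fk] := Foo k; have [mGk Gk] := Goo k; split.
  rewrite -[X in measurable X]setTI; apply: measurable_split => //.
  exact: measurableX.
rewrite /rV_measureS /pushforward -comp_preimage.
rewrite (_ : _ \o _ = id); last by apply/funext => z /=; exact: rV_consK.
by rewrite preimage_id product_measure1E// lte_mul_pinfty// ge0_fin_numE.
Qed.

HB.instance Definition _ := Measure_isSigmaFinite.Build _ _ _ rV_measureS
  measS_sigma_finite.

End product_step.

Fixpoint borel_lebesgue (d : nat) :
    {sigma_finite_measure set 'rV[R]_d -> \bar R} :=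
  match d with
  | 0 => \d_(0 : 'rV[R]_0)
  | n.+1 => rV_measureS (borel_lebesgue n)
  end.

Lemma borel_lebesgue_box (d : nat) (A : 'I_d -> set R) :
  (forall i, measurable (A i)) ->
  borel_lebesgue d [set x : 'rV[R]_d | forall i, A i (x ord0 i)] =
  (\prod_(i < d) lebesgue_measure (A i))%E.
Proof.
elim: d A => [|n IHn] A mA.
  by rewrite big_ord0 /= diracE mem_set// => -[].
rewrite big_ord_recl -IHn; last by move=> i; exact: mA.
set B := (X in _ = (_ * (borel_lebesgue n X))%E).
have mB : measurable B.
  rewrite (_ : B =
      \bigcap_(i in [set: 'I_n]) (rV_coord i @^-1` A (lift ord0 i))).
    apply: fin_bigcap_measurable => // i _.
    by rewrite -[X in measurable X]setTI; exact: measurable_rV_coord.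
  by apply/seteqP; split=> [x Bx i _|x Bx i]; [exact: Bx|exact: (Bx i I)].
transitivity ((@lebesgue_measure R \x borel_lebesgue n)%E (A ord0 `*` B)); last first.
  by rewrite product_measure1E; [|exact: (mA ord0)|exact: mB].
rewrite /= /rV_measureS /pushforward; congr (_ _).
apply/seteqP; split=> [[a v]/= Aav|[a v]/= [Aa Av] i].
  split.
    have := Aav ord0; rewrite (_ : ord0 = @lshift 1 n ord0 :> 'I_(1 + n)).
      by rewrite rV_cons0.
    exact: ord_inj.
  by move=> i; have := Aav (@rshift 1 n i); rewrite rV_consS rshift1.
case: (@splitP 1 n i) => j ij.
  rewrite (_ : i = @lshift 1 n j :> 'I_(1 + n)); last exact: ord_inj.
  by rewrite rV_cons0/= (_ : lshift n j = ord0)//; apply/ord_inj; case: j ij => -[].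
rewrite (_ : i = @rshift 1 n j :> 'I_(1 + n)); last exact: ord_inj.
by rewrite rV_consS rshift1; exact: Av.
Qed.

End lebesgue_rV.

(* R^d with the Lebesgue (completed Borel) sigma-algebra, and Lebesgue
   measure on it; [Rd R d] is convertible to ['rV[R]_d]. *)
Definition Rd (R : realType) (d : nat) :=
  caratheodory_type ((borel_lebesgue R d)^*)%mu.

Definition leb (R : realType) (d : nat) :
    {measure set (Rd R d) -> \bar R} :=
  @completed_measure_extension _ _ _ (borel_lebesgue R d).

Lemma leb_box (R : realType) (d : nat) (A : 'I_d -> set R) :
  (forall i, measurable (A i)) ->
  leb R d [set x : 'rV[R]_d | forall i, A i (x ord0 i)] =
  (\prod_(i < d) lebesgue_measure (A i))%E.
Proof.
move=> mA; rewrite -borel_lebesgue_box//.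
rewrite /leb/= /completed_measure_extension measurable_mu_extE//.
rewrite (_ : [set x | _] =
    \bigcap_(i in [set: 'I_d]) (@rV_coord R d i @^-1` A i)).
  apply: fin_bigcap_measurable => // i _.
  by rewrite -[X in measurable X]setTI; exact: measurable_rV_coord.
by apply/seteqP; split=> [x Bx i _|x Bx i]; [exact: Bx|exact: (Bx i I)].
Qed.

Section amalgam.
Context {R : realType} {d : nat}.
Implicit Types (s t : \bar R) (f : 'rV[R]_d -> \bar R).

Definition unit_cube (k : 'rV[int]_d) : set 'rV[R]_d :=
  [set x : 'rV[R]_d | forall i, (k ord0 i)%:~R <= x ord0 i < (k ord0 i)%:~R + 1].

(* The l^t (quasi-)norm of a nonnegative family, for 0 < t <= +oo. *)
Definition lseq_norm {I : choiceType} t (a : I -> \bar R) : \bar R :=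
  match t with
  | r%:E => ((\esum_(k in [set: I]) (a k `^ r)) `^ r^-1)%E
  | _ => ereal_sup (range a)
  end.

Definition Lr_norm s f : \bar R := Lnorm (leb R d) s f.

Definition amalgam_norm s t f : \bar R :=
  lseq_norm t (fun k : 'rV[int]_d =>
    Lr_norm s (fun x => f x * (\1_(unit_cube k) x)%:E)%E).

Definition amalgam s t : set ('rV[R]_d -> \bar R) :=
  [set f | measurable_fun (setT : set (Rd R d)) (f : Rd R d -> \bar R) /\
           (amalgam_norm s t f < +oo)%E].

End amalgam.

Section complex_functions.
Context {R : realType}.

Definition cmod (z : R[i]) : R := ComplexField.Normc.normc z.

Context {d : nat}.
Implicit Types (f g : 'rV[R]_d -> R[i]).

Definition Re_fun f : 'rV[R]_d -> R := fun x => complex.Re (f x).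
Definition Im_fun f : 'rV[R]_d -> R := fun x => complex.Im (f x).

Definition cmeasurable f :=
  measurable_fun (setT : set (Rd R d)) (Re_fun f : Rd R d -> R) /\
  measurable_fun (setT : set (Rd R d)) (Im_fun f : Rd R d -> R).

Definition cintegral f : R[i] :=
  Rintegral (leb R d) setT (Re_fun f) +i* Rintegral (leb R d) setT (Im_fun f).

Definition support_of f : set 'rV[R]_d := closure [set x : 'rV[R]_d | f x != 0].

Definition partial_at (i : 'I_d) f : 'rV[R]_d -> R[i] := fun x =>
  ('D_(delta_mx ord0 i) (Re_fun f) x) +i* ('D_(delta_mx ord0 i) (Im_fun f) x).

Definition partials (w : seq 'I_d) f := foldr partial_at f w.

Definition smooth f := forall w : seq 'I_d,
  [/\ continuous (Re_fun (partials w f)),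
      continuous (Im_fun (partials w f)) &
      forall (i : 'I_d) (x : 'rV[R]_d),
        derivable (Re_fun (partials w f)) x (delta_mx ord0 i) /\
        derivable (Im_fun (partials w f)) x (delta_mx ord0 i)].

(* Multi-indices, with iterated derivatives taken in a fixed order of the
   coordinates (the order is irrelevant for smooth functions). *)
Definition multi_index := {ffun 'I_d -> nat}.

Definition mdeg (b : multi_index) : nat := (\sum_i b i)%N.

Definition monomial (b : multi_index) (x : 'rV[R]_d) : R :=
  \prod_i x ord0 i ^+ b i.

Definition mderive (b : multi_index) f : 'rV[R]_d -> R[i] :=
  partials (flatten [seq nseq (b i) i | i <- enum 'I_d]) f.

Definition schwartz_seminorm (a b : multi_index) f : \bar R :=
  ereal_sup (range (fun x => (cmod ((monomial a x)%:C * mderive b f x))%:E)).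

Definition schwartz : set ('rV[R]_d -> R[i]) :=
  [set f | smooth f /\ forall a b, (schwartz_seminorm a b f < +oo)%E].

End complex_functions.

Section distributions.
Context {R : realType} {d : nat}.

(* Functionals are total; only their values on Schwartz functions matter. *)
Definition functional := ('rV[R]_d -> R[i]) -> R[i].
Implicit Types (u v : functional) (phi psi : 'rV[R]_d -> R[i]).

(* Linear on S, and continuous for the topology given by the seminorms. *)
Definition tempered u :=
  (forall (c : R[i]) psi1 psi2, schwartz psi1 -> schwartz psi2 ->
     u (fun x => c * psi1 x + psi2 x) = c * u psi1 + u psi2) /\
  (forall psi, schwartz psi -> forall e : R, 0 < e ->
     exists (N : nat) (r : R), 0 < r /\
       forall psi', schwartz psi' ->
         (forall a b : multi_index, (mdeg a <= N)%N -> (mdeg b <= N)%N ->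
            (schwartz_seminorm a b (fun x => psi' x - psi x)%R < r%:E)%E) ->
         cmod (u psi' - u psi) < e).

Definition weakstar_cvg (u_ : nat -> functional) u :=
  forall psi, schwartz psi ->
    (fun n => cmod (u_ n psi - u psi)) @ \oo --> (0 : R).

Definition dist_of (f : 'rV[R]_d -> R[i]) : functional :=
  fun psi => cintegral (fun x => f x * psi x).

(* Open Euclidean unit ball; the norm of ['rV[R]_d] is the sup norm. *)
Definition unit_ball : set 'rV[R]_d :=
  [set x : 'rV[R]_d | Num.sqrt (\sum_i x ord0 i ^+ 2) < 1].

Definition admissible phi :=
  [/\ schwartz phi, support_of phi `<=` unit_ball & cintegral phi = 1].

Definition dilate phi (t : R) : 'rV[R]_d -> R[i] :=
  fun x => (t ^- d)%:C * phi (t^-1 *: x).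

Definition convolution u psi : 'rV[R]_d -> R[i] :=
  fun x => u (fun y => psi (x - y)).

Definition local_maximal phi u : 'rV[R]_d -> \bar R := fun x =>
  ereal_sup [set (cmod (convolution u (dilate phi t) x))%:E | t in `]0, 1]].

Definition Hloc_norm phi (q p : R) u : \bar R :=
  amalgam_norm q%:E p%:E (local_maximal phi u).

Definition Hloc phi (q p : R) : set functional :=
  [set u | tempered u /\ amalgam q%:E p%:E (local_maximal phi u)].

Definition Hloc_cvg phi (q p : R) (u_ : nat -> functional) u :=
  [/\ forall n, Hloc phi q p (u_ n), Hloc phi q p u &
      (fun n => Hloc_norm phi q p (fun psi => u_ n psi - u psi)) @ \oo
        --> 0%E].

End distributions.

Arguments functional : clear implicits.

Section atoms.
Context {R : realType} {d : nat}.

Definition is_cube (Q : set 'rV[R]_d) := exists (c : 'rV[R]_d) (l : R),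
  0 < l /\ Q = [set x : 'rV[R]_d | forall i, c ord0 i <= x ord0 i <= c ord0 i + l].

Definition volume (Q : set 'rV[R]_d) : R := fine (leb R d Q).

(* The exponent is 1/r - 1/q, with 1/r = 0 for r = +oo. *)
Definition local_atom (q : R) (r : \bar R) (s : int)
    (a : 'rV[R]_d -> R[i]) (Q : set 'rV[R]_d) :=
  [/\ is_cube Q,
      cmeasurable a,
      support_of a `<=` Q,
      (Lr_norm r (fun x => (cmod (a x))%:E) <=
         (volume Q `^ (fine (r^-1)%E - q^-1))%:E)%E &
      volume Q < 1 -> forall b : multi_index, ((mdeg b)%:Z <= s) ->
        cintegral (fun x => (monomial b x)%:C * a x) = 0].

Definition char_norm (q : R) (Q : set 'rV[R]_d) : R :=
  fine (Lr_norm q%:E (fun x => (\1_Q x)%:E)).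

Definition weighted_sum (q eta : R) (lam : nat -> R[i])
    (Q : nat -> set 'rV[R]_d) : 'rV[R]_d -> \bar R := fun x =>
  (\sum_(0 <= n <oo)
     ((cmod (lam n) / char_norm q (Q n)) `^ eta * \1_(Q n) x)%:E)%E.

Definition partial_sum (lam : nat -> R[i]) (a : nat -> 'rV[R]_d -> R[i])
    (N : nat) : 'rV[R]_d -> R[i] := fun x => \sum_(n < N) lam n * a n x.

End atoms.

(* Main.v *)
Require Import Defs.
From HB Require Import structures.
From mathcomp Require Import all_boot all_order all_algebra.
From mathcomp Require Import all_classical all_reals all_analysis.
From mathcomp Require Import measurable_realfun complex.
From mathcomp Require Import ring lra zify.

Set Implicit Arguments.
Unset Strict Implicit.
Unset Printing Implicit Defensive.
Import Order.TTheory GRing.Theory Num.Theory.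
Import numFieldNormedType.Exports.

Local Open Scope classical_set_scope.
Local Open Scope ring_scope.
Local Open Scope complex_scope.

(** The proof bounds the maximal function of an atom by the tail of its cube and
    then compares sums of tails with sums of cubes. For a cube with corner [c]
    and side [l], let [tail] be the function [(l / (l + |x - c|)) ^ N] with [N =
    d + delta + 1]; the lower bound on [delta] gives [N * q > d].

    If the side of the cube is below 1, the size of the atom, for scales up to
    the side, and its cancellation against the Taylor remainder of the kernel,
    for the other scales, show that the convolution of an atom with the kernel
    is at most a constant times the size of the atom times the tail of its cube
    ([conv_tail]). Since the scales are bounded by 1, a unit cell is reached
    only by nearby cubes, and a large cube can be replaced there by a subcube of
    side 1 close to the cell ([conv_cell]).

    The heart of the matter is the inequality [integral_tail_sum_le]: for
    nonnegative coefficients and [q <= 1], the integral of the power [q] of a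
    sum of tails is at most a constant times that of the same sum of indicators.
    It is usually derived from a vector-valued maximal inequality; here it has a
    direct proof. The cubes are listed by size, and the power [q] of either sum
    is expanded as a telescoping sum, one cube at a time. The tail of a cube is
    dominated by those of the larger cubes that it touches ([tail_le_larger]).
    So, if the cube has coefficient [b] and [S] is the total coefficient of
    these cubes and of itself, the increment for the sum of tails is at most a
    constant times [b * S ^ (q - 1) * tail ^ q], while the increment for the sum
    of indicators is at least [q * b * S ^ (q - 1)] on the cube. Finally the
    integral of [tail ^ q] is at most a constant times the volume of the cube,
    as [N * q > d].

    Applied in each unit cell to the nearby cubes, this bounds the amalgam norm
    of the maximal function of the series by that of the sum of [|lam n| / |Q n|
    ^ (1 / q)] times the indicator of [Q n] ([amalgam_power_le]), and the latter
    is below the power [1 / eta] of the weighted sum at each point, as [eta <=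
    1]. The same estimate for the terms of index at least [M] has a right-hand
    side that tends to 0 by dominated convergence, first in each cell and then
    over the cells ([esum_cell_mass_from_vanishing]); this gives convergence in
    the Hardy space.

    For convergence of distributions, the pairing of an atom with a Schwartz
    function is bounded by the integral of a halo of the cube against an
    integrable weight ([atom_test_le]). On a unit cell the sum of the halos is
    bounded by a sum of tails whose power [q] has there an integral bounded
    independently of the cell, so that the pairings are summable
    ([halo_mass_sum_le]). The maximal function is measurable because it is a
    supremum of continuous functions. *)

(** * The sup norm, and measurability, on R^d *)

Section sup_norm.
Context {R : realType} {d : nat}.
Implicit Types (x : 'rV[R]_d) (r : R).

Lemma rV_norm_leP x r : 0 <= r -> (`|x| <= r) <-> (forall i, `|x ord0 i| <= r).
Proof.
move=> r0; rewrite /Num.norm/= mx_normrE; split=> [/bigmax_leP[_ H] i|H].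
  exact: (H (ord0, i)).
apply/bigmax_leP; split=> // -[i0 i] _ /=.
rewrite (ord1 i0); exact: H.
Qed.

Lemma rV_norm_ltP x r : 0 < r -> (`|x| < r) <-> (forall i, `|x ord0 i| < r).
Proof.
move=> r0; rewrite /Num.norm/= mx_normrE; split=> [/bigmax_ltP[_ H] i|H].
  exact: (H (ord0, i)).
apply/bigmax_ltP; split=> // -[i0 i] _ /=.
rewrite (ord1 i0); exact: H.
Qed.

Lemma rV_coord_le x i : `|x ord0 i| <= `|x|.
Proof. by apply: (rV_norm_leP x (normr_ge0 x)).1. Qed.

Lemma rV_norm_attained x : (0 < d)%N -> exists i, `|x| = `|x ord0 i|.
Proof.
move=> d0; pose i0 := Ordinal d0.
have [i _ Hi] := @arg_maxP _ _ _ i0 xpredT (fun i => `|x ord0 i|) isT.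
exists i; apply/eqP; rewrite eq_le rV_coord_le andbT.
by apply/rV_norm_leP => // j; exact: Hi.
Qed.

End sup_norm.

Section rd_measure.
Context {R : realType} {d : nat}.
Implicit Types (A : set 'rV[R]_d) (c x : 'rV[R]_d).

Lemma rd_borel_measurable A : measurable A -> measurable (A : set (Rd R d)).
Proof.
move=> mA; apply: (@sub_caratheodory _ 'rV[R]_d R (borel_lebesgue R d)).
exact: sub_sigma_algebra.
Qed.

Lemma rd_measurable_coord (i : 'I_d) :
  measurable_fun setT (fun x : Rd R d => (x : 'rV[R]_d) ord0 i).
Proof.
move=> _ Y mY; rewrite setTI; apply: rd_borel_measurable.
rewrite -[X in measurable X]setTI.
exact: (@measurable_rV_coord R d i).
Qed.

Lemma rd_box_measurable (A : 'I_d -> set R) : (forall i, measurable (A i)) ->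
  measurable ([set x : 'rV[R]_d | forall i, A i (x ord0 i)] : set (Rd R d)).
Proof.
move=> mA.
rewrite (_ : [set x | _] =
    \bigcap_(i in [set: 'I_d]) ((fun x : Rd R d => (x : 'rV[R]_d) ord0 i) @^-1` A i)).
  apply: fin_bigcap_measurable => // i _.
  rewrite -[X in measurable X]setTI; exact: rd_measurable_coord.
by apply/seteqP; split=> [x Bx i _|x Bx i]; [exact: Bx|exact: (Bx i I)].
Qed.

(** An open set is the union of the boxes with rational centre and inverse
    integer radius that it contains. *)
Lemma rd_open_measurable A : open A -> measurable (A : set (Rd R d)).
Proof.
move=> oA.
pose B (u : 'rV[rat]_d * nat) : set 'rV[R]_d :=
  [set x : 'rV[R]_d | forall i, `|x ord0 i - ratr (u.1 ord0 i)| < u.2.+1%:R^-1].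
pose F u := if asbool (B u `<=` A) then B u else set0.
have -> : A = \bigcup_u F u.
  apply/seteqP; split=> x; last first.
    by move=> [u _]; rewrite /F; case: asboolP => // /[apply].
  move=> Ax; have /nbhs_ballP[e /= e0 eA] : nbhs x A by exact: open_nbhs_nbhs.
  have [n _ /(_ n (leqnn n)) ne] : \forall n \near \oo, (n.+1%:R^-1 : R) < e / 2.
    by apply: near_infty_natSinv_lt (PosNum _); rewrite divr_gt0.
  have H i : exists q : rat, `|x ord0 i - ratr q| < n.+1%:R^-1.
    have [q] : exists q : rat, ratr q \in `]x ord0 i - n.+1%:R^-1, x ord0 i[.
      by apply: rat_in_itvoo; rewrite ltrBlDr ltrDl invr_gt0.
    rewrite in_itv/= => /andP[q1 q2]; exists q.
    by rewrite gtr0_norm ?subr_gt0// ltrBlDl -ltrBlDr.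
  have [f Hf] := choice H.
  exists (\row_i f i, n) => //=; rewrite /F asboolT.
    by move=> i; rewrite mxE; exact: Hf.
  move=> y By; apply: eA; rewrite -ball_normE/=.
  apply/rV_norm_ltP => // i; rewrite !mxE.
  have h1 := Hf i.
  have h2 : `|y ord0 i - ratr (f i)| < n.+1%:R^-1 by have := By i; rewrite /= mxE.
  rewrite (_ : x ord0 i - y ord0 i =
    (x ord0 i - ratr (f i)) - (y ord0 i - ratr (f i))); last by ring.
  rewrite (le_lt_trans (ler_normB _ _))//.
  by rewrite [ltRHS]splitr; apply: ltrD; [exact: lt_trans ne|exact: lt_trans ne].
have cU : countable [set: 'rV[rat]_d * nat] by exact: countableP.
apply: (@countable_bigcupT_measurable _ (Rd R d) _ F cU).
move=> u; rewrite /F; case: asboolP => // _.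
pose J i : set R := `]ratr (u.1 ord0 i) - u.2.+1%:R^-1, ratr (u.1 ord0 i) + u.2.+1%:R^-1[%classic.
rewrite (_ : B u = [set x : 'rV[R]_d | forall i, J i (x ord0 i)]).
  by apply: rd_box_measurable => i; exact: measurable_itv.
by apply/seteqP; split=> y By i; have := By i; rewrite /J /= in_itv/= ltr_distl.
Qed.

Lemma rd_continuous_measurable (f : 'rV[R]_d -> R) : continuous f ->
  measurable_fun setT (f : Rd R d -> R).
Proof.
move=> cf.
apply: (measurability _ (RGenOpens.measurableE R)).
move=> _ [_ [a [b ->] <-]]; rewrite setTI.
apply: rd_open_measurable; move/continuousP : cf; apply.
exact: interval_open.
Qed.

Lemma rd_lower_semicontinuous_measurable (f : 'rV[R]_d -> \bar R) :
  (forall a : R, open [set x | (a%:E < f x)%E]) ->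
  measurable_fun setT (f : Rd R d -> \bar R).
Proof.
move=> fo; apply: (measurability _ (ErealGenOInfty.measurableE R)).
move=> /= _ [_ [a ->]] <-; rewrite setTI preimage_itvoy.
exact: rd_open_measurable.
Qed.

Lemma rd_closed_cube_measurable c (l : R) :
  measurable ([set x : 'rV[R]_d | forall i, c ord0 i <= x ord0 i <= c ord0 i + l]
    : set (Rd R d)).
Proof.
rewrite (_ : [set x | _] =
  [set x : 'rV[R]_d | forall i, `[c ord0 i, c ord0 i + l]%classic (x ord0 i)]).
  by apply: (@rd_box_measurable (fun i => `[c ord0 i, c ord0 i + l]%classic)) => i;
    exact: measurable_itv.
by apply/seteqP; split=> x Bx i; have := Bx i; rewrite /= in_itv.
Qed.

Lemma leb_closed_cube c (l : R) : 0 <= l ->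
  leb R d [set x : 'rV[R]_d | forall i, c ord0 i <= x ord0 i <= c ord0 i + l]
    = (l ^+ d)%:E.
Proof.
move=> l0; rewrite (_ : [set x | _] =
  [set x : 'rV[R]_d | forall i, `[c ord0 i, c ord0 i + l]%classic (x ord0 i)]).
  rewrite (@leb_box R d (fun i => `[c ord0 i, c ord0 i + l]%classic))//.
  rewrite (eq_bigr (fun=> l%:E)) ?prodEFin ?prodr_const ?card_ord// => i _.
  rewrite lebesgue_measure_itv/= lte_fin ltrDl.
  case: (ltgtP 0 l) l0 => // [l0|<-] _; rewrite -?EFinB; congr EFin; ring.
by apply/seteqP; split=> x Bx i; have := Bx i; rewrite /= in_itv.
Qed.

Lemma closed_ball_cubeE c (r : R) : 0 <= r -> [set x : 'rV[R]_d | `|x - c| <= r] =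
  [set x : 'rV[R]_d | forall i, (c - const_mx r) ord0 i <= x ord0 i
     <= (c - const_mx r) ord0 i + 2 * r].
Proof.
move=> r0; apply/seteqP; split=> x /=.
  move=> /(rV_norm_leP _ r0) H i; have := H i; rewrite !mxE ler_norml; lra.
move=> H; apply/(rV_norm_leP _ r0) => i; have := H i; rewrite !mxE ler_norml; lra.
Qed.

Lemma rd_closed_ball_measurable c (r : R) : 0 <= r ->
  measurable ([set x : 'rV[R]_d | `|x - c| <= r] : set (Rd R d)).
Proof. by move=> r0; rewrite closed_ball_cubeE//; exact: rd_closed_cube_measurable. Qed.

Lemma leb_closed_ball c (r : R) : 0 <= r ->
  leb R d [set x : 'rV[R]_d | `|x - c| <= r] = ((2 * r) ^+ d)%:E.
Proof. by move=> r0; rewrite closed_ball_cubeE// leb_closed_cube ?mulr_ge0. Qed.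

Lemma unit_cubeE (k : 'rV[int]_d) : unit_cube k =
  [set x : 'rV[R]_d | forall i, `[(k ord0 i)%:~R, (k ord0 i)%:~R + 1[%classic (x ord0 i)].
Proof. by apply/seteqP; split=> x Bx i; have := Bx i; rewrite /= in_itv. Qed.

Lemma rd_unit_cube_measurable (k : 'rV[int]_d) :
  measurable (unit_cube k : set (Rd R d)).
Proof.
rewrite unit_cubeE.
by apply: (@rd_box_measurable (fun i => `[(k ord0 i)%:~R, (k ord0 i)%:~R + 1[%classic)) => i;
  exact: measurable_itv.
Qed.

Lemma leb_unit_cube (k : 'rV[int]_d) : leb R d (unit_cube k) = 1%E.
Proof.
rewrite unit_cubeE.
rewrite (@leb_box R d (fun i => `[(k ord0 i)%:~R, (k ord0 i)%:~R + 1[%classic))//.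
rewrite big1// => i _; rewrite lebesgue_measure_itv/= lte_fin ltrDl ltr01 -EFinB; congr EFin; ring.
Qed.

Lemma unit_cube_floor x : unit_cube (\row_i Num.floor (x ord0 i)) x.
Proof. by move=> i; rewrite mxE; have := floor_itv (x ord0 i); rewrite intrD. Qed.

End rd_measure.

Section lebesgue_integral.
Context {R : realType} {d : nat}.
Implicit Types (A D : set 'rV[R]_d) (f g : 'rV[R]_d -> R) (u v : 'rV[R]_d -> \bar R).

(** The types [Rd R d] and ['rV[R]_d] are convertible but carry the Lebesgue and
    the Borel sigma-algebra; these predicates fix the former for plain sets and
    functions of a row vector. *)
Definition mset D := measurable (D : set (Rd R d)).
Definition mfun f := measurable_fun (setT : set (Rd R d)) (f : Rd R d -> R).
Definition emfun u := measurable_fun (setT : set (Rd R d)) (u : Rd R d -> \bar R).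

Lemma msetT : mset setT. Proof. exact: measurableT. Qed.

Lemma mset_unit_cube (k : 'rV[int]_d) : mset (unit_cube k).
Proof. exact: rd_unit_cube_measurable. Qed.

Lemma mfun_cst (c : R) : mfun (fun=> c). Proof. exact: measurable_cst. Qed.

Lemma mfun_continuous f : continuous f -> mfun f.
Proof. exact: rd_continuous_measurable. Qed.

Lemma mfunD f g : mfun f -> mfun g -> mfun (fun x => f x + g x).
Proof. exact: measurable_funD. Qed.

Lemma mfunN f : mfun f -> mfun (fun x => - f x).
Proof. by move=> mf; apply: (measurableT_comp _ mf); exact: oppr_measurable. Qed.

Lemma mfunB f g : mfun f -> mfun g -> mfun (fun x => f x - g x).
Proof. by move=> mf mg; apply: mfunD => //; exact: mfunN. Qed.

Lemma mfunM f g : mfun f -> mfun g -> mfun (fun x => f x * g x).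
Proof. exact: measurable_funM. Qed.

Lemma mfunZ (c : R) f : mfun f -> mfun (fun x => c * f x).
Proof. by apply: mfunM; exact: mfun_cst. Qed.

Lemma mfunX n f : mfun f -> mfun (fun x => f x ^+ n).
Proof. exact: measurable_funX. Qed.

Lemma mfun_norm f : mfun f -> mfun (fun x => `|f x|).
Proof. by move=> mf; apply: (measurableT_comp _ mf); exact: normr_measurable. Qed.

Lemma mfun_powR (q : R) f : mfun f -> mfun (fun x => f x `^ q).
Proof. exact: measurableT_comp (measurable_powR q). Qed.

Lemma mfun_indic A : mset A -> mfun (\1_A).
Proof. by move=> mA; exact: (@measurable_indic _ (Rd R d) R setT A mA). Qed.

Lemma mfun_sum (I : eqType) (s : seq I) (h : I -> 'rV[R]_d -> R) :
  {in s, forall i, mfun (h i)} -> mfun (fun x => \sum_(i <- s) h i x).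
Proof.
elim: s => [|i s IH] mh.
  rewrite (_ : (fun x => _) = cst 0); first exact: mfun_cst.
  by apply/funext => x; rewrite big_nil.
rewrite (_ : (fun x => _) = (fun x => h i x + \sum_(i <- s) h i x)); last first.
  by apply/funext => x; rewrite big_cons.
apply: mfunD; first by apply: mh; rewrite mem_head.
by apply: IH => k ks; apply: mh; rewrite inE ks orbT.
Qed.

Lemma emfun_EFin f : mfun f -> emfun (fun x => (f x)%:E).
Proof. exact: measurableT_comp. Qed.

Lemma emfun_poweR (q : R) u : emfun u -> emfun (fun x => u x `^ q)%E.
Proof. exact: measurableT_comp (measurable_poweR q). Qed.

Lemma emfunD u v : emfun u -> emfun v -> emfun (fun x => u x + v x)%E.
Proof. exact: emeasurable_funD. Qed.

Lemma emfunM u v : emfun u -> emfun v -> emfun (fun x => u x * v x)%E.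
Proof. exact: emeasurable_funM. Qed.

Lemma emfun_series (h : nat -> 'rV[R]_d -> \bar R) :
  (forall n x, 0 <= h n x)%E -> (forall n, emfun (h n)) ->
  emfun (fun x => \sum_(0 <= n <oo) h n x)%E.
Proof.
by move=> h0 mh; apply: (@ge0_emeasurable_sum _ (Rd R d) R setT h xpredT) => n *;
  [exact: h0|exact: mh].
Qed.

Lemma emfun_on D u : emfun u -> measurable_fun (D : set (Rd R d)) (u : Rd R d -> \bar R).
Proof. exact: measurable_funTS. Qed.

Lemma int_le D u v : mset D -> (forall x, 0 <= u x)%E -> emfun u -> emfun v ->
  (forall x, D x -> u x <= v x)%E ->
  (\int[leb R d]_(x in D) u x <= \int[leb R d]_(x in D) v x)%E.
Proof.
move=> mD u0 mu mv uv.
by apply: (@ge0_le_integral _ (Rd R d) R (leb R d) D mD u v) => [x _||| ];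
  [exact: u0|exact: emfun_on|exact: emfun_on|exact: uv].
Qed.

Lemma intZl D u (k : R) : mset D -> (forall x, 0 <= u x)%E -> emfun u -> 0 <= k ->
  (\int[leb R d]_(x in D) (k%:E * u x) = k%:E * \int[leb R d]_(x in D) u x)%E.
Proof.
move=> mD u0 mu k0.
by apply: (@ge0_integralZl_EFin _ (Rd R d) R (leb R d) D mD u) => [x _|| ];
  [exact: u0|exact: emfun_on|exact: k0].
Qed.

Lemma intD D u v : mset D -> (forall x, 0 <= u x)%E -> emfun u ->
  (forall x, 0 <= v x)%E -> emfun v ->
  (\int[leb R d]_(x in D) (u x + v x) =
   \int[leb R d]_(x in D) u x + \int[leb R d]_(x in D) v x)%E.
Proof.
move=> mD u0 mu v0 mv.
by apply: (@ge0_integralD _ (Rd R d) R (leb R d) D mD u v) => [x _||x _|];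
  [exact: u0|exact: emfun_on|exact: v0|exact: emfun_on].
Qed.

Lemma int_ge0 D u : (forall x, 0 <= u x)%E -> (0 <= \int[leb R d]_(x in D) u x)%E.
Proof. by move=> u0; apply: integral_ge0 => x _; exact: u0. Qed.

Lemma int_sum (I : eqType) (s : seq I) D (h : I -> 'rV[R]_d -> R) : mset D ->
  {in s, forall i, mfun (h i)} -> {in s, forall i x, 0 <= h i x} ->
  (\int[leb R d]_(x in D) (\sum_(i <- s) h i x)%:E =
    \sum_(i <- s) \int[leb R d]_(x in D) (h i x)%:E)%E.
Proof.
move=> mD; elim: s => [|i s IH] mh h0.
  rewrite big_nil; under eq_integral do rewrite big_nil; exact: integral0.
rewrite big_cons; under eq_integral do rewrite big_cons EFinD.
have mh' : {in s, forall i, mfun (h i)}.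
  by move=> k ks; apply: mh; rewrite inE ks orbT.
have h0' : {in s, forall i x, 0 <= h i x}.
  by move=> k ks; apply: h0; rewrite inE ks orbT.
rewrite intD.
- by rewrite IH.
- exact: mD.
- by move=> x; rewrite lee_fin h0// mem_head.
- by apply: emfun_EFin; apply: mh; rewrite mem_head.
- by move=> x; rewrite lee_fin big_seq sumr_ge0// => k ks; exact: h0'.
- by apply: emfun_EFin; exact: mfun_sum.
Qed.

Lemma int_indic D A : mset D -> mset A ->
  (\int[leb R d]_(x in D) (\1_A x)%:E = leb R d (A `&` D))%E.
Proof. by move=> mD mA; exact: (@integral_indic _ (Rd R d) R (leb R d) D mD A mA). Qed.

Lemma int_cst D (c : \bar R) : mset D ->
  (\int[leb R d]_(x in D) c = c * leb R d D)%E.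
Proof. by move=> mD; exact: (@integral_cst _ (Rd R d) R (leb R d) D mD c). Qed.

Lemma int_subset A D u : mset A -> mset D -> emfun u -> (forall x, 0 <= u x)%E ->
  A `<=` D -> (\int[leb R d]_(x in A) u x <= \int[leb R d]_(x in D) u x)%E.
Proof.
move=> mA mD mu u0 AD.
by apply: (@ge0_subset_integral _ (Rd R d) R (leb R d) A D mA mD) => [|x _|];
  [exact: emfun_on|exact: u0|exact: AD].
Qed.

Lemma int_mkcond D u : (\int[leb R d]_(x in D) u x =
  \int[leb R d]_x (u x * (\1_D x)%:E))%E.
Proof.
rewrite integral_mkcond; apply: eq_integral => x _.
by rewrite patchE indicE; case: ifP => _; rewrite ?mule1 ?mule0.
Qed.

Lemma int_series D (h : nat -> 'rV[R]_d -> \bar R) : mset D ->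
  (forall n, emfun (h n)) -> (forall n x, 0 <= h n x)%E ->
  (\int[leb R d]_(x in D) (\sum_(0 <= n <oo) h n x) =
   \sum_(0 <= n <oo) \int[leb R d]_(x in D) h n x)%E.
Proof.
move=> mD mh h0; apply: (@integral_nneseries _ (Rd R d) R (leb R d) D mD h) => [n|n x _].
- exact: emfun_on.
- exact: h0.
Qed.

End lebesgue_integral.

(** * Sums of cube tails against sums of cubes *)

Section powR_inequalities.
Context {R : realType}.
Implicit Types s t q : R.

Lemma powR_le_base (r : R) s t : 0 <= r -> 0 <= s -> s <= t -> s `^ r <= t `^ r.
Proof. by move=> r0 s0 st; rewrite ge0_ler_powR ?nnegrE// (le_trans s0). Qed.

Lemma powRV (r : R) t : 0 <= t -> t^-1 `^ r = (t `^ r)^-1.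
Proof. by move=> t0; rewrite -powR_inv1// -powRrM mulN1r powRN. Qed.

(** Bernoulli's inequality for exponents at most 1, from Young's inequality
    applied to [x `^ q * 1]. *)
Lemma powR_le_tangent1 q t : 0 < q -> q <= 1 -> 0 <= t ->
  t `^ q <= 1 + q * (t - 1).
Proof.
move=> q0 q1 t0; case: (ltgtP q 1) q1 => // [q1 _|-> _]; last by rewrite powRr1//; lra.
have q1' : 0 < 1 - q by lra.
have := @conjugate_powR R (t `^ q) 1 q^-1 (1 - q)^-1 (powR_ge0 _ _) ler01.
rewrite !invr_gt0 !invrK => /(_ q0 q1').
rewrite -powRrM divff ?gt_eqF// powRr1// powR1 mulr1 => H.
have : t `^ q <= t * q + 1 * (1 - q) by apply: H; lra.
lra.
Qed.

(** As [t `^ q] is concave, its increments are comparable with [t `^ (q - 1)]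
    times the increments of [t]. With the next lemma, this replaces the power of
    a sum by a telescoping sum in which each term enters linearly. *)
Lemma powRB_le q s t : 0 < q -> q <= 1 -> 0 <= s <= t -> 0 < t ->
  t `^ q - s `^ q <= (t - s) * t `^ (q - 1).
Proof.
move=> q0 q1 /andP[s0 st] t0.
rewrite mulrBl (mulr_powRB1 (ltW t0) q0) lerD2l lerN2.
have [->|s_neq0] := eqVneq s 0.
  by rewrite mul0r powR_ge0.
have {s_neq0}s0 : 0 < s by rewrite lt_neqAle eq_sym s_neq0.
rewrite -[leRHS](mulr_powRB1 (ltW s0) q0) ler_pM2l//.
rewrite -(opprB 1 q) !powRN lef_pV2 ?posrE ?powR_gt0//.
by apply: powR_le_base; rewrite ?subr_ge0// ltW.
Qed.

Lemma powRB_ge q s t : 0 < q -> q <= 1 -> 0 <= s <= t -> 0 < t ->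
  q * ((t - s) * t `^ (q - 1)) <= t `^ q - s `^ q.
Proof.
move=> q0 q1 /andP[s0 st] t0.
have x0 : 0 <= s / t by rewrite divr_ge0// ltW.
have := powR_le_tangent1 q0 q1 x0.
rewrite powRM ?invr_ge0 ?(ltW t0)//.
have tq0 : 0 < t `^ q by rewrite powR_gt0.
rewrite (powRV q (ltW t0)) ler_pdivrMr// => H.
rewrite -(mulr_powRB1 (ltW t0) q0) in H *.
have -> : q * ((t - s) * t `^ (q - 1)) =
  - (q * (s / t - 1) * (t * t `^ (q - 1))) by field; rewrite gt_eqF.
lra.
Qed.

Lemma powR_le_anti q s t : q <= 1 -> 0 < s -> s <= t -> t `^ (q - 1) <= s `^ (q - 1).
Proof.
move=> q1 s0 st; have t0 : 0 < t by exact: lt_le_trans st.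
rewrite -(opprB 1 q) !powRN lef_pV2 ?posrE ?powR_gt0//.
by apply: powR_le_base; rewrite ?subr_ge0// ltW.
Qed.

End powR_inequalities.

Section tails.
Context {R : realType} {d : nat}.
Implicit Types (c x : 'rV[R]_d) (l b : R) (s : seq (R * ('rV[R]_d * R))).

Definition cube c l : set 'rV[R]_d :=
  [set x : 'rV[R]_d | forall i, c ord0 i <= x ord0 i <= c ord0 i + l].

(** Comparable with the power [N / d] of the Hardy-Littlewood maximal function
    of the indicator of [cube c l]. *)
Definition tail N c l x : R := (l / (l + `|x - c|)) ^+ N.

Lemma tail_gt0 N c l x : 0 < l -> 0 < tail N c l x.
Proof. by move=> l0; rewrite exprn_gt0// divr_gt0// ltr_pwDl. Qed.

Lemma tail_le1 N c l x : 0 < l -> tail N c l x <= 1.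
Proof.
move=> l0; rewrite exprn_ile1// ?divr_ge0 ?addr_ge0 ?(ltW l0)//.
by rewrite ler_pdivrMr ?mul1r ?lerDl// ltr_pwDl.
Qed.

Lemma cubes_meet_corners c c' l l' x : l <= l' ->
  0 <= l -> cube c l x -> cube c' l' x -> `|c - c'| <= l'.
Proof.
move=> ll' l0 cx cx'; apply/rV_norm_leP; first exact: le_trans ll'.
move=> i; rewrite !mxE ler_norml; have := cx i; have := cx' i; lra.
Qed.

(** The tail of a cube is dominated by the tail of any larger cube that it
    meets. *)
Lemma tail_le_larger N c c' l l' x : 0 < l -> l <= l' ->
  cube c l `&` cube c' l' !=set0 -> tail N c l x <= 2 ^+ N * tail N c' l' x.
Proof.
move=> l0 ll' [y [cy cy']].
have cc' := cubes_meet_corners ll' (ltW l0) cy cy'.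
have l'0 : 0 < l' by exact: lt_le_trans ll'.
have lx : 0 < l + `|x - c| by rewrite ltr_pwDl.
have lx' : 0 < l' + `|x - c'| by rewrite ltr_pwDl.
rewrite -exprMn; apply: lerXn2r;
  rewrite ?nnegrE ?mulr_ge0 ?invr_ge0 ?(ltW l0) ?(ltW l'0) ?(ltW lx) ?(ltW lx')//.
rewrite ler_pdivrMr// (_ : 2 * _ * _ =
  l' * (2 * (l + `|x - c|)) / (l' + `|x - c'|)); last by ring.
rewrite ler_pdivlMr//.
have H : `|x - c'| <= `|x - c| + l'.
  by rewrite -(subrKA c) (le_trans (ler_normD _ _))// lerD2l.
apply: (@le_trans _ _ (l * (2 * l' + `|x - c|))); first by apply: ler_wpM2l; lra.
have := normr_ge0 (x - c); nra.
Qed.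

Definition tail_sum N s x : R := \sum_(k <- s) k.1 * tail N k.2.1 k.2.2 x.

Definition cube_sum s x : R := \sum_(k <- s) k.1 * \1_(cube k.2.1 k.2.2) x.

(** The total coefficient of the cubes that meet a given one bounds the sum of
    those cubes from above on the given one, and, as their tails dominate
    its tail, bounds the sum of the tails from below everywhere. *)
Definition touching_mass (k : R * ('rV[R]_d * R)) s : R :=
  \sum_(i <- s | `[< cube k.2.1 k.2.2 `&` cube i.2.1 i.2.2 !=set0 >]) i.1.

(** Adding a cube with coefficient [k.1] to a sum with value [S] changes its
    power [q] by about [k.1 * S `^ (q - 1)]; the touching mass of the cube with
    the larger ones stands for [S], which makes the change independent of the
    point. *)
Fixpoint reweighted q s : seq (R * ('rV[R]_d * R)) :=
  if s is k :: s' then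
    (k.1 * touching_mass k s `^ (q - 1), k.2) :: reweighted q s'
  else [::].

Definition proper_family s := all (fun k => (0 <= k.1) && (0 < k.2.2)) s.

Lemma proper_mem s k : proper_family s -> k \in s -> 0 <= k.1 /\ 0 < k.2.2.
Proof. by move=> /allP /[apply] /andP. Qed.

Lemma reweighted_proper q s : proper_family s -> proper_family (reweighted q s).
Proof.
elim: s => //= k s IH /andP[/andP[k1 k2] /IH ->].
by rewrite k2 mulr_ge0// powR_ge0.
Qed.

Lemma tail_sum_ge0 N s x : proper_family s -> 0 <= tail_sum N s x.
Proof.
move=> /allP s0; rewrite /tail_sum big_seq sumr_ge0// => k /s0 /andP[k1 k2].
by rewrite mulr_ge0// ltW// tail_gt0.
Qed.

Lemma cube_sum_ge0 s x : proper_family s -> 0 <= cube_sum s x.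
Proof.
move=> /allP s0; rewrite /cube_sum big_seq sumr_ge0// => k /s0 /andP[k1 k2].
by rewrite mulr_ge0.
Qed.

Section sorted_family.
Variable q : R.
Hypotheses (q_gt0 : 0 < q) (q_le1 : q <= 1).
Let smaller := fun k i : R * ('rV[R]_d * R) => k.2.2 <= i.2.2.

Let smaller_all k s : sorted smaller (k :: s) -> forall i, i \in s -> k.2.2 <= i.2.2.
Proof.
have tr : transitive smaller by move=> a b c; exact: le_trans.
by move=> /= /(order_path_min tr)/allP.
Qed.

Lemma touching_mass_head k s : proper_family (k :: s) -> k.1 <= touching_mass k (k :: s).
Proof.
move=> /= /andP[/andP[k1 k2] s0]; rewrite /touching_mass big_cons asboolT.
  rewrite lerDl big_seq_cond sumr_ge0// => i /andP[si _].
  by have [] := proper_mem s0 si.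
by exists k.2.1; split=> i; lra.
Qed.

(** The cubes are added in decreasing order of size. At each step the sum of the
    tails is at least a constant times the new tail times the touching mass, and
    the exponent [q - 1] is nonpositive. *)
Lemma tail_sum_powR_le N s x : proper_family s -> sorted smaller s ->
  tail_sum N s x `^ q <=
    2 ^+ N * \sum_(k <- reweighted q s) k.1 * tail N k.2.1 k.2.2 x `^ q.
Proof.
elim: s => [|k s IH] ks0 kss.
  by rewrite /tail_sum !big_nil powR0 ?mulr0// gt_eqF.
have /= /andP[/andP[k0 l0] s0] := ks0.
rewrite /= big_cons/= mulrDr.
have {}IH := IH s0 (path_sorted kss).
have [k_eq0|k_neq0] := eqVneq k.1 0.
  by rewrite /tail_sum big_cons k_eq0 !mul0r mulr0 !add0r.
have {k_neq0}k_gt0 : 0 < k.1 by rewrite lt_neqAle eq_sym k_neq0.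
set g := tail N k.2.1 k.2.2 x; set S := touching_mass k (k :: s).
have g0 : 0 < g by exact: tail_gt0.
have S0 : 0 < S by rewrite (lt_le_trans k_gt0)// touching_mass_head.
have FE : tail_sum N (k :: s) x = k.1 * g + tail_sum N s x.
  by rewrite /tail_sum big_cons.
have F0 : 0 < tail_sum N (k :: s) x.
  by rewrite FE ltr_pwDl ?mulr_gt0// tail_sum_ge0.
have := @powRB_le _ q (tail_sum N s x) (tail_sum N (k :: s) x) q_gt0 q_le1.
rewrite tail_sum_ge0// {1}FE lerDr mulr_ge0 ?(ltW g0)// => /(_ isT F0).
rewrite {2}FE addrK lerBlDr => /le_trans; apply; rewrite lerD// {IH}.
have gS : (2 ^+ N)^-1 * (g * S) <= tail_sum N (k :: s) x.
  rewrite mulrC ler_pdivrMr ?exprn_gt0// /tail_sum /S /touching_mass.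
  rewrite mulr_sumr mulr_suml big_mkcond/=.
  rewrite [leLHS]big_seq [leRHS]big_seq ler_sum// => i iks.
  have [i0 il] := proper_mem ks0 iks.
  case: asboolP => [ki|_]; last by rewrite !mulr_ge0// ltW// tail_gt0.
  rewrite mulrC -mulrA ler_wpM2l// mulrC; apply: tail_le_larger => //.
  move: iks; rewrite inE => /predU1P[->//|]; exact: smaller_all.
have c0 : 0 < (2 ^+ N)^-1 * (g * S) by rewrite !mulr_gt0// invr_gt0 exprn_gt0.
apply: (@le_trans _ _ (k.1 * g * ((2 ^+ N)^-1 * (g * S)) `^ (q - 1))).
  by apply: ler_wpM2l; [rewrite mulr_ge0// ltW|exact: powR_le_anti].
have pow2 : 0 <= (2 ^+ N : R)^-1 by rewrite invr_ge0 exprn_ge0.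
rewrite !powRM ?(ltW g0) ?(ltW S0) ?mulr_ge0 ?(ltW g0) ?(ltW S0)//.
have -> : k.1 * g * ((2 ^+ N)^-1 `^ (q - 1) * (g `^ (q - 1) * S `^ (q - 1))) =
   (2 ^+ N)^-1 `^ (q - 1) * (k.1 * S `^ (q - 1) * (g * g `^ (q - 1))) by ring.
rewrite (mulr_powRB1 (ltW g0) q_gt0) ler_wpM2r ?mulr_ge0 ?powR_ge0// -powR_inv1 ?exprn_ge0//.
rewrite -powRrM mulN1r opprB -[leRHS]powRr1 ?exprn_ge0//.
by apply: ler_powR; [rewrite exprn_ege1 ?ler1n|rewrite gerBl ltW].
Qed.

(** On the new cube, the sum of the indicators is at most the touching mass, so
    that the same weights are now bounded by the increments of the power [q]. *)
Lemma reweighted_cube_sum_le s x : proper_family s -> sorted smaller s ->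
  q * cube_sum (reweighted q s) x <= cube_sum s x `^ q.
Proof.
elim: s => [|k s IH] ks0 kss.
  by rewrite /cube_sum/= !big_nil mulr0 powR_ge0.
have /= /andP[/andP[k0 l0] s0] := ks0.
have {}IH := IH s0 (path_sorted kss).
rewrite /= /cube_sum !big_cons /= -!/(cube_sum _ _) indicE.
case: (boolP (x \in _)) => xk; last by rewrite !mulr0 !add0r.
rewrite !mulr1; set S := touching_mass k (k :: s).
have [k_eq0|k_neq0] := eqVneq k.1 0; first by rewrite k_eq0 mul0r !add0r.
have {k_neq0}k_gt0 : 0 < k.1 by rewrite lt_neqAle eq_sym k_neq0.
set T := cube_sum s x in IH *.
have T0 : 0 <= T by exact: cube_sum_ge0.
have kT0 : 0 < k.1 + T by rewrite ltr_pwDl.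
have TS : k.1 + T <= S.
  have -> : k.1 + T = cube_sum (k :: s) x.
    by rewrite /cube_sum big_cons indicE xk mulr1.
  rewrite /cube_sum /S /touching_mass [leRHS]big_mkcond/=.
  rewrite [leLHS]big_seq [leRHS]big_seq ler_sum// => i iks.
  have [i0 il] := proper_mem ks0 iks.
  rewrite indicE; case: (boolP (x \in _)) => xi; last first.
    by rewrite mulr0; case: ifP.
  rewrite mulr1 asboolT//; exists x.
  by rewrite inE in xi; rewrite inE in xk.
have := @powRB_ge _ q T (k.1 + T) q_gt0 q_le1.
rewrite T0 lerDr (ltW k_gt0) => /(_ isT kT0); rewrite addrK => H.
have : k.1 * S `^ (q - 1) <= k.1 * (k.1 + T) `^ (q - 1).
  by rewrite ler_wpM2l//; exact: powR_le_anti.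
move/(ler_wpM2l (ltW q_gt0)); rewrite mulrDr; lra.
Qed.

End sorted_family.
End tails.

Section tail_integral.
Context {R : realType} {d : nat}.
Implicit Types (c x : 'rV[R]_d) (l b : R) (s : seq (R * ('rV[R]_d * R))).

Lemma mset_cube c l : mset (cube c l).
Proof. exact: rd_closed_cube_measurable. Qed.

Lemma mset_ball c l : 0 <= l -> mset [set x : 'rV[R]_d | `|x - c| <= l].
Proof. exact: rd_closed_ball_measurable. Qed.

Lemma leb_cube c l : 0 <= l -> leb R d (cube c l) = (l ^+ d)%:E.
Proof. exact: leb_closed_cube. Qed.

Lemma dist_continuous c : continuous (fun x : 'rV[R]_d => `|x - c|).
Proof.
move=> x; apply/(@cvgrPdist_le _ _ _ (nbhs x) (nbhs_filter x)) => e e0.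
apply/nbhs_ballP; exists e => //= y.
rewrite -ball_normE/= => xy; rewrite (le_trans (ler_dist_dist _ _))//.
by rewrite opprB addrA subrK ltW.
Qed.

Lemma tail_continuous N c l : 0 < l -> continuous (tail N c l : 'rV[R]_d -> R).
Proof.
move=> l0 x.
apply: (@continuous_comp _ _ _ (fun x => `|x - c|) (fun r => (l / (l + r)) ^+ N)).
  exact: dist_continuous.
apply: (@continuous_comp _ _ _ (fun r => l / (l + r)) (fun u => u ^+ N)); last first.
  exact: exprn_continuous.
apply: cvgM; first exact: cvg_cst.
apply: cvgV; first by rewrite gt_eqF// ltr_pwDl.
by apply: cvgD; [exact: cvg_cst|exact: cvg_id].
Qed.

Lemma mfun_tail N c l : 0 < l -> mfun (tail N c l).
Proof. by move=> l0; apply: mfun_continuous; exact: (tail_continuous l0). Qed.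

Lemma tail_powR N c l x (q : R) : 0 < l ->
  tail N c l x `^ q = (l / (l + `|x - c|)) `^ (N%:R * q).
Proof.
by move=> l0; rewrite powRrM powR_mulrn// divr_ge0 ?addr_ge0// ltW.
Qed.

Lemma mfun_tail_powR c l (sigma : R) : 0 < l ->
  mfun (fun x => (l / (l + `|x - c|)) `^ sigma).
Proof. by move=> l0; apply: mfun_powR; exact: (mfun_tail 1 c l0). Qed.

Lemma nneseries_le (u : nat -> \bar R) (B : \bar R) :
  (forall n, 0 <= u n)%E -> (forall n, \sum_(0 <= i < n) u i <= B)%E ->
  (\sum_(0 <= i <oo) u i <= B)%E.
Proof.
move=> u0 uB; apply: lime_le; first exact: is_cvg_nneseries.
by apply: nearW => n; exact: uB.
Qed.

(** Splitting R^d into the dyadic shells around a cube, on which its tail is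
    comparable to a constant, reduces the integral to a geometric series. *)
Lemma integral_tail_powR_le (sigma : R) : d%:R < sigma ->
  exists2 C : R, 0 < C & forall c l, 0 < l ->
    (\int[leb R d]_x ((l / (l + `|x - c|)) `^ sigma)%:E <= (C * l ^+ d)%:E)%E.
Proof.
move=> ds.
have s0 : 0 < sigma by exact: le_lt_trans ds.
pose r : R := 2 `^ (d%:R - sigma).
have r0 : 0 < r by rewrite powR_gt0.
have r1 : r < 1.
  rewrite -(powRr0 2) /r /powR pnatr_eq0/= ltr_expR mul0r nmulr_rlt0 ?subr_lt0//.
  by rewrite ln_gt0// ltr1n.
exists (2 `^ sigma * 2 ^+ d / (1 - r)).
  by rewrite divr_gt0 ?subr_gt0// mulr_gt0 ?powR_gt0// exprn_gt0.
move=> c l l0.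
pose E i : set 'rV[R]_d := [set x | `|x - c| <= 2 ^+ i * l].
have Ei0 i : 0 <= 2 ^+ i * l :> R by rewrite mulr_ge0// ?exprn_ge0// ltW.
have mE i : mset (E i) by exact: mset_ball.
pose a i : R := 2 `^ sigma * (2 `^ (- sigma)) ^+ i.
have a0 i : 0 <= a i by rewrite mulr_ge0 ?exprn_ge0 ?powR_ge0.
pose u i (x : 'rV[R]_d) : \bar R := (a i * \1_(E i) x)%:E.
have u0 i x : (0 <= u i x)%E by rewrite lee_fin mulr_ge0.
have mI i : emfun (fun x => (\1_(E i) x)%:E) by apply: emfun_EFin; exact: mfun_indic.
have mu i : emfun (u i) by apply: emfun_EFin; apply: mfunZ; exact: mfun_indic.
have le_u x : (((l / (l + `|x - c|)) `^ sigma)%:E <= \sum_(0 <= i <oo) u i x)%E.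
  suff [i [xi fi]] : exists i, E i x /\ (l / (l + `|x - c|)) `^ sigma <= a i.
    apply: (@le_trans _ _ (u i x)).
      by rewrite /u indicE mem_set// mulr1 lee_fin.
    apply: le_trans (nneseries_lim_ge i.+1 _) => //.
    by rewrite big_nat_recr//= leeDr// sume_ge0.
  have [i Hi] : exists i, `|x - c| <= 2 ^+ i * l.
    exists (Num.trunc (`|x - c| / l)).+1.
    rewrite -ler_pdivrMr//; apply: (@le_trans _ _ (Num.trunc (`|x - c| / l)).+1%:R).
      by rewrite ltW// truncnS_gt.
    by rewrite -natrX ler_nat ltnW// ltn_expl.
  (* descent to the smallest box around [c] that contains [x] *)
  elim: i Hi => [|i IH] Hi.
    exists 0%N; split=> //; rewrite /a expr0 mulr1.
    apply: (@le_trans _ _ 1).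
      rewrite [leRHS](_ : 1 = 1 `^ sigma); last by rewrite powR1.
      apply: powR_le_base; first exact: ltW.
        by rewrite ltW// divr_gt0// ltr_pwDl.
      by rewrite ler_pdivrMr ?mul1r ?lerDl// ltr_pwDl.
    by rewrite -[leLHS](powRr0 2) ler_powR ?ler1n// ltW.
  have [/IH//|lt_i] := leP (`|x - c|) (2 ^+ i * l).
  exists i.+1; split=> //.
  have -> : a i.+1 = (2^-1 ^+ i) `^ sigma.
    rewrite /a exprS mulrA powRN mulfV ?gt_eqF ?powR_gt0// mul1r -powRV//.
    rewrite -powR_mulrn; last exact: powR_ge0.
    rewrite -[in RHS]powR_mulrn; last by rewrite invr_ge0.
    exact: powRAC.
  apply: powR_le_base; [exact: ltW|by rewrite divr_ge0 ?addr_ge0// ltW|].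
  rewrite exprVn ler_pdivrMr ?ltr_pwDl// mulrC ler_pdivlMr ?exprn_gt0//.
  by rewrite mulrC (le_trans (ltW lt_i))// lerDr ltW.
apply: (@le_trans _ _ (\int[leb R d]_x (\sum_(0 <= i <oo) u i x))%E).
  apply: int_le.
  - exact: msetT.
  - by move=> x; rewrite lee_fin powR_ge0.
  - by apply: emfun_EFin; exact: mfun_tail_powR.
  - exact: emfun_series.
  - by move=> x _; exact: le_u.
rewrite int_series; [|exact: msetT|exact: mu|exact: u0].
rewrite (@eq_eseriesr _ _ (fun n => (2 `^ sigma * 2 ^+ d * l ^+ d * r ^+ n)%:E)); last first.
  move=> n _; rewrite /u; under eq_integral do rewrite EFinM.
  rewrite intZl; [|exact: msetT|by move=> x; rewrite lee_fin|exact: mI|exact: a0].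
  rewrite int_indic ?setIT; [|exact: msetT|exact: mE].
  rewrite leb_closed_ball// -EFinM; congr EFin.
  rewrite /a /r powRD ?pnatr_eq0 ?implybT// powR_mulrn// !exprMn exprAC; ring.
apply: nneseries_le => [n|n].
  by rewrite lee_fin !mulr_ge0 ?exprn_ge0 ?powR_ge0// ltW.
rewrite sumEFin lee_fin -mulr_sumr.
have := @geometric_le_lim _ n 1 r ler01 r0.
rewrite gtr0_norm// => /(_ r1); rewrite /series/= mul1r => H.
under eq_bigr do rewrite -[_ ^+ _]mul1r.
apply: le_trans (ler_wpM2l _ H) _; last by rewrite le_eqVlt; apply/orP; left; apply/eqP; ring.
by rewrite !mulr_ge0 ?exprn_ge0 ?powR_ge0// ltW.
Qed.

Lemma mfun_tail_sum N s : proper_family s -> mfun (tail_sum N s).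
Proof.
by move=> s0; apply: mfun_sum => k /(proper_mem s0)[_ l0]; apply: mfunZ; exact: mfun_tail.
Qed.

Lemma mfun_cube_sum s : mfun (cube_sum s).
Proof.
by apply: mfun_sum => k _; apply: mfunZ; apply: mfun_indic; exact: mset_cube.
Qed.

(** The key estimate. Listing the cubes by size, the q-th powers of both sums
    are compared, one cube at a time, with the same reweighted family, whose
    tails to the power [q] and indicators have comparable integrals. *)
Lemma integral_tail_sum_le (N : nat) (q : R) :
  0 < q -> q <= 1 -> d%:R < N%:R * q ->
  exists2 C : R, 0 < C & forall s, proper_family s ->
    (\int[leb R d]_x (tail_sum N s x `^ q)%:E <=
      C%:E * \int[leb R d]_x (cube_sum s x `^ q)%:E)%E.
Proof.
move=> q0 q1 dN; have [C C0 HC] := integral_tail_powR_le dN.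
exists (2 ^+ N * C / q); first by rewrite divr_gt0// mulr_gt0// exprn_gt0.
move=> s0 ps0.
pose le2 := fun k i : R * ('rV[R]_d * R) => k.2.2 <= i.2.2.
pose s := sort le2 s0.
have ss0 : perm_eq s s0 by rewrite perm_sort.
have ps : proper_family s by rewrite /proper_family (perm_all _ ss0).
have sorts : sorted le2 s by apply: sort_sorted => k i; exact: le_total.
have -> : tail_sum N s0 = tail_sum N s.
  by apply/funext => x; rewrite /tail_sum (perm_big _ ss0).
have -> : cube_sum s0 = cube_sum s.
  by apply/funext => x; rewrite /cube_sum (perm_big _ ss0).
pose w := reweighted q s.
have pw : proper_family w by exact: reweighted_proper.
pose T k x : R := k.1 * tail N k.2.1 k.2.2 x `^ q.
have mT : {in w, forall k, mfun (T k)}.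
  move=> k /(proper_mem pw)[_ l0]; apply: mfunZ; apply: mfun_powR.
  exact: mfun_tail.
have T0 : {in w, forall k x, 0 <= T k x}.
  by move=> k /(proper_mem pw)[k0 _] x; rewrite mulr_ge0 ?powR_ge0.
pose I k (x : 'rV[R]_d) : R := k.1 * \1_(cube k.2.1 k.2.2) x.
have mI : {in w, forall k, mfun (I k)}.
  by move=> k _; apply: mfunZ; apply: mfun_indic; exact: mset_cube.
have I0 : {in w, forall k x, 0 <= I k x}.
  by move=> k /(proper_mem pw)[k0 _] x; rewrite mulr_ge0.
have sumT0 x : 0 <= \sum_(k <- w) T k x.
  by rewrite big_seq sumr_ge0// => k /T0.
have mcq : emfun (fun x => (cube_sum s x `^ q)%:E).
  by apply: emfun_EFin; apply: mfun_powR; exact: mfun_cube_sum.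
apply: (@le_trans _ _ (\int[leb R d]_x
    ((2 ^+ N)%:E * (\sum_(k <- w) T k x)%:E))%E).
  apply: int_le.
  - exact: msetT.
  - by move=> x; rewrite lee_fin powR_ge0.
  - by apply: emfun_EFin; apply: mfun_powR; exact: mfun_tail_sum.
  - by apply: emfun_EFin; apply: mfunZ; exact: mfun_sum.
  - by move=> x _; rewrite -EFinM lee_fin; exact: tail_sum_powR_le.
rewrite intZl; [|exact: msetT|by move=> x; rewrite lee_fin|
  by apply: emfun_EFin; exact: mfun_sum|by rewrite exprn_ge0].
rewrite int_sum; [|exact: msetT|exact: mT|exact: T0].
have HI : (\sum_(k <- w) \int[leb R d]_x (I k x)%:E <=
   (q^-1)%:E * \int[leb R d]_x (cube_sum s x `^ q)%:E)%E.
  rewrite -int_sum; [|exact: msetT|exact: mI|exact: I0].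
  rewrite -intZl; [|exact: msetT|by move=> x; rewrite lee_fin powR_ge0|
    exact: mcq|by rewrite invr_ge0 ltW].
  apply: int_le.
  - exact: msetT.
  - by move=> x; rewrite lee_fin big_seq sumr_ge0// => k /I0.
  - by apply: emfun_EFin; exact: mfun_sum.
  - by apply: emfun_EFin; apply: mfunZ; apply: mfun_powR; exact: mfun_cube_sum.
  - move=> x _; rewrite lee_fin mulrC ler_pdivlMr// mulrC.
    exact: reweighted_cube_sum_le.
apply: (@le_trans _ _ ((2 ^+ N)%:E *
    (C%:E * \sum_(k <- w) \int[leb R d]_x (I k x)%:E))%E).
  rewrite lee_pmul2l// ?lte_fin ?exprn_gt0//.
  have {}HC : {in w, forall k, (\int[leb R d]_x (T k x)%:E <=
     C%:E * \int[leb R d]_x (I k x)%:E)%E}.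
    move=> k kw; have [k0 l0] := proper_mem pw kw.
    rewrite /T /I; under eq_integral do rewrite EFinM tail_powR//.
    rewrite intZl; [|exact: msetT|by move=> x; rewrite lee_fin powR_ge0|
      by apply: emfun_EFin; exact: mfun_tail_powR|exact: k0].
    under [in leRHS]eq_integral do rewrite EFinM.
    rewrite intZl; [|exact: msetT|by move=> x; rewrite lee_fin|
      by apply: emfun_EFin; apply: mfun_indic; exact: mset_cube|exact: k0].
    rewrite int_indic ?setIT; [|exact: msetT|exact: mset_cube].
    rewrite leb_cube; last exact: ltW.
    by rewrite muleCA lee_wpmul2l ?lee_fin// -EFinM; exact: HC.
  rewrite big_seq [X in (_ <= _ * X)%E]big_seq ge0_sume_distrr; last first.
    by move=> k kw; apply: int_ge0 => x; rewrite lee_fin I0.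
  by apply: lee_sum => k /HC.
apply: (@le_trans _ _ ((2 ^+ N)%:E * (C%:E * ((q^-1)%:E * \int[leb R d]_x (cube_sum s x `^ q)%:E)))%E).
  by rewrite lee_wpmul2l ?lee_fin ?exprn_ge0// lee_wpmul2l// lee_fin ltW.
by rewrite !muleA -!EFinM.
Qed.
End tail_integral.

(** * Taylor approximation by polynomials *)

Section line_derivatives.
Context {R : realType} {d : nat}.
Implicit Types (x y c z : 'rV[R]_d) (f g : 'rV[R]_d -> R) (i : 'I_d) (r s l : R).

(** Differentiability along whole coordinate lines, in the parameter of the
    line: the form in which the mean value theorem and the chain rule apply. *)
Definition line_deriv i f g := forall x s,
  is_derive s 1 (fun r => f (x + r *: delta_mx ord0 i)) (g (x + s *: delta_mx ord0 i)).

Lemma derivable_line_deriv i f :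
  (forall x, derivable f x (delta_mx ord0 i)) ->
  line_deriv i f (fun x => 'D_(delta_mx ord0 i) f x).
Proof.
move=> df x s; set e := delta_mx ord0 i.
pose y := x + s *: e.
have E : (fun h : R => h^-1 *: (((fun r => f (x + r *: e)) \o shift s) (h *: (1 : R)) -
    (fun r => f (x + r *: e)) s)) =
  (fun h : R => h^-1 *: ((f \o shift y) (h *: e) - f y)).
  apply/funext => h /=; rewrite scaler1; congr (_ *: (f _ - _)).
  by rewrite /shift/= /y scalerDl addrCA.
split; first by rewrite /derivable E; exact: df.
by rewrite /derive E.
Qed.

Lemma line_derivD i f1 f2 g1 g2 : line_deriv i f1 g1 -> line_deriv i f2 g2 ->
  line_deriv i (fun x => f1 x + f2 x) (fun x => g1 x + g2 x).
Proof. by move=> H1 H2 x s; exact: (is_deriveD (H1 x s) (H2 x s)). Qed.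

Lemma line_derivB i f1 f2 g1 g2 : line_deriv i f1 g1 -> line_deriv i f2 g2 ->
  line_deriv i (fun x => f1 x - f2 x) (fun x => g1 x - g2 x).
Proof. by move=> H1 H2 x s; exact: (is_deriveB (H1 x s) (H2 x s)). Qed.

Lemma line_deriv_reflect i f g k x t : line_deriv i f g ->
  line_deriv i (fun y => k * f (t *: (x - y))) (fun y => k * - t * g (t *: (x - y))).
Proof.
move=> H y s; rewrite -mulrA; apply: is_deriveZ.
have E (r : R) : t *: (x - (y + r *: delta_mx ord0 i)) =
    t *: (x - y) + (- t * r) *: delta_mx ord0 i :> 'rV[R]_d.
  by rewrite opprD addrA scalerBr scalerA mulNr scaleNr.
rewrite (_ : (fun r => _) =
    (fun u => f (t *: (x - y) + u *: delta_mx ord0 i)) \o (fun r => - t * r)); last first.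
  by apply/funext => r /=; rewrite E.
rewrite E mulrC.
apply: is_derive1_comp => //.
by have := is_deriveZ (- t) (is_derive_id s 1); rewrite /GRing.scale/= mulr1.
Qed.

Lemma line_increment_le i f g x r (B : R) : line_deriv i f g ->
  (forall s, `|s| <= `|r| -> `|g (x + s *: delta_mx ord0 i)| <= B) ->
  `|f (x + r *: delta_mx ord0 i) - f x| <= B * `|r|.
Proof.
move=> H gB; set e := delta_mx ord0 i.
have inc a b : a <= b -> (forall s, a <= s <= b -> `|s| <= `|r|) ->
    `|f (x + b *: e) - f (x + a *: e)| <= B * (b - a).
  move=> ab Hs.
  have := @MVT_segment R (fun r => f (x + r *: e)) (fun s => g (x + s *: e)) a b ab.
  case => [s _||s + ->].
  - exact: H.
  - by apply: derivable_within_continuous => s _; exact: (@ex_derive _ _ _ _ _ _ _ (H x s)).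
  - rewrite in_itv/= => /Hs /gB sB.
    by rewrite normrM (ger0_norm (_ : 0 <= b - a)) ?subr_ge0// ler_wpM2r// subr_ge0.
have [r0|r0] := leP 0 r.
  have := inc 0 r r0; rewrite scale0r addr0 subr0 (ger0_norm r0); apply.
  by move=> s /andP[s0 sr]; rewrite ger0_norm.
have := inc r 0 (ltW r0); rewrite scale0r addr0 sub0r distrC (ltr0_norm r0); apply.
by move=> s /andP[s0 sr]; rewrite ler0_norm ?lerN2.
Qed.

End line_derivatives.

Section polynomials.
Context {R : realType} {d : nat}.
Implicit Types (x y c z : 'rV[R]_d) (f g : 'rV[R]_d -> R) (i : 'I_d) (r s l : R).

(** Generated by monomials, so that orthogonality to polynomials follows from
    orthogonality to monomials by induction. *)
Inductive polyfun (m : nat) : ('rV[R]_d -> R) -> Prop :=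
| polyfun0 : polyfun m (fun=> 0)
| polyfunD f g : polyfun m f -> polyfun m g -> polyfun m (fun x => f x + g x)
| polyfun_mono r (b : @multi_index d) : (mdeg b < m)%N ->
    polyfun m (fun x => r * monomial b x).

Lemma polyfunZ m r f : polyfun m f -> polyfun m (fun x => r * f x).
Proof.
elim=> [|{}f g _ IHf _ IHg|s b bm].
- rewrite (_ : (fun _ => _) = (fun=> 0)); first exact: polyfun0.
  by apply/funext => x; rewrite mulr0.
- rewrite (_ : (fun _ => _) = (fun x => r * f x + r * g x)); first exact: polyfunD.
  by apply/funext => x; rewrite mulrDr.
- rewrite (_ : (fun _ => _) = (fun x => (r * s) * monomial b x)); first exact: polyfun_mono.
  by apply/funext => x; rewrite mulrA.
Qed.

Lemma polyfunB m f g : polyfun m f -> polyfun m g -> polyfun m (fun x => f x - g x).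
Proof.
move=> pf pg; rewrite (_ : (fun _ => _) = (fun x => f x + (-1) * g x)).
  by apply: polyfunD => //; exact: polyfunZ.
by apply/funext => x; rewrite mulN1r.
Qed.

Lemma polyfun_cst m r : polyfun m.+1 (fun=> r).
Proof.
rewrite (_ : (fun _ => _) = (fun x => r * monomial [ffun=> 0%N] x)).
  by apply: polyfun_mono; rewrite /mdeg big1// => i _; rewrite ffunE.
by apply/funext => x; rewrite /monomial big1 ?mulr1// => i _; rewrite ffunE expr0.
Qed.

Lemma polyfun_sum m (I : Type) (s : seq I) (P : pred I) (h : I -> 'rV[R]_d -> R) :
  (forall k, P k -> polyfun m (h k)) -> polyfun m (fun x => \sum_(k <- s | P k) h k x).
Proof.
move=> ph; elim: s => [|k s IH].
  rewrite (_ : (fun _ => _) = (fun=> 0)); first exact: polyfun0.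
  by apply/funext => x; rewrite big_nil.
have [Pk|nPk] := boolP (P k).
  rewrite (_ : (fun _ => _) = (fun x => h k x + \sum_(k <- s | P k) h k x)).
    by apply: polyfunD => //; exact: ph.
  by apply/funext => x; rewrite big_cons Pk.
rewrite (_ : (fun _ => _) = (fun x => \sum_(k <- s | P k) h k x))//.
by apply/funext => x; rewrite big_cons (negbTE nPk).
Qed.

Lemma polyfun1_cst f : polyfun 1 f -> exists r, forall x, f x = r.
Proof.
elim=> [|{}f g _ [r Hr] _ [s Hs]|r b]; first by exists 0.
  by exists (r + s) => x; rewrite Hr Hs.
rewrite ltnS leqn0 /mdeg sum_nat_eq0 => /forallP b0; exists r => x.
by rewrite /monomial big1 ?mulr1// => i _; rewrite (eqP (b0 i)) expr0.
Qed.

Lemma polyfun_antideriv m f i : polyfun m f ->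
  exists2 g, polyfun m.+1 g & line_deriv i g f.
Proof.
elim=> [|{}f g _ [F pF HF] _ [G pG HG]|r b bm].
- exists (fun=> 0); first exact: polyfun0.
  by move=> x s; exact: is_derive_cst.
- by exists (fun x => F x + G x); [exact: polyfunD|exact: line_derivD].
pose b' : multi_index := [ffun j => (b j + (j == i))%N].
exists (fun x => (r / (b i).+1%:R) * monomial b' x).
  apply: polyfun_mono; rewrite /mdeg.
  under eq_bigr do rewrite ffunE.
  rewrite big_split/= (bigD1 i (F := fun j => (j == i : nat)))//= eqxx.
  rewrite (_ : (\sum_(j | j != i) _ = 0)%N); last by apply: big1 => j /negbTE->.
  by rewrite addn0 addn1 ltnS.
move=> x s.
pose C : R := \prod_(j | j != i) x ord0 j ^+ b j.
have coordE (u : R) j : (x + u *: delta_mx ord0 i) ord0 j = x ord0 j + u * (j == i)%:R.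
  by rewrite !mxE eqxx.
have mE u : monomial b (x + u *: delta_mx ord0 i) = (x ord0 i + u) ^+ b i * C.
  rewrite /monomial (bigD1 i)//= coordE eqxx mulr1; congr (_ * _).
  by apply: eq_bigr => j /negbTE ji; rewrite coordE ji mulr0 addr0.
have m'E u : monomial b' (x + u *: delta_mx ord0 i) = (x ord0 i + u) ^+ (b i).+1 * C.
  rewrite /monomial (bigD1 i)//= coordE ffunE eqxx mulr1 addn1; congr (_ * _).
  by apply: eq_bigr => j /negbTE ji; rewrite coordE ffunE ji mulr0 addr0 addn0.
rewrite mE (_ : (fun _ => _) =
    (fun u : R => (r / (b i).+1%:R * C) *: (x ord0 i + u) ^+ (b i).+1)); last first.
  by apply/funext => u; rewrite m'E /GRing.scale/=; ring.
have -> : r * ((x ord0 i + s) ^+ b i * C) =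
    (r / (b i).+1%:R * C) *: ((b i).+1%:R * (x ord0 i + s) ^+ b i *: (1 : R)).
  have n0 : (b i).+1%:R != 0 :> R by rewrite pnatr_eq0.
  rewrite /GRing.scale/= mulr1.
  by move: n0; set n1 : R := (b i).+1%:R => n0; field.
apply: is_deriveZ.
have Hd : is_derive s 1 (fun u : R => x ord0 i + u) (1 : R).
  by have := is_deriveD (is_derive_cst (x ord0 i) s 1) (is_derive_id s 1); rewrite add0r.
by have := is_deriveX (b i).+1 Hd; rewrite exprfctE.
Qed.

(** The vertices of a broken line from [c] to [z] with edges along the
    coordinate directions. *)
Definition hybrid c (i : nat) z : 'rV[R]_d :=
  \row_j if (j < i)%N then z ord0 j else c ord0 j.

Lemma hybrid0 c z : hybrid c 0 z = c.
Proof. by apply/rowP => j; rewrite mxE. Qed.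

Lemma hybrid_full c z : hybrid c d z = z.
Proof. by apply/rowP => j; rewrite mxE ltn_ord. Qed.

Lemma hybridS c z i :
  hybrid c i.+1 z = hybrid c i z + (z ord0 i - c ord0 i) *: delta_mx ord0 i.
Proof.
apply/rowP => j; rewrite !mxE eqxx/= ltnS leq_eqVlt.
have [/val_inj->|ji] := eqVneq (j : nat) i.
  by rewrite ltnn eqxx mulr1 addrC subrK.
have /negbTE-> : j != i by apply: contra ji => /eqP->.
by rewrite mulr0 addr0.
Qed.

Lemma hybrid_line c z i r :
  hybrid c i.+1 (hybrid c i z + r *: delta_mx ord0 i) =
  hybrid c i z + r *: delta_mx ord0 i.
Proof.
apply/rowP => j; rewrite !mxE; case: ifPn => //; rewrite ltnS -ltnNge => ij.
have /negbTE-> : j != i by apply: contraL ij => /eqP->; rewrite ltnn.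
by rewrite mulr0 addr0 ltnNge (ltnW ij).
Qed.

Lemma hybrid_line_dist c z i r l : `|z - c| <= l -> `|r| <= `|z ord0 i - c ord0 i| ->
  `|hybrid c i z + r *: delta_mx ord0 i - c| <= l.
Proof.
move=> zc rz; have l0 : 0 <= l by exact: le_trans zc.
apply/rV_norm_leP => // j; rewrite !mxE eqxx/=.
have zcj k : `|z ord0 k - c ord0 k| <= l.
  by have := (rV_norm_leP _ l0).1 zc k; rewrite !mxE.
have [->|/negbTE ji] := eqVneq j i.
  by rewrite ltnn mulr1 addrAC subrr add0r; exact: le_trans (zcj i).
by rewrite mulr0 addr0; case: ifP => // _; rewrite subrr normr0.
Qed.

Lemma polyfun_hybrid m f c (i : nat) : polyfun m f -> polyfun m (fun z => f (hybrid c i z)).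
Proof.
elim=> [|{}f g _ IHf _ IHg|r b bm]; [exact: polyfun0|exact: polyfunD|].
pose b' : @multi_index d := [ffun j : 'I_d => if (j < i)%N then b j else 0%N].
rewrite (_ : (fun _ => _) =
  (fun z => (r * \prod_(j < d) (if (j < i)%N then 1 else c ord0 j ^+ b j)) * monomial b' z)).
  apply: polyfun_mono; apply: leq_ltn_trans bm.
  by apply: leq_sum => j _; rewrite ffunE; case: ifP.
apply/funext => z; rewrite -mulrA; congr (_ * _).
rewrite /monomial -big_split/=; apply: eq_bigr => j _; rewrite mxE ffunE.
by case: ifP; rewrite ?mul1r ?expr0 ?mulr1.
Qed.

(** A word lists the directions of an iterated derivative, the outermost
    first. *)
Definition increasing (w : seq 'I_d) := sorted (fun i j : 'I_d => (i <= j)%N) w.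

(** Near [c], a function is approximated to order [m] by a polynomial of degree
    less than [m]: the increments along the broken line from [c] to [z] that
    changes one coordinate at a time are controlled by the same statement for
    the partial derivatives. Only derivatives taken in the increasing order of
    the coordinates are involved, since the derivative along the [k]-th
    coordinate is needed only at points that already agree with [c] in the
    later coordinates. *)
Lemma taylor_hybrid (D : seq 'I_d -> 'rV[R]_d -> R) c :
  (forall w i, line_deriv i (D w) (D (i :: w))) ->
  forall m w (i : nat), (i <= d)%N ->
  (forall k : 'I_d, (k < i)%N -> increasing (k :: w)) ->
  exists2 P, polyfun m P & forall l (K : R), 0 <= l -> 0 <= K ->
    (forall w' : seq 'I_d, size w' = (m + size w)%N -> increasing w' ->
       forall z, `|z - c| <= l -> `|D w' z| <= K) ->
    increasing w ->
    forall z, `|z - c| <= l -> `|D w (hybrid c i z) - P z| <= (d%:R * l) ^+ m * K.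
Proof.
move=> HD; elim=> [|m IH] w i id sw.
  exists (fun=> 0); first exact: polyfun0.
  move=> l K l0 K0 DK sortw z zc; rewrite subr0 expr0 mul1r.
  apply: DK => //; apply/rV_norm_leP => // j; rewrite !mxE; case: ifP => _.
    by have := (rV_norm_leP _ l0).1 zc j; rewrite !mxE.
  by rewrite subrr normr0.
have H (k : 'I_d) : exists P, (k < i)%N -> polyfun m P /\ forall l (K : R), 0 <= l -> 0 <= K ->
    (forall w' : seq 'I_d, size w' = (m + size (k :: w))%N -> increasing w' ->
       forall z, `|z - c| <= l -> `|D w' z| <= K) ->
    forall z, `|z - c| <= l ->
      `|D (k :: w) (hybrid c k.+1 z) - P z| <= (d%:R * l) ^+ m * K.
  have [ki|] := boolP (k < i)%N; last by exists (fun=> 0).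
  have [j|P pP HP] := IH (k :: w) k.+1 (ltn_ord k).
    by rewrite ltnS => jk /=; rewrite jk; exact: sw.
  by exists P => _; split=> // l K l0 K0 DK z zc; apply: HP => //; exact: sw.
have {IH H}[P HP] := choice H.
have H (k : 'I_d) : exists Q, (k < i)%N -> polyfun m.+1 Q /\ line_deriv k Q (P k).
  have [ki|] := boolP (k < i)%N; last by exists (fun=> 0).
  by have [Q pQ HQ] := polyfun_antideriv k (HP k ki).1; exists Q.
have {H}[Q HQ] := choice H.
exists (fun z => D w c +
  \sum_(k < d | (k < i)%N) (Q k (hybrid c k.+1 z) - Q k (hybrid c k z))).
  apply: polyfunD; first exact: polyfun_cst.
  apply: polyfun_sum => k /HQ[pQ _].
  by apply: polyfunB; exact: polyfun_hybrid.
move=> l K l0 K0 DK sortw z zc.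
have -> : D w (hybrid c i z) = D w c +
    \sum_(k < d | (k < i)%N) (D w (hybrid c k.+1 z) - D w (hybrid c k z)).
  rewrite -(big_ord_widen d (fun k => D w (hybrid c k.+1 z) - D w (hybrid c k z)))//.
  rewrite -(big_mkord xpredT (fun k => D w (hybrid c k.+1 z) - D w (hybrid c k z))).
  by rewrite (telescope_sumr (fun k => D w (hybrid c k z)))// hybrid0 addrC subrK.
rewrite opprD addrACA subrr add0r -sumrB.
apply: (le_trans (ler_norm_sum _ _ _)).
apply: (@le_trans _ _ (\sum_(k < d | (k < i)%N) (d%:R * l) ^+ m * K * l)).
  apply: ler_sum => k ki.
  have [pP HPk] := HP k ki; have [pQ HQk] := HQ k ki.
  have zk : `|z ord0 k - c ord0 k| <= l.
    by have := (rV_norm_leP _ l0).1 zc k; rewrite !mxE.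
  have dK0 : forall y, `|y - c| <= l -> `|D (k :: w) (hybrid c k.+1 y) - P k y| <= (d%:R * l) ^+ m * K.
    apply: (HPk l K l0 K0) => w' sw'; apply: DK.
    by rewrite sw' /= addSnnS.
  rewrite (_ : _ - _ = (D w (hybrid c k.+1 z) - Q k (hybrid c k.+1 z)) -
      (D w (hybrid c k z) - Q k (hybrid c k z))); last by ring.
  rewrite hybridS.
  apply: le_trans (line_increment_le (B := (d%:R * l) ^+ m * K)
    (line_derivB (HD w k) HQk) _) _.
    move=> s sz; rewrite -[in D _ _]hybrid_line; apply: dK0.
    exact: hybrid_line_dist.
  apply: ler_wpM2l => //.
  by rewrite mulr_ge0// exprn_ge0// mulr_ge0.
rewrite big_mkcond/=.
apply: (@le_trans _ _ (\sum_(k < d) (d%:R * l) ^+ m * K * l)).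
  by apply: ler_sum => k _; case: ifP => // _; rewrite !mulr_ge0// exprn_ge0// mulr_ge0.
by rewrite sumr_const card_ord -mulr_natr exprS le_eqVlt; apply/orP; left; apply/eqP; ring.
Qed.

Lemma taylor_polyfun (D : seq 'I_d -> 'rV[R]_d -> R) c m :
  (forall w i, line_deriv i (D w) (D (i :: w))) ->
  exists2 P, polyfun m P & forall l (K : R), 0 <= l -> 0 <= K ->
    (forall w, size w = m -> increasing w ->
       forall z, `|z - c| <= l -> `|D w z| <= K) ->
    forall z, `|z - c| <= l -> `|D [::] z - P z| <= (d%:R * l) ^+ m * K.
Proof.
move=> HD; have [//|//|P pP HP] := @taylor_hybrid D c HD m [::] d.
exists P => // l K l0 K0 DK z zc; rewrite -{1}(hybrid_full c z).
by apply: HP => // w; rewrite addn0; exact: DK.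
Qed.

End polynomials.

(** * Integrals against an atom *)

Section real_integral.
Context {R : realType} {d : nat}.
Implicit Types (f g : 'rV[R]_d -> R) (D : set 'rV[R]_d).

Definition lint f : R := Rintegral (leb R d) setT f.

Definition lintegrable f := mfun f /\ (\int[leb R d]_x (`|f x|)%:E < +oo)%E.

Lemma int_indicT (A : set 'rV[R]_d) : mset A ->
  (\int[leb R d]_x (\1_A x)%:E = leb R d A)%E.
Proof. by move=> mA; rewrite int_indic ?setIT//; exact: msetT. Qed.

Lemma lintegrableP f : lintegrable f -> (leb R d).-integrable setT (EFin \o f).
Proof.
move=> [mf If]; apply/integrableP; split; first exact: emfun_EFin.
by under eq_integral do rewrite abse_EFin.
Qed.

Lemma lintD f g : lintegrable f -> lintegrable g ->
  lint (fun x => f x + g x) = lint f + lint g.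
Proof.
move=> /lintegrableP If /lintegrableP Ig.
exact: (@RintegralD _ (Rd R d) R (leb R d) setT f g measurableT If Ig).
Qed.

Lemma lintB f g : lintegrable f -> lintegrable g ->
  lint (fun x => f x - g x) = lint f - lint g.
Proof.
move=> /lintegrableP If /lintegrableP Ig.
exact: (@RintegralB _ (Rd R d) R (leb R d) setT f g measurableT If Ig).
Qed.

Lemma lintZ (k : R) f : lintegrable f -> lint (fun x => k * f x) = k * lint f.
Proof.
move=> /lintegrableP If.
exact: (@RintegralZl _ (Rd R d) R (leb R d) setT f k measurableT If).
Qed.

Lemma lint_le f : mfun f -> ((`|lint f|)%:E <= \int[leb R d]_x (`|f x|)%:E)%E.
Proof.
move=> mf; have := @le_abse_integral _ (Rd R d) R (leb R d) setT (EFin \o f)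
  measurableT (emfun_EFin mf).
under [in leRHS]eq_integral do rewrite abse_EFin.
apply: le_trans; rewrite /lint /Rintegral.
by case: (integral _ _ _) => [r| |]//=; rewrite normr0 leey.
Qed.

Lemma lint0 f : (forall x, f x = 0) -> lint f = 0.
Proof.
move=> f0; rewrite /lint (_ : f = fun=> 0); last exact/funext.
by rewrite /Rintegral integral0.
Qed.

Lemma lintegrableD f g : lintegrable f -> lintegrable g ->
  lintegrable (fun x => f x + g x).
Proof.
move=> [mf If] [mg Ig]; split; first exact: mfunD.
have ge0 h : mfun h -> emfun (fun x => (`|h x|)%:E).
  by move=> mh; apply: emfun_EFin; exact: mfun_norm.
apply: (@le_lt_trans _ _ (\int[leb R d]_x ((`|f x|)%:E + (`|g x|)%:E))%E).
  apply: int_le => //; [exact: msetT|by apply: ge0; exact: mfunD| |].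
    by apply: emfunD; exact: ge0.
  by move=> x _; rewrite -EFinD lee_fin ler_normD.
rewrite intD; [exact: lte_add_pinfty|exact: msetT|by [] |exact: ge0|by []|exact: ge0].
Qed.

Lemma lintegrableZ (k : R) f : lintegrable f -> lintegrable (fun x => k * f x).
Proof.
move=> [mf If]; split; first exact: mfunZ.
under eq_integral do rewrite normrM EFinM.
rewrite intZl; [|exact: msetT|by []|by apply: emfun_EFin; exact: mfun_norm|by []].
by rewrite lte_mul_pinfty.
Qed.

End real_integral.

Section real_atoms.
Context {R : realType} {d : nat}.
Implicit Types (x y c z : 'rV[R]_d) (f g h : 'rV[R]_d -> R) (l V K B : R).

(** The properties of the real and imaginary parts of an atom with corner [c],
    side [l] and size [V]. The bound holds almost everywhere only, since it comes
    from an essential supremum. *)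
Definition real_atom (m : nat) c l V f :=
  [/\ mfun f, {ae leb R d, forall x, `|f x| <= V},
      forall x, ~ cube c l x -> f x = 0 &
      l < 1 -> forall b : @multi_index d, (mdeg b < m)%N ->
        lint (fun x => monomial b x * f x) = 0].

Lemma mfun_coord (i : 'I_d) : mfun (fun x : 'rV[R]_d => x ord0 i).
Proof. exact: rd_measurable_coord. Qed.

Lemma mfun_polyfun m f : polyfun m f -> mfun f.
Proof.
elim=> [|{}f g _ IHf _ IHg|r b _]; [exact: mfun_cst|exact: mfunD|].
apply: mfunZ; rewrite /monomial; elim: (index_enum _) => [|i s IH].
  rewrite (_ : (fun _ => _) = (fun=> 1)); first exact: mfun_cst.
  by apply/funext => x; rewrite big_nil.
rewrite (_ : (fun _ => _) = (fun x => x ord0 i ^+ b i * \prod_(i <- s) x ord0 i ^+ b i)).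
  by apply: mfunM => //; apply: mfunX; exact: mfun_coord.
by apply/funext => x; rewrite big_cons.
Qed.

Lemma polyfun_bounded m f c l : 0 <= l -> polyfun m f ->
  exists2 B, 0 <= B & forall z, `|z - c| <= l -> `|f z| <= B.
Proof.
move=> l0; elim=> [|{}f g _ [B B0 HB] _ [B' B'0 HB']|r b _].
- by exists 0 => // z _; rewrite normr0.
- exists (B + B'); first exact: addr_ge0.
  by move=> z zc; rewrite (le_trans (ler_normD _ _))// lerD ?HB ?HB'.
exists (`|r| * \prod_i (`|c| + l) ^+ b i).
  by rewrite mulr_ge0// prodr_ge0// => i _; rewrite exprn_ge0// addr_ge0.
move=> z zc; rewrite normrM ler_wpM2l// /monomial normr_prod.
apply: ler_prod => i _; rewrite normr_ge0/= normrX; apply: lerXn2r.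
- by rewrite nnegrE.
- by rewrite nnegrE addr_ge0.
- apply: le_trans (rV_coord_le z i) _.
  by rewrite -[z](subrK c) (le_trans (ler_normD _ _))// addrC lerD2l.
Qed.

Lemma cube_ball c l z : 0 <= l -> cube c l z -> `|z - c| <= l.
Proof.
move=> l0 H; apply/rV_norm_leP => // i; have := H i; rewrite !mxE ler_norml; lra.
Qed.

Section atom.
Variables (m : nat) (c : 'rV[R]_d) (l V : R) (a : 'rV[R]_d -> R).
Hypotheses (l_gt0 : 0 < l) (V_ge0 : 0 <= V) (atom_a : real_atom m c l V a).

Let mfun_a : mfun a. Proof. by case: atom_a. Qed.

Lemma atom_norm_integral_le h : mfun h ->
  (\int[leb R d]_x (`|a x * h x|)%:E <=
   V%:E * \int[leb R d]_x (`|h x| * \1_(cube c l) x)%:E)%E.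
Proof.
move=> mh; case: atom_a => _ aV a0 _.
have mI : mfun (\1_(cube c l)) by apply: mfun_indic; exact: mset_cube.
have mhI : mfun (fun x => `|h x| * \1_(cube c l) x).
  by apply: mfunM => //; exact: mfun_norm.
rewrite -intZl; [|exact: msetT|by move=> x; rewrite lee_fin mulr_ge0|
  exact: emfun_EFin|exact: V_ge0].
apply: (@ae_ge0_le_integral _ (Rd R d) R (leb R d) setT measurableT).
- by move=> x _; rewrite lee_fin.
- by apply: emfun_EFin; apply: mfun_norm; exact: mfunM.
- by move=> x _; rewrite -EFinM lee_fin !mulr_ge0.
- by apply: emfun_EFin; exact: mfunZ.
- have aeF := ae_filter_ringOfSetsType (leb R d).
  apply: (@filterS _ (almost_everywhere (leb R d)) aeF _ _ _ aV) => x Hx _.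
  rewrite -EFinM lee_fin normrM indicE.
  case: (boolP (x \in _)) => [_|]; first by rewrite mulr1 ler_wpM2r.
  by rewrite notin_setE => /a0->; rewrite normr0 !mulr0 mul0r.
Qed.

Lemma atom_int_le h : mfun h ->
  ((`|lint (fun x => a x * h x)|)%:E <=
   V%:E * \int[leb R d]_x (`|h x| * \1_(cube c l) x)%:E)%E.
Proof.
by move=> mh; apply: le_trans (lint_le _) (atom_norm_integral_le mh); exact: mfunM.
Qed.

(** The set [A] can be smaller than the cube, as is the support of a kernel
    rescaled below the size of the cube. *)
Lemma atom_int_le_measure h (A : set 'rV[R]_d) B v : mfun h -> 0 <= B -> mset A ->
  leb R d A = v%:E ->
  (forall x, cube c l x -> `|h x| <= B * \1_A x) ->
  `|lint (fun x => a x * h x)| <= V * (B * v).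
Proof.
move=> mh B0 mA Av hB; rewrite -lee_fin; apply: le_trans (atom_int_le mh) _.
rewrite EFinM lee_wpmul2l// EFinM -Av -(int_indicT mA).
rewrite -intZl; [|exact: msetT|by move=> x; rewrite lee_fin|
  by apply: emfun_EFin; exact: mfun_indic|exact: B0].
apply: int_le.
- exact: msetT.
- by move=> x; rewrite lee_fin mulr_ge0.
- apply: emfun_EFin; apply: mfunM; first exact: mfun_norm.
  by apply: mfun_indic; exact: mset_cube.
- by apply: emfun_EFin; apply: mfunZ; exact: mfun_indic.
- move=> x _; rewrite -EFinM lee_fin [X in _ * X]indicE.
  case: (boolP (x \in _)) => [|_]; last by rewrite mulr0 mulr_ge0.
  by rewrite inE mulr1 => /hB.
Qed.

Lemma atom_integrable h B : mfun h -> (forall x, cube c l x -> `|h x| <= B) ->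
  lintegrable (fun x => a x * h x).
Proof.
move=> mh hB; split; first exact: mfunM.
have B0 : 0 <= B.
  have c_cube : cube c l c by move=> i; rewrite lexx lerDl ltW.
  exact: le_trans (normr_ge0 _) (hB _ c_cube).
apply: le_lt_trans (atom_norm_integral_le mh) _.
apply: lte_mul_pinfty => //.
apply: (@le_lt_trans _ _ (\int[leb R d]_x (B%:E * (\1_(cube c l) x)%:E))%E).
  apply: int_le.
  - exact: msetT.
  - by move=> x; rewrite lee_fin mulr_ge0.
  - apply: emfun_EFin; apply: mfunM; first exact: mfun_norm.
    by apply: mfun_indic; exact: mset_cube.
  - by apply: emfun_EFin; apply: mfunZ; apply: mfun_indic; exact: mset_cube.
  - move=> x _; rewrite -EFinM lee_fin indicE.
    case: (boolP (x \in _)) => [|_]; last by rewrite !mulr0.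
    by rewrite inE !mulr1 => /hB.
rewrite intZl; [|exact: msetT|by move=> x; rewrite lee_fin|
  by apply: emfun_EFin; apply: mfun_indic; exact: mset_cube|exact: B0].
rewrite int_indic; [|exact: msetT|exact: mset_cube].
by rewrite setIT leb_cube ?ltW// -EFinM ltry.
Qed.

Lemma atom_polyfun_integrable P k : polyfun k P -> lintegrable (fun x => a x * P x).
Proof.
move=> pP; have [B _ HB] := polyfun_bounded c (ltW l_gt0) pP.
apply: (@atom_integrable _ B); first exact: mfun_polyfun pP.
by move=> x /(cube_ball (ltW l_gt0)); exact: HB.
Qed.

Lemma atom_polyfun0 P : l < 1 -> polyfun m P -> lint (fun x => a x * P x) = 0.
Proof.
move=> l1; case: atom_a => _ _ _ mom; elim=> [|f g pf IHf pg IHg|r b bm].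
- by apply: lint0 => x; rewrite mulr0.
- rewrite (_ : (fun _ => _) = (fun x => a x * f x + a x * g x)); last first.
    by apply/funext => x; rewrite mulrDr.
  rewrite lintD; [|exact: atom_polyfun_integrable pf|exact: atom_polyfun_integrable pg].
  by rewrite IHf IHg addr0.
- rewrite (_ : (fun _ => _) = (fun x => r * (a x * (1 * monomial b x)))); last first.
    by apply/funext => x; ring.
  rewrite lintZ; last by apply: atom_polyfun_integrable; exact: (polyfun_mono 1 bm).
  rewrite (_ : (fun x => a x * (1 * monomial b x)) = (fun x => monomial b x * a x)).
    by rewrite mom ?mulr0.
  by apply/funext => x; ring.
Qed.

(** Cancellation: a test function may be replaced by its Taylor remainder. *)
Lemma atom_cancel_le h (D : seq 'I_d -> 'rV[R]_d -> R) K : l < 1 -> mfun h ->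
  D [::] = h -> (forall w i, line_deriv i (D w) (D (i :: w))) -> 0 <= K ->
  (forall w, size w = m -> increasing w -> forall z, `|z - c| <= l -> `|D w z| <= K) ->
  `|lint (fun x => a x * h x)| <= V * ((d%:R * l) ^+ m * K * l ^+ d).
Proof.
move=> l1 mh D0 HD K0 DK; have l0 := ltW l_gt0.
have [P pP HP] := taylor_polyfun c m HD.
have {}HP := HP l K l0 K0 DK; rewrite D0 in HP.
have [B B0 HB] := polyfun_bounded c l0 pP.
have mP : mfun P by exact: mfun_polyfun pP.
have hB x : cube c l x -> `|h x| <= (d%:R * l) ^+ m * K + B.
  move=> /(cube_ball l0) xc; rewrite -[h x](subrK (P x)).
  by rewrite (le_trans (ler_normD _ _))// lerD ?HP ?HB.
have E : lint (fun x => a x * h x) = lint (fun x => a x * (h x - P x)).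
  rewrite (_ : (fun x => a x * (h x - P x)) = (fun x => a x * h x - a x * P x)); last first.
    by apply/funext => x; rewrite mulrBr.
  rewrite lintB; [|exact: atom_integrable mh hB|exact: atom_polyfun_integrable pP].
  by rewrite (atom_polyfun0 l1 pP) subr0.
rewrite E; apply: (atom_int_le_measure (A := cube c l)).
- exact: mfunB.
- by rewrite mulr_ge0// exprn_ge0// mulr_ge0.
- exact: mset_cube.
- exact: leb_cube.
- by move=> x cx; rewrite indicE mem_set// mulr1 HP//; exact: cube_ball.
Qed.

End atom.
End real_atoms.

(** * Convolutions and pairings with an atom *)

Section cells.
Context {R : realType} {d : nat}.
Implicit Types (x y c z : 'rV[R]_d) (k : 'rV[int]_d) (l : R).

(** The corner of the cube of side [Num.min l 1] inside [cube c l] that is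
    closest to the unit cell [k]. As seen from that cell, a large cube can be
    replaced by this one, which lies in [big_cell k] if the large cube is near. *)
Definition clamp k c l : 'rV[R]_d :=
  \row_i Num.max (c ord0 i) (Num.min (k ord0 i)%:~R (c ord0 i + l - Num.min l 1)).

(** The cubes that are not near are out of reach, from the unit cell [k], of
    kernels with support in the unit ball. *)
Definition near_cell k c l : bool :=
  [forall i, (c ord0 i <= (k ord0 i)%:~R + 2) && ((k ord0 i)%:~R - 1 <= c ord0 i + l)].

Definition big_cell k : set 'rV[R]_d :=
  [set z : 'rV[R]_d | forall i, (k ord0 i)%:~R - 2 <= z ord0 i < (k ord0 i)%:~R + 4].

Lemma clampP k c l i (u := clamp k c l ord0 i) (l1 := Num.min l 1) : 0 < l ->
  [/\ 0 < l1, l1 <= l, l1 <= 1 &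
  [\/ u = (k ord0 i)%:~R /\ c ord0 i <= (k ord0 i)%:~R <= c ord0 i + l - l1,
      u = c ord0 i /\ (k ord0 i)%:~R <= c ord0 i |
      u = c ord0 i + l - l1 /\ c ord0 i + l - l1 <= (k ord0 i)%:~R]].
Proof.
move=> l0.
have [l1_gt0 l1_le l1_le1] : [/\ 0 < l1, l1 <= l & l1 <= 1].
  by rewrite /l1; case: (leP l 1); split; lra.
split=> //; rewrite /u mxE -/l1.
case: (leP (k ord0 i)%:~R (c ord0 i + l - l1)) => h1.
  case: (leP (c ord0 i) (k ord0 i)%:~R) => h2; last by apply: Or32; split; lra.
  by apply: Or31; split; lra.
case: (leP (c ord0 i) (c ord0 i + l - l1)) => h2; last by exfalso; lra.
by apply: Or33; split; lra.
Qed.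

Lemma clamp_cube k c l : 0 < l -> cube (clamp k c l) (Num.min l 1) `<=` cube c l.
Proof.
move=> l0 z Hz i; have := Hz i; have [l1 l2 l3] := clampP k c i l0; case; lra.
Qed.

Lemma clamp_big_cell k c l : 0 < l -> near_cell k c l ->
  cube (clamp k c l) (Num.min l 1) `<=` big_cell k.
Proof.
move=> l0 /forallP nk z Hz i; have /andP[] := nk i; have := Hz i.
have [l1 l2 l3] := clampP k c i l0; case; lra.
Qed.

Lemma clamp_dist k c l x : 0 < l -> near_cell k c l -> unit_cube k x ->
  `|x - clamp k c l| <= 3.
Proof.
move=> l0 /forallP nk kx; apply/rV_norm_leP => // i.
have /andP[] := nk i; have := kx i.
rewrite !mxE -[_ - Num.max _ _]/(x ord0 i - _) ler_norml.
have := clampP k c i l0; rewrite mxE => -[l1 l2 l3]; case; lra.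
Qed.

Lemma near_cell_of_dist k c l x y : unit_cube k x -> cube c l y -> `|x - y| <= 1 ->
  near_cell k c l.
Proof.
move=> kx cy /(rV_norm_leP _ ler01) xy; apply/forallP => i.
have := kx i; have := cy i; have := xy i; rewrite !mxE ler_norml; lra.
Qed.

Lemma clamp_small k c l : l <= 1 -> clamp k c l = c.
Proof.
move=> l1; apply/rowP => i; rewrite mxE.
have -> : Num.min l 1 = l by case: (leP l 1) l1 => //; lra.
rewrite addrK; case: (leP (k ord0 i)%:~R (c ord0 i)) => h1.
  by case: (leP (c ord0 i) (k ord0 i)%:~R) => h2 //; apply/eqP; rewrite eq_le h1.
by rewrite maxxx.
Qed.

Lemma mset_big_cell k : mset (big_cell k).
Proof.
rewrite /big_cell (_ : [set z | _] = [set z : 'rV[R]_d | forall i,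
  `[(k ord0 i)%:~R - 2, (k ord0 i)%:~R + 4[%classic (z ord0 i)]).
  by apply: (@rd_box_measurable R d (fun i => `[(k ord0 i)%:~R - 2, (k ord0 i)%:~R + 4[%classic))
    => i; exact: measurable_itv.
by apply/seteqP; split=> z Hz i; have := Hz i; rewrite /= in_itv.
Qed.

End cells.

Section weight.
Context {R : realType} {d : nat}.
Implicit Types (x y z : 'rV[R]_d).

(** An integrable weight, comparable at points at bounded distance. *)
Definition weight y : R := tail d.+1 0 1 y.

Lemma weightE y : weight y = ((1 + `|y|) ^+ d.+1)^-1.
Proof. by rewrite /weight /tail subr0 div1r exprVn. Qed.

Lemma weight_gt0 y : 0 < weight y. Proof. exact: tail_gt0. Qed.

Lemma weight_le1 y : weight y <= 1. Proof. exact: tail_le1. Qed.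

Lemma mfun_weight : mfun weight. Proof. exact: mfun_tail. Qed.

Lemma weight_le y z : weight y <= (1 + `|y - z|) ^+ d.+1 * weight z.
Proof.
rewrite !weightE -ler_pdivrMr; last by rewrite invr_gt0 exprn_gt0// ltr_pwDl.
rewrite invrK -exprVn -exprMn; apply: lerXn2r.
- by rewrite nnegrE mulr_ge0 ?invr_ge0 ?addr_ge0.
- by rewrite nnegrE addr_ge0.
rewrite mulrC ler_pdivrMr ?ltr_pwDl//.
have : `|z| <= `|y| + `|y - z| by rewrite -{1}[z](subKr y) (le_trans (ler_normB _ _)).
have := normr_ge0 y; have := normr_ge0 (y - z); nra.
Qed.

Lemma weight_integral : exists W : R, (\int[leb R d]_y (weight y)%:E)%E = W%:E.
Proof.
have dd : d%:R < d.+1%:R :> R by rewrite ltr_nat.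
have [C C0 /(_ 0 1 ltr01)] := integral_tail_powR_le dd.
have E y : (1 / (1 + `|y - 0|)) `^ d.+1%:R = weight y.
  by rewrite powR_mulrn// divr_ge0 ?addr_ge0.
under eq_integral do rewrite E.
have : (0 <= \int[leb R d]_y (weight y)%:E)%E.
  by apply: int_ge0 => y; rewrite lee_fin ltW// weight_gt0.
by case: (integral _ _ _) => // r; exists r.
Qed.

End weight.

Section kernels.
Context {R : realType} {d : nat}.
Variables (m : nat) (r : 'rV[R]_d -> R) (D : seq 'I_d -> 'rV[R]_d -> R) (K0 K1 : R).
Hypotheses (r_continuous : continuous r) (D0 : D [::] = r)
  (HD : forall w i, line_deriv i (D w) (D (i :: w)))
  (r_supp : forall z, 1 <= `|z| -> r z = 0) (rK0 : forall z, `|r z| <= K0)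
  (DK1 : forall w z, size w = m -> increasing w -> `|D w z| <= K1).
Implicit Types (x y c z : 'rV[R]_d) (l V t : R) (a : 'rV[R]_d -> R).

Definition scaled_kernel t x y : R := t ^- d * r (t^-1 *: (x - y)).

Definition scaled_family t x w y : R :=
  t ^- d * (- t^-1) ^+ size w * D w (t^-1 *: (x - y)).

Lemma scaled_family0 t x : scaled_family t x [::] = scaled_kernel t x.
Proof. by apply/funext => y; rewrite /scaled_family expr0 mulr1 D0. Qed.

Lemma scaled_family_deriv t x w i :
  line_deriv i (scaled_family t x w) (scaled_family t x (i :: w)).
Proof.
rewrite /scaled_family /= (_ : t ^- d * (- t^-1) ^+ (size w).+1 =
  (t ^- d * (- t^-1) ^+ size w) * - t^-1); last by rewrite exprSr mulrA.
exact: line_deriv_reflect.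
Qed.

Lemma scaled_kernel_continuous t x : continuous (scaled_kernel t x).
Proof.
move=> y.
have H : {for y, continuous (fun y => r (t^-1 *: (x - y)))}.
  apply: (@continuous_comp _ _ _ (fun y => t^-1 *: (x - y)) r); last exact: r_continuous.
  apply/(@cvgrPdist_le _ _ _ (nbhs y) (nbhs_filter y)) => e e0.
  apply/nbhs_ballP; exists (e / (1 + `|t^-1|)) => /= [|z]; first by rewrite divr_gt0// ltr_pwDl.
  rewrite -ball_normE/= => yz; rewrite -scalerBr normrZ opprB addrC addrA subrK.
  rewrite distrC.
  have t0 := normr_ge0 t^-1.
  have : `|y - z| * (1 + `|t^-1|) < e by rewrite -ltr_pdivlMr// ltr_pwDl.
  have := normr_ge0 (y - z); nra.
apply: (@continuous_comp _ _ _ (fun y => r (t^-1 *: (x - y))) (fun u => t ^- d * u)) => //.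
exact: mulrl_continuous.
Qed.

Lemma K0_ge0 : 0 <= K0. Proof. exact: le_trans (normr_ge0 _) (rK0 0). Qed.

Section scaled.
Variables (c : 'rV[R]_d) (l V : R) (a : 'rV[R]_d -> R).
Hypotheses (l_gt0 : 0 < l) (V_ge0 : 0 <= V) (atom_a : real_atom m c l V a).
Variables (t : R) (x : 'rV[R]_d).
Hypotheses (t_gt0 : 0 < t).

Local Notation I := (lint (fun y => a y * scaled_kernel t x y)).

Lemma scaled_kernel_supp y : t <= `|x - y| -> scaled_kernel t x y = 0.
Proof.
move=> txy; rewrite /scaled_kernel r_supp ?mulr0// normrZ gtr0_norm ?invr_gt0//.
by rewrite mulrC ler_pdivlMr// mul1r.
Qed.

Lemma conv_far : (forall y, cube c l y -> t <= `|x - y|) -> I = 0.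
Proof.
move=> far; apply: lint0 => y; have [cy|ncy] := pselect (cube c l y).
  by rewrite scaled_kernel_supp ?mulr0//; exact: far.
by case: atom_a => _ _ -> //; rewrite mul0r.
Qed.

Lemma conv_size : `|I| <= V * (2 ^+ d * K0).
Proof.
have -> : 2 ^+ d * K0 = t ^- d * K0 * (2 * t) ^+ d.
  by rewrite exprMn; field; rewrite expf_neq0// gt_eqF.
apply: (@atom_int_le_measure R d m c l V a V_ge0 atom_a (scaled_kernel t x)
  [set y | `|y - x| <= t]).
- by apply: mfun_continuous; exact: scaled_kernel_continuous.
- by rewrite mulr_ge0 ?K0_ge0// invr_ge0 exprn_ge0// ltW.
- by apply: mset_ball; exact: ltW.
- by apply: leb_closed_ball; exact: ltW.
move=> y _; have [yx|xy] := leP `|y - x| t.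
  rewrite indicE mem_set// mulr1 normrM gtr0_norm ?invr_gt0 ?exprn_gt0//.
  by rewrite ler_wpM2l// invr_ge0 exprn_ge0// ltW.
rewrite scaled_kernel_supp ?normr0; last by rewrite distrC ltW.
by rewrite !mulr_ge0 ?K0_ge0// invr_ge0 exprn_ge0// ltW.
Qed.

Lemma conv_cancel : 0 <= K1 -> l < 1 ->
  `|I| <= V * (d%:R ^+ m * K1 * (l / t) ^+ (d + m)).
Proof.
move=> K1_ge0 l1.
have -> : d%:R ^+ m * K1 * (l / t) ^+ (d + m) =
    (d%:R * l) ^+ m * (t ^- d * t^-1 ^+ m * K1) * l ^+ d.
  by rewrite !exprMn !exprD !exprVn; ring.
have ti : 0 <= t^-1 by rewrite invr_ge0 ltW.
rewrite /I; apply: (atom_cancel_le l_gt0 V_ge0 atom_a l1 _ (scaled_family0 t x)).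
- by apply: mfun_continuous; exact: scaled_kernel_continuous.
- exact: scaled_family_deriv.
- by rewrite !mulr_ge0// ?exprn_ge0// -exprVn exprn_ge0.
move=> w wm wi z _; rewrite /scaled_family wm !normrM !normrX normrN.
rewrite (ger0_norm ti) ger0_norm -?exprVn ?exprn_ge0//.
by rewrite ler_wpM2l ?mulr_ge0 ?exprn_ge0//; exact: DK1.
Qed.

(** At scales [t] below the side the size estimate suffices, and at larger
    scales cancellation wins the power of [l / t]; in both cases the integral
    vanishes unless [x] is at distance less than [t] from the cube. *)
Lemma conv_tail : 0 <= K1 -> l < 1 ->
  `|I| <= V * (3 ^+ (d + m) * (d%:R ^+ m * K1 + 2 ^+ d * K0)) * tail (d + m) c l x.
Proof.
move=> K1_ge0 l1; have K00 := K0_ge0; have l0 := l_gt0; have t0 := t_gt0.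
have A0 : 0 <= d%:R ^+ m * K1 by rewrite mulr_ge0// exprn_ge0.
have B0 : 0 <= 2 ^+ d * K0 by rewrite mulr_ge0// exprn_ge0.
have [[y [cy xy]]|H] := pselect (exists y, cube c l y /\ `|x - y| < t); last first.
  rewrite conv_far ?normr0.
    apply: mulr_ge0; last by rewrite ltW// tail_gt0.
    by rewrite mulr_ge0// mulr_ge0 ?exprn_ge0// addr_ge0.
  by move=> y cy; rewrite leNgt; apply/negP => xy; apply: H; exists y.
have xc : `|x - c| <= t + l.
  rewrite -(subrKA y) (le_trans (ler_normD _ _))// lerD ?(ltW xy)//.
  by apply: cube_ball => //; exact: ltW.
have lx : 0 < l + `|x - c| by rewrite ltr_pwDl.
(* as [|x - c| <= t + l], both [l / t] for [l < t] and 1 for [t <= l] are at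
   most [3 * l / (l + |x - c|)] *)
have V3 B : V * (3 ^+ (d + m) * B) * tail (d + m) c l x =
    V * (B * (3 * l / (l + `|x - c|)) ^+ (d + m)).
  by rewrite /tail -[3 * l / _]mulrA; move: (l / _) => g;
    rewrite [(3 * g) ^+ _]exprMn; ring.
rewrite V3 mulrDl mulrDr.
have [lt|tl] := leP l t.
  apply: (le_trans (conv_cancel K1_ge0 l1)).
  rewrite -[leLHS]addr0 lerD//; last first.
    by rewrite !mulr_ge0// exprn_ge0// divr_ge0 ?mulr_ge0// ltW.
  rewrite ler_wpM2l// ler_wpM2l//; apply: lerXn2r.
  - by rewrite nnegrE divr_ge0// ltW.
  - by rewrite nnegrE divr_ge0 ?mulr_ge0// ltW.
  - rewrite ler_pdivrMr// mulrAC ler_pdivlMr// (_ : 3 * l * t = l * (3 * t)); last by ring.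
    by apply: ler_wpM2l; lra.
apply: (le_trans conv_size).
rewrite -[leLHS]add0r lerD//.
  by rewrite !mulr_ge0// exprn_ge0// divr_ge0 ?mulr_ge0// ltW.
rewrite ler_wpM2l// ler_peMr// exprn_ege1// ler_pdivlMr//; lra.
Qed.

(** The local form of the estimate, for scales at most 1. For a cube of side at
    least 1 no cancellation is needed, because the tail of its clamped cube is
    bounded below on the unit cell. *)
Lemma conv_cell (k : 'rV[int]_d) : 0 <= K1 -> t <= 1 -> unit_cube k x ->
  `|I| <= V * (4 ^+ (d + m) * (d%:R ^+ m * K1 + 2 ^+ d * K0)) *
     (if near_cell k c l then tail (d + m) (clamp k c l) (Num.min l 1) x else 0).
Proof.
move=> K1_ge0 t1 kx; have K00 := K0_ge0; have l0 := l_gt0; have t0 := t_gt0.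
have A0 : 0 <= d%:R ^+ m * K1 by rewrite mulr_ge0// exprn_ge0.
have B0 : 0 <= 2 ^+ d * K0 by rewrite mulr_ge0// exprn_ge0.
case: ifPn => [nk|nnk]; last first.
  rewrite mulr0 conv_far ?normr0// => y cy; rewrite leNgt; apply/negP => xy.
  have xy1 : `|x - y| <= 1 by rewrite (le_trans (ltW xy)).
  by rewrite (near_cell_of_dist kx cy xy1) in nnk.
have [l1|l1] := ltP l 1.
  rewrite clamp_small ?(ltW l1)//.
  apply: (le_trans (conv_tail K1_ge0 l1)).
  rewrite ler_wpM2r ?(ltW (tail_gt0 _ _ _ _))// ler_wpM2l// ler_wpM2r ?addr_ge0//.
  by apply: lerXn2r; rewrite ?nnegrE//; lra.
have xc := clamp_dist l_gt0 nk kx.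
apply: (le_trans conv_size); rewrite -mulrA ler_wpM2l// mulrAC /tail -exprMn.
apply: (@le_trans _ _ (d%:R ^+ m * K1 + 2 ^+ d * K0)); first by rewrite lerDr.
rewrite ler_peMl ?addr_ge0// exprn_ege1// div1r ler_pdivlMr ?ltr_pwDl//; lra.
Qed.

End scaled.
End kernels.

Section test_functions.
Context {R : realType} {d : nat}.
Implicit Types (x y c z : 'rV[R]_d) (l V K : R) (a h : 'rV[R]_d -> R) (k : 'rV[int]_d).

(** Only the derivatives of order 0 and [m] enter the Taylor estimates. *)
Definition test_fun m K h := mfun h /\
  exists D : seq 'I_d -> 'rV[R]_d -> R, [/\ D [::] = h,
    forall w i, line_deriv i (D w) (D (i :: w)) &
    forall w y, increasing w -> size w = 0%N \/ size w = m -> `|D w y| <= K * weight y].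

(** Against a function of fixed scale, a small atom gains the power [N] of the
    side by its size and its cancellation. The halo keeps this power and enlarges
    the cube, so that on each unit cell it is below a constant times the tail. *)
Definition halo N c l y : R := Num.min l 1 ^+ N * \1_(cube (c - const_mx 1) (l + 2)) y.

Definition halo_mass N c l : \bar R := (\int[leb R d]_y (halo N c l y * weight y)%:E)%E.

Lemma halo_ge0 N c l y : 0 < l -> 0 <= halo N c l y.
Proof.
by move=> l0; rewrite mulr_ge0// exprn_ge0//; case: (leP l 1) => // _; exact: ltW.
Qed.

Lemma mfun_halo N c l : mfun (halo N c l).
Proof. by apply: mfunZ; apply: mfun_indic; exact: mset_cube. Qed.

Lemma halo_le_tail N c l k x y : 0 < l -> unit_cube k x -> unit_cube k y ->
  halo N c l y <= 4 ^+ N *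
    (if near_cell k c l then tail N (clamp k c l) (Num.min l 1) x else 0).
Proof.
move=> l0 kx ky.
have l1 : 0 < Num.min l 1 by case: (leP l 1).
have l1' : Num.min l 1 <= 1 by case: (leP l 1).
have T0 u : 0 < tail N (clamp k c l) (Num.min l 1) u by exact: tail_gt0.
rewrite /halo indicE; case: (boolP (y \in _)) => [|_]; last first.
  by rewrite mulr0 mulr_ge0 ?exprn_ge0//; case: ifP => // _; exact: ltW.
rewrite inE mulr1 => cy.
have nk : near_cell k c l.
  by apply/forallP => i; have := cy i; have := ky i; rewrite !mxE; lra.
rewrite nk /tail -exprMn; have xc := clamp_dist l0 nk kx.
have D0 := normr_ge0 (x - clamp k c l).
apply: lerXn2r; rewrite ?nnegrE.
- exact: ltW.
- by rewrite mulr_ge0// divr_ge0 ?addr_ge0// ltW.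
rewrite mulrA ler_pdivlMr ?ltr_pwDl// mulrC ler_wpM2r//; [exact: ltW|lra].
Qed.

Section atom_test.
Variables (m : nat) (c : 'rV[R]_d) (l V : R) (a : 'rV[R]_d -> R).
Hypotheses (l_gt0 : 0 < l) (V_ge0 : 0 <= V) (atom_a : real_atom m c l V a).

Definition pairing_cst : R := 1 + d%:R ^+ m * 2 ^+ d.+2.

Lemma cube_halo : cube c l `<=` cube (c - const_mx 1) (l + 2).
Proof. by move=> y cy i; have := cy i; rewrite !mxE; lra. Qed.

Lemma mfun_halo_weight N : mfun (fun y => halo N c l y * weight y).
Proof. by apply: mfunM; [exact: mfun_halo|exact: mfun_weight]. Qed.

Lemma halo_mass_ge_small : l < 1 ->
  ((l ^+ (d + m) * weight c / 2)%:E <= halo_mass (d + m) c l)%E.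
Proof.
move=> l1; have l0 := l_gt0.
pose B : set 'rV[R]_d := [set y | `|y - c| <= 1].
have mB : mset B by apply: mset_ball; exact: ler01.
have mI : emfun (fun y => (\1_B y)%:E) by apply: emfun_EFin; exact: mfun_indic.
pose w0 : R := l ^+ (d + m) * (weight c / 2 ^+ d.+1).
have w00 : 0 <= w0 by rewrite mulr_ge0 ?exprn_ge0 ?divr_ge0 ?exprn_ge0 ?(ltW l0)// ltW// weight_gt0.
have -> : (l ^+ (d + m) * weight c / 2)%:E = (w0%:E * \int[leb R d]_y (\1_B y)%:E)%E.
  rewrite int_indicT// leb_closed_ball// mulr1 -EFinM; congr EFin.
  by rewrite /w0 exprS; field; rewrite expf_neq0.
rewrite -intZl; [|exact: msetT|by move=> x; rewrite lee_fin|exact: mI|exact: w00].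
apply: int_le.
- exact: msetT.
- by move=> y; rewrite -EFinM lee_fin mulr_ge0.
- by apply: emfun_EFin; apply: mfunZ; exact: mfun_indic.
- by apply: emfun_EFin; exact: mfun_halo_weight.
move=> y _; rewrite -EFinM lee_fin indicE.
case: (boolP (y \in _)) => [|_]; last first.
  by rewrite mulr0 mulr_ge0 ?halo_ge0// ltW// weight_gt0.
rewrite inE mulr1 => yc; rewrite /halo indicE mem_set; last first.
  move=> i; have := (rV_norm_leP _ ler01).1 yc i; rewrite !mxE ler_norml; lra.
have -> : Num.min l 1 = l by case: (leP l 1) l1 => //; lra.
rewrite mulr1 ler_wpM2l ?exprn_ge0 ?(ltW l0)// ler_pdivrMr ?exprn_gt0//.
apply: (le_trans (weight_le c y)).
rewrite mulrC ler_wpM2l ?(ltW (weight_gt0 _))//.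
apply: lerXn2r; rewrite ?nnegrE ?addr_ge0//.
by rewrite distrC; have := yc; rewrite /B/=; lra.
Qed.

(** A small atom sees only the Taylor remainder of the test function, hence the
    power of the side; a large one sees the weight on its cube. The mass of the
    halo is at least of the order of both bounds. *)
Lemma atom_test_le K h : 0 <= K -> test_fun m K h ->
  ((`|lint (fun y => a y * h y)|)%:E <=
    (V * K * pairing_cst)%:E * halo_mass (d + m) c l)%E.
Proof.
move=> K0 [mh [D [D0 HD DK]]]; have l0 := l_gt0.
have C0 : 0 <= d%:R ^+ m * 2 ^+ d.+2 :> R by rewrite mulr_ge0 ?exprn_ge0.
have hK y : `|h y| <= K * weight y by rewrite -D0; apply: DK => //; left.
have hm0 : (0 <= halo_mass (d + m) c l)%E.
  by apply: int_ge0 => y; rewrite lee_fin mulr_ge0 ?halo_ge0// ltW// weight_gt0.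
have [l1|l1] := ltP l 1.
  have KW : 0 <= K * (2 ^+ d.+1 * weight c).
    by rewrite mulr_ge0 ?mulr_ge0 ?exprn_ge0// ltW// weight_gt0.
  have := atom_cancel_le l0 V_ge0 atom_a l1 mh D0 HD KW.
  move=> /(_ _)/le_trans H.
  have {}H : `|lint (fun y => a y * h y)| <=
      V * K * (d%:R ^+ m * 2 ^+ d.+2) * (l ^+ (d + m) * weight c / 2).
    apply: H => [w wm wi z zc|].
      apply: (le_trans (DK w z wi (or_intror wm))); apply: ler_wpM2l => //.
      apply: (le_trans (weight_le z c)); rewrite ler_wpM2r ?(ltW (weight_gt0 _))//.
      by apply: lerXn2r; rewrite ?nnegrE ?addr_ge0//; lra.
    by rewrite exprMn exprD !exprS le_eqVlt; apply/orP; left; apply/eqP; field.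
  apply: (@le_trans _ _ ((V * K * pairing_cst)%:E * (l ^+ (d + m) * weight c / 2)%:E)%E).
    rewrite -EFinM lee_fin; apply: (le_trans H); apply: ler_wpM2r.
      by rewrite mulr_ge0 ?mulr_ge0 ?exprn_ge0 ?(ltW l0)// ltW// weight_gt0.
    by rewrite ler_wpM2l ?mulr_ge0// /pairing_cst; lra.
  by rewrite lee_wpmul2l ?lee_fin ?mulr_ge0 ?addr_ge0//; exact: halo_mass_ge_small.
apply: (le_trans (atom_int_le V_ge0 atom_a mh)).
have le_h : (\int[leb R d]_x (`|h x| * \1_(cube c l) x)%:E <= K%:E * halo_mass (d + m) c l)%E.
  rewrite -intZl; [|exact: msetT|by move=> x; rewrite lee_fin mulr_ge0 ?halo_ge0// ltW// weight_gt0|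
    by apply: emfun_EFin; exact: mfun_halo_weight|exact: K0].
  apply: int_le.
  - exact: msetT.
  - by move=> x; rewrite lee_fin mulr_ge0.
  - apply: emfun_EFin; apply: mfunM; first exact: mfun_norm.
    by apply: mfun_indic; exact: mset_cube.
  - by apply: emfun_EFin; apply: mfunZ; exact: mfun_halo_weight.
  move=> x _; rewrite -EFinM lee_fin indicE.
  case: (boolP (x \in _)) => [|_]; last first.
    by rewrite mulr0 mulr_ge0// mulr_ge0 ?halo_ge0// ltW// weight_gt0.
  rewrite inE mulr1 => cx; apply: (le_trans (hK x)); rewrite ler_wpM2l//.
  rewrite /halo indicE mem_set; last exact: cube_halo.
  have -> : Num.min l 1 = 1 by case: (leP l 1) l1 => //; lra.
  by rewrite expr1n !mul1r.
apply: (@le_trans _ _ ((V * K)%:E * halo_mass (d + m) c l)%E).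
  by rewrite EFinM -muleA lee_wpmul2l.
rewrite lee_wpmul2r// lee_fin ler_peMr ?mulr_ge0// /pairing_cst; lra.
Qed.

End atom_test.
End test_functions.

(** * Local estimates for a sequence of cubes *)

Section ereal_series.
Context {R : realType}.

Lemma nneseries_ge (u : nat -> R) n : (forall n, 0 <= u n) ->
  ((\sum_(i < n) u i)%:E <= \sum_(0 <= i <oo) (u i)%:E)%E.
Proof.
move=> u0; rewrite -sumEFin -(big_mkord xpredT (fun i => (u i)%:E)).
by apply: (@nneseries_lim_ge R (fun i => (u i)%:E) xpredT 0 n) => i _ _; rewrite lee_fin.
Qed.

Lemma nneseries_EFin_le (u : nat -> R) (B : \bar R) : (forall n, 0 <= u n) ->
  (forall n, (\sum_(i < n) u i)%:E <= B)%E -> (\sum_(0 <= i <oo) (u i)%:E <= B)%E.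
Proof.
move=> u0 uB; apply: nneseries_le => n; first by rewrite lee_fin.
by rewrite sumEFin big_mkord.
Qed.

Lemma poweR_le_base (q : R) (x y : \bar R) : 0 <= q -> (0 <= x)%E -> (x <= y)%E ->
  (x `^ q <= y `^ q)%E.
Proof.
move=> q0 x0 xy; apply: gt0_ler_poweR => //; rewrite in_itv/= leey andbT//.
exact: le_trans xy.
Qed.

Lemma powRK (q x : R) : q != 0 -> 0 <= x -> (x `^ q) `^ q^-1 = x.
Proof. by move=> q0 x0; rewrite -powRrM mulfV// powRr1. Qed.

Lemma poweRK (q : R) (x : \bar R) : q != 0 -> (0 <= x)%E -> ((x `^ q) `^ q^-1 = x)%E.
Proof. by move=> q0 x0; rewrite -poweRrM mulfV// poweRe1. Qed.

Lemma poweRVK (q : R) (x : \bar R) : q != 0 -> (0 <= x)%E -> ((x `^ q^-1) `^ q = x)%E.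
Proof. by move=> q0 x0; rewrite -poweRrM mulVf// poweRe1. Qed.

End ereal_series.

Section local_estimate.
Context {R : realType} {d : nat}.
Implicit Types (x y c z : 'rV[R]_d) (k : 'rV[int]_d).

Definition cell_tail N k c l x : R :=
  if near_cell k c l then tail N (clamp k c l) (Num.min l 1) x else 0.

Lemma min1_gt0 (l : R) : 0 < l -> 0 < Num.min l 1.
Proof. by move=> l0; case: (leP l 1). Qed.

Lemma cell_tail_ge0 N k c l x : 0 < l -> 0 <= cell_tail N k c l x.
Proof.
by move=> l0; rewrite /cell_tail; case: ifP => // _; rewrite ltW// tail_gt0// min1_gt0.
Qed.

Lemma mfun_cell_tail N k c l : 0 < l -> mfun (cell_tail N k c l).
Proof.
move=> l0; rewrite (_ : cell_tail N k c l =
  if near_cell k c l then tail N (clamp k c l) (Num.min l 1) else fun=> 0).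
  by case: ifP => _; [apply: mfun_tail; exact: min1_gt0|exact: mfun_cst].
by apply/funext => x; rewrite /cell_tail; case: ifP.
Qed.

Variables (cor : nat -> 'rV[R]_d) (len cf : nat -> R).
Hypotheses (len_gt0 : forall n, 0 < len n) (cf_ge0 : forall n, 0 <= cf n).

Definition cube_series x : \bar R :=
  (\sum_(0 <= n <oo) (cf n * \1_(cube (cor n) (len n)) x)%:E)%E.

Definition cell_sum N k n x : R :=
  \sum_(i < n) cf i * cell_tail N k (cor i) (len i) x.

Definition cell_series N k x : \bar R :=
  (\sum_(0 <= i <oo) (cf i * cell_tail N k (cor i) (len i) x)%:E)%E.

Lemma cube_series_ge0 x : (0 <= cube_series x)%E.
Proof. by apply: nneseries_ge0 => n _ _; rewrite lee_fin mulr_ge0. Qed.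

Lemma emfun_cube_series : emfun cube_series.
Proof.
apply: emfun_series => [n x|n]; first by rewrite lee_fin mulr_ge0.
by apply: emfun_EFin; apply: mfunZ; apply: mfun_indic; exact: mset_cube.
Qed.

Lemma cell_sum_ge0 N k n x : 0 <= cell_sum N k n x.
Proof. by apply: sumr_ge0 => i _; rewrite mulr_ge0// cell_tail_ge0. Qed.

Lemma mfun_cell_sum N k n : mfun (cell_sum N k n).
Proof. by apply: mfun_sum => i _; apply: mfunZ; exact: mfun_cell_tail. Qed.

Section exponent.
Variables (N : nat) (q C : R).
Hypotheses (q_gt0 : 0 < q) (C_ge0 : 0 <= C)
  (tail_sum_le : forall s : seq (R * ('rV[R]_d * R)), proper_family s ->
    (\int[leb R d]_x (tail_sum N s x `^ q)%:E <=
      C%:E * \int[leb R d]_x (cube_sum s x `^ q)%:E)%E).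

Definition big_mass k : \bar R := (\int[leb R d]_(x in big_cell k) (cube_series x `^ q))%E.

(** Inside a unit cell only the parts of the cubes within bounded distance
    matter, so that the comparison of tails with cubes localizes. *)
Lemma cell_sum_le k n :
  (\int[leb R d]_(x in unit_cube k) (cell_sum N k n x `^ q)%:E <= C%:E * big_mass k)%E.
Proof.
pose coef i := if near_cell k (cor i) (len i) then cf i else 0.
pose s := [seq (coef i, (clamp k (cor i) (len i), Num.min (len i) 1)) | i : 'I_n <- index_enum 'I_n].
have ps : proper_family s.
  apply/allP => _ /mapP[i _ ->] /=; rewrite min1_gt0// andbT /coef.
  by case: ifP.
have sE x : tail_sum N s x = cell_sum N k n x.
  rewrite /tail_sum big_map; apply: eq_bigr => i _ /=.
  by rewrite /coef /cell_tail; case: ifP => // _; rewrite mul0r mulr0.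
have cube_le x : ((cube_sum s x `^ q)%:E <= cube_series x `^ q * (\1_(big_cell k) x)%:E)%E.
  rewrite indicE; case: (boolP (x \in _)) => [_|nx]; last first.
    rewrite mule0 [X in (X `^ q)%:E](_ : _ = 0) ?powR0 ?gt_eqF//.
    rewrite /cube_sum big_map big1// => i _ /=; rewrite /coef.
    case: ifP => ni; last by rewrite mul0r.
    rewrite indicE memNset ?mulr0// => xi; move: nx; rewrite notin_setE; apply.
    exact: (clamp_big_cell (len_gt0 i) ni).
  rewrite mule1 -poweR_EFin; apply: poweR_le_base; first exact: ltW.
    by rewrite lee_fin cube_sum_ge0.
  apply: le_trans (nneseries_ge n _); last by move=> i; rewrite mulr_ge0.
  rewrite lee_fin /cube_sum big_map; apply: ler_sum => i _ /=.
  rewrite /coef; case: ifP => _; last by rewrite mul0r mulr_ge0.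
  rewrite ler_wpM2l// !indicE; case: (boolP (x \in _)) => // xi.
  rewrite mem_set//; apply: (clamp_cube (len_gt0 i)).
  by rewrite inE in xi; exact: xi.
apply: (@le_trans _ _ (\int[leb R d]_x (tail_sum N s x `^ q)%:E)%E).
  under eq_integral do rewrite -sE.
  apply: int_subset; [exact: mset_unit_cube|exact: msetT| |by move=> x; rewrite lee_fin powR_ge0|by []].
  by apply: emfun_EFin; apply: mfun_powR; exact: mfun_tail_sum.
apply: (le_trans (tail_sum_le ps)); rewrite lee_wpmul2l ?lee_fin//.
rewrite /big_mass [leRHS]int_mkcond; apply: int_le.
- exact: msetT.
- by move=> x; rewrite lee_fin powR_ge0.
- by apply: emfun_EFin; apply: mfun_powR; exact: mfun_cube_sum.
- apply: emfunM; first by apply: emfun_poweR; exact: emfun_cube_series.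
  by apply: emfun_EFin; apply: mfun_indic; exact: mset_big_cell.
- by move=> x _; exact: cube_le.
Qed.

Lemma cell_series_le k (u : 'rV[R]_d -> \bar R) (K : R) : 0 <= K ->
  (forall x, 0 <= u x)%E -> emfun u ->
  (forall x, unit_cube k x -> u x <= K%:E * cell_series N k x)%E ->
  (\int[leb R d]_(x in unit_cube k) (u x `^ q) <= (K `^ q * C)%:E * big_mass k)%E.
Proof.
move=> K0 u0 mu uK.
pose g n x : \bar R := (cell_sum N k n x `^ q)%:E.
have g0 n x : (0 <= g n x)%E by rewrite lee_fin powR_ge0.
have mg n : emfun (g n) by apply: emfun_EFin; apply: mfun_powR; exact: mfun_cell_sum.
have gn x : {homo g^~ x : n m / (n <= m)%N >-> (n <= m)%E}.
  move=> i j ij; rewrite lee_fin; apply: powR_le_base; rewrite ?cell_sum_ge0//; first exact: ltW.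
  rewrite /cell_sum -(big_mkord xpredT (fun i => cf i * cell_tail N k (cor i) (len i) x)).
  rewrite -(big_mkord xpredT (fun i => cf i * cell_tail N k (cor i) (len i) x)).
  rewrite (big_cat_nat _ ij)//= lerDl sumr_ge0// => n _.
  by rewrite mulr_ge0// cell_tail_ge0.
have lim_le : (\int[leb R d]_(x in unit_cube k) (limn (g^~ x)) <= C%:E * big_mass k)%E.
  rewrite (@monotone_convergence _ (Rd R d) R (leb R d) (unit_cube k) (mset_unit_cube k) g);
    [|by move=> n; apply: emfun_on; exact: mg|by move=> n x _; exact: g0|by move=> x _; exact: gn].
  apply: lime_le; last by apply: nearW => n; exact: cell_sum_le.
  apply: ereal_nondecreasing_is_cvgn => i j ij.
  apply: int_le; [exact: mset_unit_cube|exact: g0|exact: mg|exact: mg|].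
  by move=> x _; exact: gn.
have limE x : limn (g^~ x) = ereal_sup (range (g^~ x)).
  by apply/cvg_lim => //; apply: ereal_nondecreasing_cvgn => i j; exact: gn.
have emlim : emfun (fun x => limn (g^~ x)).
  apply: (@emeasurable_fun_cvg _ (Rd R d) R setT g _ mg) => x _.
  by rewrite limE; apply: ereal_nondecreasing_cvgn => i j; exact: gn.
have lim0 x : (0 <= limn (g^~ x))%E.
  apply: lime_ge; first exact: ereal_nondecreasing_is_cvgn.
  by apply: nearW => n; exact: g0.
apply: (@le_trans _ _ (\int[leb R d]_(x in unit_cube k) ((K `^ q)%:E * limn (g^~ x)))%E).
  apply: int_le; [exact: mset_unit_cube|by move=> x; exact: poweR_ge0|exact: emfun_poweR| |].
    by apply: emfunM => //; apply: emfun_EFin; exact: mfun_cst.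
  move=> x kx; apply: (@le_trans _ _ ((K%:E * cell_series N k x) `^ q)%E).
    by apply: poweR_le_base => //; [exact: ltW|exact: uK].
  have cs0 : (0 <= cell_series N k x)%E.
    by apply: nneseries_ge0 => n _ _; rewrite lee_fin mulr_ge0// cell_tail_ge0.
  rewrite poweRM ?lee_fin// poweR_EFin lee_wpmul2l ?lee_fin ?powR_ge0//.
  rewrite -[leRHS](@poweRVK _ q) ?gt_eqF//; apply: poweR_le_base; [exact: ltW|by []|].
  apply: nneseries_EFin_le => [n|n]; first by rewrite mulr_ge0// cell_tail_ge0.
  rewrite -[leLHS](@poweRK _ q) ?gt_eqF// ?lee_fin ?cell_sum_ge0//.
  apply: poweR_le_base; [by rewrite invr_ge0 ltW|exact: poweR_ge0|].
  by rewrite poweR_EFin limE; apply: ereal_sup_ubound; exists n.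
rewrite intZl; [|exact: mset_unit_cube|exact: lim0|exact: emlim|exact: powR_ge0].
by rewrite EFinM -muleA lee_wpmul2l ?lee_fin ?powR_ge0.
Qed.

End exponent.
End local_estimate.

(** * Summation over the unit cells *)

Section esum_powers.
Context {R : realType}.

Lemma esumZ_le (T : choiceType) (k : R) (a : T -> \bar R) : 0 <= k ->
  (forall i, 0 <= a i)%E ->
  (\esum_(i in [set: T]) (k%:E * a i) <= k%:E * \esum_(i in [set: T]) a i)%E.
Proof.
move=> k0 a0; apply: ge_ereal_sup => _ [X [finX XT] <-].
rewrite -ge0_mule_fsumr//.
have H : (\sum_(x \in X) a x <= \esum_(i in [set: T]) a i)%E.
  by apply: ereal_sup_ubound; exists X.
by apply: lee_wpmul2l => //; rewrite lee_fin.
Qed.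

Lemma sum_poweR_le (I : finType) (r : R) (x : I -> \bar R) : 0 < r ->
  (forall i, 0 <= x i)%E ->
  ((\sum_i x i) `^ r <= (#|I|%:R `^ r)%:E * \sum_i (x i `^ r))%E.
Proof.
move=> r0 x0; pose Y : \bar R := (\sum_i (x i `^ r))%E.
have Y0 : (0 <= Y)%E by apply: sume_ge0 => i _; exact: poweR_ge0.
have xY i : (x i <= Y `^ r^-1)%E.
  rewrite -[leLHS](@poweRK _ r) ?gt_eqF//; apply: poweR_le_base.
  - by rewrite invr_ge0 ltW.
  - exact: poweR_ge0.
  - rewrite /Y (bigD1 i)//= leeDl// sume_ge0// => j _; exact: poweR_ge0.
have : (\sum_i x i <= (#|I|%:R)%:E * Y `^ r^-1)%E.
  apply: (@le_trans _ _ (\sum_(i : I) Y `^ r^-1)%E); first exact: lee_sum.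
  by rewrite sumr_const mule_natl.
have sx0 : (0 <= \sum_i x i)%E by apply: sume_ge0.
move=> /(poweR_le_base (ltW r0) sx0) /le_trans; apply.
by rewrite poweRM ?poweR_ge0 ?lee_fin// poweR_EFin poweRVK// gt_eqF.
Qed.

Lemma esum_shift_poweR_le (V : zmodType) (I : finType) (s : I -> V) (r : R)
    (X : V -> \bar R) : 0 < r -> (forall k, 0 <= X k)%E ->
  (\esum_(k in [set: V]) ((\sum_i X (k + s i)%R) `^ r) <=
   (#|I|%:R `^ r * #|I|%:R)%:E * \esum_(k in [set: V]) (X k `^ r))%E.
Proof.
move=> r0 X0.
apply: (@le_trans _ _ (\esum_(k in [set: V])
    ((#|I|%:R `^ r)%:E * \sum_i (X (k + s i)%R `^ r)))%E).
  by apply: le_esum => k _; exact: sum_poweR_le.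
apply: (le_trans (esumZ_le (powR_ge0 _ _) _)).
  by move=> k; apply: sume_ge0 => i _; exact: poweR_ge0.
rewrite EFinM -muleA lee_wpmul2l ?lee_fin ?powR_ge0//.
rewrite esum_sum; last by move=> *; exact: poweR_ge0.
rewrite (eq_bigr (fun=> \esum_(k in [set: V]) (X k `^ r)%E)) => [|i _].
  by rewrite sumr_const mule_natl.
apply/esym; apply: (@reindex_esum R V V setT setT (fun k => k + s i)).
split=> //; first by move=> k l _ _; exact: addIr.
by move=> k _; exists (k - s i) => //; rewrite subrK.
Qed.

Lemma esum_ge_term (T : choiceType) (a : T -> \bar R) k : (forall i, 0 <= a i)%E ->
  (a k <= \esum_(i in [set: T]) a i)%E.
Proof.
move=> a0; apply: esum_ge; exists [set k]; first by split.
by rewrite fsbig_set1.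
Qed.

(** Convergence to zero of a sequence of nonnegative extended reals. *)
Definition vanishing (u : nat -> \bar R) := forall e : R, 0 < e ->
  exists M, forall n, (M <= n)%N -> (u n <= e%:E)%E.

Lemma vanishing_cvg (u : nat -> \bar R) : (forall n, 0 <= u n)%E ->
  vanishing u -> u n @[n --> \oo] --> 0%E.
Proof.
move=> u0 vu.
have [M HM] := vu 1 ltr01.
have fin n : (M <= n)%N -> u n \is a fin_num.
  by move=> /HM un; rewrite ge0_fin_numE// (le_lt_trans un)// ltry.
apply/fine_cvgP; split.
  by exists M => // n; exact: fin.
apply/cvgrPdist_le => e e0; have [M' HM'] := vu e e0.
exists (maxn M M') => // n /=; rewrite geq_max => /andP[Mn M'n].
rewrite sub0r normrN ger0_norm ?fine_ge0//.
by rewrite -lee_fin fineK ?fin//; exact: HM'.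
Qed.

Lemma cvg_vanishing (u : nat -> \bar R) : u n @[n --> \oo] --> 0%E -> vanishing u.
Proof.
move=> /fine_cvgP[[M _ finM]] /cvgrPdist_le cu e e0; have [M' _ HM'] := cu e e0.
exists (maxn M M') => n; rewrite geq_max => /andP[Mn M'n].
have := HM' n M'n; rewrite sub0r normrN => un.
rewrite -(fineK (finM n Mn)) lee_fin; exact: le_trans (ler_norm _) un.
Qed.

Lemma vanishing_le (u v : nat -> \bar R) : (forall n, u n <= v n)%E ->
  vanishing v -> vanishing u.
Proof.
move=> uv vv e e0; have [M HM] := vv e e0; exists M => n /HM.
exact: le_trans (uv n).
Qed.

Lemma vanishing_poweR (u : nat -> \bar R) (r : R) : 0 < r -> (forall n, 0 <= u n)%E ->
  vanishing u -> vanishing (fun n => u n `^ r)%E.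
Proof.
move=> r0 u0 vu e e0; have [M HM] := vu (e `^ r^-1) (powR_gt0 _ e0).
exists M => n /HM un; rewrite -[e](powRr1 (ltW e0)) -(mulVf (lt0r_neq0 r0)) powRrM.
by rewrite -poweR_EFin; apply: poweR_le_base => //; exact: ltW.
Qed.

Lemma vanishingZ (u : nat -> \bar R) (k : R) : 0 <= k -> (forall n, 0 <= u n)%E ->
  vanishing u -> vanishing (fun n => k%:E * u n)%E.
Proof.
move=> k0 u0 vu e e0; have k1 : 0 < k + 1 by rewrite ltr_wpDl.
have [M HM] := vu (e / (k + 1)) (divr_gt0 e0 k1).
exists M => n /HM un.
apply: (@le_trans _ _ (k%:E * (e / (k + 1))%:E)%E); first by rewrite lee_wpmul2l.
by rewrite -EFinM lee_fin mulrA ler_pdivrMr// mulrC ler_wpM2l ?(ltW e0)// lerDl.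
Qed.

(** The dominating sum is small outside a finite set of indices. *)
Lemma esum_dominated_vanishing (T : choiceType) (a : nat -> T -> \bar R) (b : T -> \bar R) :
  (forall n i, 0 <= a n i)%E -> (forall n i, a n i <= b i)%E ->
  (\esum_(i in [set: T]) b i < +oo)%E ->
  (forall i, vanishing (a ^~ i)) ->
  vanishing (fun n => \esum_(i in [set: T]) a n i).
Proof.
move=> a0 ab bfin acvg e e0.
have b0 i : (0 <= b i)%E by exact: le_trans (a0 0%N i) (ab 0%N i).
have e2 : 0 < e / 2 by rewrite divr_gt0.
have finb : \esum_(i in [set: T]) b i \is a fin_num.
  by rewrite ge0_fin_numE//; apply: esum_ge0 => i _; exact: b0.
have [_ [X [finX _] <-]] := @ub_ereal_sup_adherent R _ (e / 2) e2 finb.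
rewrite -/(esum _ _) => HX.
have split_sum (c : T -> \bar R) : (forall i, 0 <= c i)%E ->
    \esum_(i in [set: T]) c i = (\sum_(i \in X) c i + \esum_(i in ~` X) c i)%E.
  move=> c0; have := esumID X setT c (fun i _ => c0 i); rewrite !setTI => ->.
  by rewrite esum_fset.
have tail_le : (\esum_(i in ~` X) b i <= (e / 2)%:E)%E.
  have finS : (\sum_(i \in X) b i)%E \is a fin_num.
    rewrite ge0_fin_numE; last by apply: fsume_ge0 => i _; exact: b0.
    apply: le_lt_trans bfin; rewrite split_sum// leeDl//.
    by apply: esum_ge0 => i _; exact: b0.
  move: HX; rewrite split_sum// => HX.
  rewrite leNgt; apply/negP => lt_e; move: HX; apply/negP; rewrite -leNgt.
  rewrite leeBrDr//.
  by rewrite leeD2l// ltW.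
have [M HM] : exists M, forall n, (M <= n)%N -> (\sum_(i \in X) a n i <= (e / 2)%:E)%E.
  suff [M HM] : exists M, forall n, (M <= n)%N ->
      (\sum_(i <- finmap.enum_fset (fset_set X)) a n i <= (e / 2)%:E)%E.
    by exists M => n Mn; rewrite fsbig_finite//; exact: HM.
  elim: (finmap.enum_fset (fset_set X)) (e / 2) e2 {HX tail_le} => [|i s IH] eps eps0.
    by exists 0%N => n _; rewrite big_nil lee_fin ltW.
  have eps2 : 0 < eps / 2 by rewrite divr_gt0.
  have [M HM] := IH _ eps2; have [M' HM'] := acvg i _ eps2.
  exists (maxn M M') => n; rewrite geq_max => /andP[Mn M'n].
  by rewrite big_cons [eps]splitr EFinD leeD ?HM ?HM'.
exists M => n Mn; rewrite (split_sum (a n))// [e]splitr EFinD leeD//; first exact: HM.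
by apply: le_trans tail_le; apply: le_esum => i _; exact: ab.
Qed.

End esum_powers.

Section amalgam_estimates.
Context {R : realType} {d : nat}.
Implicit Types (x y c z : 'rV[R]_d) (k : 'rV[int]_d) (u : 'rV[R]_d -> \bar R).

Lemma amalgam_normE (q p : R) u : 0 < q -> 0 < p -> (forall x, 0 <= u x)%E ->
  amalgam_norm q%:E p%:E u =
  ((\esum_(k in [set: 'rV[int]_d])
     ((\int[leb R d]_(x in unit_cube k) (u x `^ q)) `^ (p / q))) `^ p^-1)%E.
Proof.
move=> q0 p0 u0; rewrite /amalgam_norm /lseq_norm; congr poweR.
apply: eq_esum => k _; rewrite /Lr_norm unlock -poweRrM mulrC; congr poweR.
rewrite int_mkcond; apply: eq_integral => x _.
rewrite indicE; case: (x \in _); first by rewrite !mule1 gee0_abs.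
by rewrite !mule0 abse0 poweR0r// gt_eqF.
Qed.

Lemma int_esum (I : finType) (D : set 'rV[R]_d) (h : I -> 'rV[R]_d -> \bar R) : mset D ->
  (forall i, emfun (h i)) -> (forall i x, 0 <= h i x)%E ->
  (\int[leb R d]_(x in D) (\sum_i h i x) = \sum_i \int[leb R d]_(x in D) h i x)%E.
Proof.
move=> mD mh h0.
apply: (@ge0_integral_sum _ (Rd R d) R (leb R d) D mD I h _ _ (index_enum I)) => [i|i x _].
- exact: emfun_on.
- exact: h0.
Qed.

Lemma emfun_sum (I : finType) (h : I -> 'rV[R]_d -> \bar R) :
  (forall i, emfun (h i)) -> emfun (fun x => \sum_i h i x)%E.
Proof. by move=> mh; exact: (@emeasurable_sum _ (Rd R d) R setT I (index_enum I) h mh). Qed.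

(** The translations by which the unit cells cover the enlarged one. *)
Definition cell_shift (e : {ffun 'I_d -> 'I_6}) : 'rV[int]_d :=
  \row_i ((e i : nat)%:Z - 2).

Lemma big_cell_cover k x : big_cell k x -> exists e, unit_cube (k + cell_shift e) x.
Proof.
move=> kx.
exists [ffun i => inord (absz (Num.floor (x ord0 i) - k ord0 i + 2))] => i.
rewrite !mxE ffunE.
have /andP[x1 x2] := kx i.
have /andP[f1 f2] := floor_itv (x ord0 i).
have g1 : k ord0 i - 2 <= Num.floor (x ord0 i).
  by rewrite floor_ge_int intrB.
have g2 : Num.floor (x ord0 i) < k ord0 i + 4.
  by rewrite floor_lt_int intrD.
rewrite inordK.
  rewrite gez0_abs; last by lia.
  rewrite (_ : k ord0 i + _ = Num.floor (x ord0 i)); last by lia.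
  by move: f2; rewrite intrD => ->; rewrite f1.
lia.
Qed.

Section masses.
Variables (cor : nat -> 'rV[R]_d) (len cf : nat -> R) (N : nat) (q C : R).
Hypotheses (len_gt0 : forall n, 0 < len n) (cf_ge0 : forall n, 0 <= cf n).
Hypotheses (q_gt0 : 0 < q) (C_ge0 : 0 <= C)
  (tail_sum_le : forall s : seq (R * ('rV[R]_d * R)), proper_family s ->
    (\int[leb R d]_x (tail_sum N s x `^ q)%:E <=
      C%:E * \int[leb R d]_x (cube_sum s x `^ q)%:E)%E).

Let T := cube_series cor len cf.

Definition cell_mass k : \bar R := (\int[leb R d]_(x in unit_cube k) (cube_series cor len cf x `^ q))%E.

Lemma cell_mass_ge0 k : (0 <= cell_mass k)%E.
Proof. by apply: int_ge0 => x; exact: poweR_ge0. Qed.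

Lemma big_mass_le k : (big_mass cor len cf q k <= \sum_e cell_mass (k + cell_shift e)%R)%E.
Proof.
have mT : emfun (fun x => T x `^ q)%E by apply: emfun_poweR; exact: emfun_cube_series.
have mI e : emfun (fun x => (\1_(unit_cube (k + cell_shift e)) x : R)%:E).
  by apply: emfun_EFin; apply: mfun_indic; exact: mset_unit_cube.
have E : (\sum_e cell_mass (k + cell_shift e)%R = \int[leb R d]_x
    \sum_e (T x `^ q * (\1_(unit_cube (k + cell_shift e)) x)%:E))%E.
  rewrite int_esum; [|exact: msetT|by move=> e; exact: emfunM|
    by move=> e x; rewrite mule_ge0 ?poweR_ge0 ?lee_fin].
  by apply: eq_bigr => e _; rewrite /cell_mass int_mkcond.
rewrite E /big_mass int_mkcond; apply: int_le.
- exact: msetT.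
- by move=> x; rewrite mule_ge0 ?poweR_ge0 ?lee_fin.
- apply: emfunM => //; apply: emfun_EFin; apply: mfun_indic; exact: mset_big_cell.
- by apply: emfun_sum => e; exact: emfunM.
move=> x _; rewrite [X in (_ * X%:E <= _)%E]indicE.
have t0 e : (0 <= T x `^ q * (\1_(unit_cube (k + cell_shift e)) x)%:E)%E.
  by rewrite mule_ge0 ?poweR_ge0 ?lee_fin.
case: (boolP (x \in _)) => [|_]; last by rewrite mule0 sume_ge0.
rewrite inE => /big_cell_cover[e xe].
by rewrite (bigD1 e)//= indicE mem_set// leeDl// sume_ge0.
Qed.

(** Each enlarged cell is covered by finitely many translates of its unit cell,
    and the sum over all cells is invariant under translation. *)
Lemma amalgam_power_le (p K : R) u : 0 < p -> 0 <= K ->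
  (forall x, 0 <= u x)%E -> emfun u ->
  (forall k x, unit_cube k x -> u x <= K%:E * cell_series cor len cf N k x)%E ->
  (\esum_(k in [set: 'rV[int]_d])
     ((\int[leb R d]_(x in unit_cube k) (u x `^ q)) `^ (p / q)) <=
   ((K `^ q * C) `^ (p / q) * (#|{ffun 'I_d -> 'I_6}|%:R `^ (p / q) * #|{ffun 'I_d -> 'I_6}|%:R))%:E *
   \esum_(k in [set: 'rV[int]_d]) (cell_mass k `^ (p / q)))%E.
Proof.
move=> p0 K0 u0 mu uK; have r0 : 0 < p / q by rewrite divr_gt0.
have kc0 : 0 <= K `^ q * C by rewrite mulr_ge0 ?powR_ge0.
apply: (@le_trans _ _ (\esum_(k in [set: 'rV[int]_d])
   (((K `^ q * C) `^ (p / q))%:E * (\sum_e cell_mass (k + cell_shift e)%R) `^ (p / q)))%E).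
  apply: le_esum => k _; rewrite -poweR_EFin -poweRM ?lee_fin//; last first.
    by apply: sume_ge0 => e _; exact: cell_mass_ge0.
  apply: poweR_le_base; [exact: ltW|by apply: int_ge0 => x; exact: poweR_ge0|].
  apply: (le_trans (cell_series_le len_gt0 cf_ge0 q_gt0 C_ge0 tail_sum_le K0 u0 mu (uK k))).
  by rewrite lee_wpmul2l ?lee_fin//; exact: big_mass_le.
apply: (le_trans (esumZ_le (powR_ge0 _ _) _)); first by move=> k; exact: poweR_ge0.
rewrite [in leRHS]EFinM -muleA lee_wpmul2l ?lee_fin ?powR_ge0//.
by apply: esum_shift_poweR_le => // k; exact: cell_mass_ge0.
Qed.

Section halo_sums.
Variable A : R.
Hypothesis big_mass_A : forall k, (big_mass cor len cf q k <= A%:E)%E.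

(** On a unit cell, every value of the sum of the halos is at most a constant
    times every value of the sum of the cell tails, whose power [q] has a bounded
    integral there. *)
Lemma halo_sum_le n y :
  \sum_(i < n) cf i * halo N (cor i) (len i) y <= 4 ^+ N * (C * A) `^ q^-1.
Proof.
set S := (X in X <= _); pose k : 'rV[int]_d := \row_i Num.floor (y ord0 i).
have ky : unit_cube k y by exact: unit_cube_floor.
have S0 : 0 <= S by apply: sumr_ge0 => i _; rewrite mulr_ge0// halo_ge0.
have p4 : 0 < 4 ^+ N :> R by rewrite exprn_gt0.
have Sx x : unit_cube k x -> S / 4 ^+ N <= cell_sum cor len cf N k n x.
  move=> kx; rewrite ler_pdivrMr// mulrC /cell_sum mulr_sumr; apply: ler_sum => i _.
  by rewrite [leRHS]mulrCA ler_wpM2l//; exact: halo_le_tail.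
have SN0 : 0 <= S / 4 ^+ N by rewrite divr_ge0// ltW.
have Sq : (S / 4 ^+ N) `^ q <= C * A.
  rewrite -lee_fin EFinM.
  apply: (@le_trans _ _ (C%:E * big_mass cor len cf q k)%E); last by rewrite lee_wpmul2l ?lee_fin.
  apply: le_trans _ (cell_sum_le cor len_gt0 cf_ge0 q_gt0 C_ge0 tail_sum_le k n).
  rewrite -[leLHS]mule1 -(leb_unit_cube k) -int_cst; last exact: mset_unit_cube.
  apply: int_le.
  - exact: mset_unit_cube.
  - by move=> x; rewrite lee_fin powR_ge0.
  - by apply: emfun_EFin; exact: mfun_cst.
  - by apply: emfun_EFin; apply: mfun_powR; exact: mfun_cell_sum.
  - by move=> x kx; rewrite lee_fin; apply: powR_le_base; [exact: ltW|exact: SN0|exact: Sx].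
rewrite -ler_pdivrMl// mulrC -[leLHS](powRK (lt0r_neq0 q_gt0) SN0).
by apply: powR_le_base; [rewrite invr_ge0 ltW|exact: powR_ge0|exact: Sq].
Qed.

Lemma halo_mass_ge0 i : (0 <= halo_mass N (cor i) (len i))%E.
Proof. by apply: int_ge0 => y; rewrite lee_fin mulr_ge0 ?halo_ge0// ltW// weight_gt0. Qed.

Lemma halo_mass_fin i : halo_mass N (cor i) (len i) \is a fin_num.
Proof.
rewrite ge0_fin_numE ?halo_mass_ge0//.
have [W HW] := @weight_integral R d.
apply: (@le_lt_trans _ _ (\int[leb R d]_y (weight y)%:E)%E); last by rewrite HW ltry.
apply: int_le; [exact: msetT| |by apply: emfun_EFin; exact: mfun_halo_weight|
  by apply: emfun_EFin; exact: mfun_weight|].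
  by move=> y; rewrite lee_fin mulr_ge0 ?halo_ge0// ltW// weight_gt0.
move=> y _; rewrite lee_fin ler_piMl ?(ltW (weight_gt0 _))//.
rewrite /halo mulr_ile1 ?exprn_ge0 ?(ltW (min1_gt0 _))//.
  by rewrite exprn_ile1 ?(ltW (min1_gt0 _))//; case: (leP (len i) 1).
Qed.

(** The sum of the halos is bounded, and the weight is integrable; this is what
    makes the pairings of the atoms with a test function summable. *)
Lemma halo_mass_sum_le : exists B : R, forall n,
  \sum_(i < n) cf i * fine (halo_mass N (cor i) (len i)) <= B.
Proof.
have [W HW] := @weight_integral R d.
exists (4 ^+ N * (C * A) `^ q^-1 * W) => n.
have B0 : 0 <= 4 ^+ N * (C * A) `^ q^-1 by rewrite mulr_ge0 ?powR_ge0 ?exprn_ge0.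
rewrite -lee_fin EFinM -HW -intZl; [|exact: msetT|
  by move=> y; rewrite lee_fin ltW// weight_gt0|by apply: emfun_EFin; exact: mfun_weight|exact: B0].
rewrite -sumEFin (eq_bigr (fun i : 'I_n => \int[leb R d]_y
    (cf i * (halo N (cor i) (len i) y * weight y))%:E)%E); last first.
  move=> i _; rewrite EFinM fineK ?halo_mass_fin// -intZl; [by []|exact: msetT| | |by []].
    by move=> y; rewrite lee_fin mulr_ge0 ?halo_ge0// ltW// weight_gt0.
  by apply: emfun_EFin; exact: mfun_halo_weight.
rewrite -(@int_sum R d _ (index_enum 'I_n) setT
   (fun (i : 'I_n) y => cf i * (halo N (cor i) (len i) y * weight y))); first last.
- by move=> i _ y; rewrite mulr_ge0// mulr_ge0 ?halo_ge0// ltW// weight_gt0.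
- by move=> i _; apply: mfunZ; exact: mfun_halo_weight.
- exact: msetT.
apply: int_le.
- exact: msetT.
- by move=> y; rewrite lee_fin sumr_ge0// => i _; rewrite mulr_ge0// mulr_ge0 ?halo_ge0// ltW// weight_gt0.
- by apply: emfun_EFin; apply: mfun_sum => i _; apply: mfunZ; exact: mfun_halo_weight.
- by apply: emfun_EFin; apply: mfunZ; exact: mfun_weight.
move=> y _; rewrite -EFinM lee_fin.
under eq_bigr do rewrite mulrA.
by rewrite -mulr_suml ler_wpM2r ?(ltW (weight_gt0 _))//; exact: halo_sum_le.
Qed.

End halo_sums.
End masses.
End amalgam_estimates.

Section tails_of_series.
Context {R : realType} {d : nat}.
Variables (cor : nat -> 'rV[R]_d) (len cf : nat -> R) (q : R).
Hypotheses (cf_ge0 : forall n, 0 <= cf n) (q_gt0 : 0 < q).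
Implicit Types (x : 'rV[R]_d) (k : 'rV[int]_d).

Definition from_index (M : nat) (b : nat -> R) n := if (M <= n)%N then b n else 0.

Lemma from_index_ge0 M n : 0 <= from_index M cf n.
Proof. by rewrite /from_index; case: ifP. Qed.

Lemma from_index_le M n : from_index M cf n <= cf n.
Proof. by rewrite /from_index; case: ifP. Qed.

Lemma nneseries_from_index (u : nat -> R) M :
  (\sum_(0 <= n <oo) (if (M <= n)%N then u n else 0)%:E =
   \sum_(M <= n <oo) (u n)%:E)%E.
Proof.
rewrite [RHS]eseries_cond [RHS]eseries_mkcond; apply: eq_eseriesr => n _ /=.
by case: ifP.
Qed.

Lemma cube_series_from_le M x :
  (cube_series cor len (from_index M cf) x <= cube_series cor len cf x)%E.
Proof.
apply: nneseries_EFin_le => [n|n]; first by rewrite mulr_ge0 ?from_index_ge0.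
apply: (@le_trans _ _ ((\sum_(i < n) cf i * \1_(cube (cor i) (len i)) x)%:E)).
  by rewrite lee_fin; apply: ler_sum => i _; rewrite ler_wpM2r ?from_index_le.
by apply: (@nneseries_ge R (fun i => cf i * \1_(cube (cor i) (len i)) x)) => i; rewrite mulr_ge0.
Qed.

Lemma cube_series_from_vanishing x : (cube_series cor len cf x < +oo)%E ->
  vanishing (fun M => cube_series cor len (from_index M cf) x).
Proof.
move=> xfin; apply: cvg_vanishing.
pose u n : R := cf n * \1_(cube (cor n) (len n)) x.
rewrite (_ : (fun M => _) = (fun M => \sum_(M <= n <oo) (u n)%:E)%E).
  by apply: nneseries_tail_cvg => // n _; rewrite lee_fin mulr_ge0.
apply/funext => M; rewrite -nneseries_from_index; apply: eq_eseriesr => n _.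
by rewrite /from_index /u; case: ifP => // _; rewrite mul0r.
Qed.

Lemma cell_mass_from_le M k :
  (cell_mass cor len (from_index M cf) q k <= cell_mass cor len cf q k)%E.
Proof.
apply: int_le; [exact: mset_unit_cube|by move=> x; exact: poweR_ge0| | |].
- by apply: emfun_poweR; apply: emfun_cube_series; exact: from_index_ge0.
- by apply: emfun_poweR; exact: emfun_cube_series.
- move=> x _; apply: poweR_le_base; [exact: ltW| |exact: cube_series_from_le].
  by apply: cube_series_ge0; exact: from_index_ge0.
Qed.

Lemma cell_mass_from_vanishing k : (cell_mass cor len cf q k < +oo)%E ->
  vanishing (fun M => cell_mass cor len (from_index M cf) q k).
Proof.
move=> kfin; apply: cvg_vanishing.
have mD := @mset_unit_cube R d k.
pose g x : \bar R := (cube_series cor len cf x `^ q)%E.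
pose f M x : \bar R := (cube_series cor len (from_index M cf) x `^ q)%E.
have f0 M x : (0 <= f M x)%E by exact: poweR_ge0.
have g0 x : (0 <= g x)%E by exact: poweR_ge0.
have mg : emfun g by apply: emfun_poweR; exact: emfun_cube_series.
have mf M : emfun (f M).
  by apply: emfun_poweR; apply: emfun_cube_series; exact: from_index_ge0.
have fg M x : (f M x <= g x)%E.
  apply: poweR_le_base; [exact: ltW| |exact: cube_series_from_le].
  by apply: cube_series_ge0; exact: from_index_ge0.
have ig : (leb R d).-integrable (unit_cube k) (g : Rd R d -> \bar R).
  apply/integrableP; split; first exact: emfun_on.
  by under eq_integral do rewrite gee0_abs//.
have aeF := ae_filter_ringOfSetsType (leb R d).
have ae_cvg : {ae leb R d, forall x, unit_cube k x -> f M x @[M --> \oo] --> 0%E}.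
  have := integrable_ae mD ig.
  apply: (@filterS _ (almost_everywhere (leb R d)) aeF) => x /[apply] xfin.
  apply: vanishing_cvg => // ; apply: vanishing_poweR => //.
    by move=> n; apply: cube_series_ge0; exact: from_index_ge0.
  apply: cube_series_from_vanishing; apply: (@lty_poweRy R _ q); first by rewrite gt_eqF.
  by move: xfin; rewrite ge0_fin_numE.
have ae_le : {ae leb R d, forall x, forall n, unit_cube k x -> (`|f n x| <= g x)%E}.
  apply: (@filterE _ (almost_everywhere (leb R d)) aeF) => x n _.
  by rewrite gee0_abs.
have [_ _] := @dominated_convergence _ (Rd R d) R (leb R d) (unit_cube k) mD f (cst 0%E) g
  (fun M => emfun_on (mf M)) (measurable_cst _) ae_cvg ig ae_le.
by rewrite integral0.
Qed.

Lemma esum_cell_mass_from_vanishing (r : R) : 0 < r ->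
  (\esum_(k in [set: 'rV[int]_d]) (cell_mass cor len cf q k `^ r) < +oo)%E ->
  vanishing (fun M => \esum_(k in [set: 'rV[int]_d])
    (cell_mass cor len (from_index M cf) q k `^ r))%E.
Proof.
move=> r0 fin.
apply: (esum_dominated_vanishing (b := fun k => (cell_mass cor len cf q k `^ r)%E)) => //.
- by move=> n k; exact: poweR_ge0.
- move=> n k; apply: poweR_le_base; [exact: ltW|exact: cell_mass_ge0|exact: cell_mass_from_le].
move=> k; apply: vanishing_poweR => //; first by move=> n; exact: cell_mass_ge0.
apply: cell_mass_from_vanishing; apply: (@lty_poweRy R _ r); first by rewrite gt_eqF.
apply: le_lt_trans fin.
by apply: (esum_ge_term (a := fun k => (cell_mass cor len cf q k `^ r)%E)) => i; exact: poweR_ge0.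
Qed.

End tails_of_series.

(** * Complex-valued functions and Schwartz functions *)

Section complex_modulus.
Context {R : realType}.
Implicit Types z w : R[i].

Lemma cmod_ge0 z : 0 <= cmod z.
Proof. by case: z => a b; exact: sqrtr_ge0. Qed.

Lemma cmodM z w : cmod (z * w) = cmod z * cmod w.
Proof. exact: ComplexField.Normc.normcM. Qed.

Lemma cmod_real (r : R) : cmod r%:C = `|r|.
Proof. by rewrite /cmod /= expr0n addr0 sqrtr_sqr. Qed.

Lemma cmodD z w : cmod (z + w) <= cmod z + cmod w.
Proof. exact: le_normcD. Qed.

Lemma Re_le_cmod z : `|complex.Re z| <= cmod z.
Proof.
case: z => a b /=; rewrite -sqrtr_sqr /cmod/=.
by rewrite ler_wsqrtr// lerDl sqr_ge0.
Qed.

Lemma Im_le_cmod z : `|complex.Im z| <= cmod z.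
Proof.
case: z => a b /=; rewrite -sqrtr_sqr /cmod/=.
by rewrite ler_wsqrtr// lerDr sqr_ge0.
Qed.

Lemma cmod_le_ReIm z : cmod z <= `|complex.Re z| + `|complex.Im z|.
Proof.
case: z => a b /=; rewrite /cmod/=.
rewrite -[leRHS]ger0_norm ?addr_ge0// -sqrtr_sqr ler_wsqrtr//.
rewrite -(real_normK (num_real a)) -(real_normK (num_real b)).
have := normr_ge0 a; have := normr_ge0 b; nra.
Qed.

Lemma cmodN z : cmod (- z) = cmod z.
Proof. by case: z => a b; rewrite /cmod/= !sqrrN. Qed.

Lemma cmod0 : cmod (0 : R[i]) = 0.
Proof. by rewrite /cmod/= expr0n addr0 sqrtr0. Qed.

Lemma cmod_sum (I : Type) (s : seq I) (P : pred I) (F : I -> R[i]) :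
  cmod (\sum_(i <- s | P i) F i) <= \sum_(i <- s | P i) cmod (F i).
Proof.
elim/big_ind2 : _ => //; first by rewrite cmod0.
by move=> a u b v au bv; rewrite (le_trans (cmodD _ _))// lerD.
Qed.

Lemma reM z w : complex.Re (z * w) =
  complex.Re z * complex.Re w - complex.Im z * complex.Im w.
Proof. by case: z w => [a b] [c e]. Qed.

Lemma imM z w : complex.Im (z * w) =
  complex.Re z * complex.Im w + complex.Im z * complex.Re w.
Proof. by case: z w => [a b] [c e]. Qed.

Lemma reD z w : complex.Re (z + w) = complex.Re z + complex.Re w.
Proof. by case: z w => [a b] [c e]. Qed.

Lemma imD z w : complex.Im (z + w) = complex.Im z + complex.Im w.
Proof. by case: z w => [a b] [c e]. Qed.

Lemma reB z w : complex.Re (z - w) = complex.Re z - complex.Re w.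
Proof. by case: z w => [a b] [c e]. Qed.

Lemma imB z w : complex.Im (z - w) = complex.Im z - complex.Im w.
Proof. by case: z w => [a b] [c e]. Qed.

Lemma complexP z w : complex.Re z = complex.Re w -> complex.Im z = complex.Im w -> z = w.
Proof. by case: z w => [a b] [c e] /= -> ->. Qed.

End complex_modulus.

Section schwartz_functions.
Context {R : realType} {d : nat}.
Hypothesis d_gt0 : (0 < d)%N.
Implicit Types (psi : 'rV[R]_d -> R[i]) (y : 'rV[R]_d) (w : seq 'I_d) (a b : @multi_index d).

Definition word_index w : @multi_index d := [ffun i => count_mem i w].

Lemma mdeg_word_index w : mdeg (word_index w) = size w.
Proof.
rewrite /mdeg; under eq_bigr do rewrite ffunE.
elim: w => [|i w IH] /=; first by rewrite big1.
rewrite big_split/= IH (bigD1 i)//= eqxx big1 ?addn0 ?add1n// => j ji.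
by rewrite eq_sym (negbTE ji).
Qed.

(** An increasing word spells the derivatives in the order used for
    multi-indices. *)
Lemma mderive_word w psi : increasing w -> mderive (word_index w) psi = partials w psi.
Proof.
move=> incw; rewrite /mderive; congr partials.
have leT : transitive (fun i j : 'I_d => (i <= j)%N).
  by move=> j i k; exact: leq_trans.
apply: (@sorted_eq _ (fun i j : 'I_d => (i <= j)%N)) => //.
- by move=> i j ij; apply/val_inj/anti_leq.
- have : pairwise (fun i j : 'I_d => (i < j)%N) (enum 'I_d).
    rewrite -(@pairwise_map _ _ val ltn) val_enum_ord -sorted_pairwise; last exact: ltn_trans.
    exact: iota_ltn_sorted.
  rewrite sorted_pairwise//; elim: (enum 'I_d) => //= i s IH /andP[is_ /IH IHs].
  rewrite pairwise_cat IHs andbT; apply/andP; split.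
    apply/allrelP => j k; rewrite mem_nseq => /andP[_ /eqP->] /flattenP[t /mapP[l ls ->]].
    by rewrite mem_nseq => /andP[_ /eqP->]; rewrite ltnW//; exact: (allP is_).
  by elim: (word_index w i) => //= n ->; rewrite andbT all_nseq leqnn orbT.
- apply/permP => P; rewrite -!sum1_count.
  rewrite big_flatten/= big_map big_enum/=.
  have E (i : 'I_d) : (\sum_(j <- nseq (word_index w i) i | P j) 1 = P i * count_mem i w)%N.
    by rewrite sum1_count count_nseq ffunE.
  rewrite (eq_bigr _ (fun i _ => E i)).
  elim: w {incw E} => [|j w IH]; first by rewrite big_nil big1// => i _; rewrite muln0.
  rewrite big_cons; under eq_bigr do rewrite /= mulnDr.
  rewrite big_split/= IH (bigD1 j)//= eqxx muln1 big1 ?addn0; last first.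
    by move=> i ij; rewrite eq_sym (negbTE ij) muln0.
  by case: (P j).
Qed.

Definition coord_power (i : 'I_d) (n : nat) : @multi_index d :=
  [ffun j => if j == i then n else 0%N].

Lemma mdeg_coord_power i n : mdeg (coord_power i n) = n.
Proof.
rewrite /mdeg (bigD1 i)//= ffunE eqxx big1 ?addn0// => j /negbTE ji.
by rewrite ffunE ji.
Qed.

Lemma monomial_coord_power i n y : monomial (coord_power i n) y = y ord0 i ^+ n.
Proof.
rewrite /monomial (bigD1 i)//= ffunE eqxx big1 ?mulr1// => j /negbTE ji.
by rewrite ffunE ji expr0.
Qed.

Lemma seminorm_le a b psi y (r : R) : (schwartz_seminorm a b psi <= r%:E)%E ->
  `|monomial a y| * cmod (mderive b psi y) <= r.
Proof.
move=> ab; rewrite -cmod_real -cmodM -lee_fin; apply: le_trans ab.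
by apply: ereal_sup_ubound; exists y.
Qed.

(** Seminorms with a power of a single coordinate suffice, because the sup norm
    of a point is the absolute value of one of its coordinates. *)
Lemma partials_weight_le m psi (r : R) w y :
  (forall a b, (mdeg a <= d.+1 + m)%N -> (mdeg b <= d.+1 + m)%N ->
    (schwartz_seminorm a b psi <= r%:E)%E) ->
  increasing w -> (size w <= m)%N ->
  cmod (partials w psi y) <= 2 ^+ d.+1 * r * weight y.
Proof.
move=> Hr incw wm; rewrite -mderive_word// weightE ler_pdivlMr ?exprn_gt0 ?ltr_pwDl//.
have bw : (mdeg (word_index w) <= d.+1 + m)%N by rewrite mdeg_word_index (leq_trans wm)// leq_addl.
set z := cmod _; have z0 : 0 <= z by exact: cmod_ge0.
have Hi i n : (n <= d.+1)%N -> `|y ord0 i| ^+ n * z <= r.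
  move=> nd; rewrite -normrX -monomial_coord_power; apply: seminorm_le.
  by apply: Hr => //; rewrite mdeg_coord_power (leq_trans nd)// leq_addr.
have [i yi] := rV_norm_attained y d_gt0.
have [y1|y1] := leP `|y| 1.
  have := Hi i 0%N isT; rewrite expr0 mul1r => zr.
  have X0 : 0 <= (1 + `|y|) ^+ d.+1 by rewrite exprn_ge0// addr_ge0.
  rewrite mulrC; apply: ler_pM => //.
  by apply: lerXn2r; rewrite ?nnegrE ?addr_ge0//; lra.
apply: (@le_trans _ _ (z * (2 * `|y|) ^+ d.+1)).
  by rewrite ler_wpM2l//; apply: lerXn2r; rewrite ?nnegrE ?addr_ge0 ?mulr_ge0//; lra.
rewrite exprMn mulrCA ler_wpM2l ?exprn_ge0// yi mulrC; exact: Hi.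
Qed.

Definition re_family psi w : 'rV[R]_d -> R := Re_fun (partials w psi).
Definition im_family psi w : 'rV[R]_d -> R := Im_fun (partials w psi).

Lemma re_family_deriv psi w i : smooth psi ->
  line_deriv i (re_family psi w) (re_family psi (i :: w)).
Proof.
by move=> spsi; apply: derivable_line_deriv => x; have [_ _ /(_ i x)[]] := spsi w.
Qed.

Lemma im_family_deriv psi w i : smooth psi ->
  line_deriv i (im_family psi w) (im_family psi (i :: w)).
Proof.
by move=> spsi; apply: derivable_line_deriv => x; have [_ _ /(_ i x)[]] := spsi w.
Qed.

Definition ctest m K psi := test_fun m K (Re_fun psi) /\ test_fun m K (Im_fun psi).

Lemma schwartz_ctest_le m psi (r : R) : smooth psi ->
  (forall a b, (mdeg a <= d.+1 + m)%N -> (mdeg b <= d.+1 + m)%N ->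
    (schwartz_seminorm a b psi <= r%:E)%E) ->
  ctest m (2 ^+ d.+1 * r) psi.
Proof.
move=> spsi Hr; have [cRe cIm _] := spsi [::].
have size_le w : size w = 0%N \/ size w = m -> (size w <= m)%N by move=> [->|->].
split; (split; first exact: mfun_continuous).
- exists (re_family psi); split=> // [w i|w y incw sw]; first exact: re_family_deriv.
  apply: le_trans (Re_le_cmod _) _.
  by apply: (partials_weight_le _ Hr) => //; exact: size_le.
- exists (im_family psi); split=> // [w i|w y incw sw]; first exact: im_family_deriv.
  apply: le_trans (Im_le_cmod _) _.
  by apply: (partials_weight_le _ Hr) => //; exact: size_le.
Qed.

Lemma schwartz_bounded_seminorms n psi : schwartz psi -> exists2 r : R, 0 <= r &
  forall a b, (mdeg a <= n)%N -> (mdeg b <= n)%N -> (schwartz_seminorm a b psi <= r%:E)%E.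
Proof.
move=> [_ fin].
pose mi (f : {ffun 'I_d -> 'I_n.+1}) : @multi_index d := [ffun i => f i : nat].
exists (\sum_f \sum_g `|fine (schwartz_seminorm (mi f) (mi g) psi)|).
  by apply: sumr_ge0 => f _; apply: sumr_ge0.
have miE a : (mdeg a <= n)%N -> exists f, a = mi f.
  move=> an; exists [ffun i => inord (a i)]; apply/ffunP => i; rewrite !ffunE inordK//.
  by rewrite ltnS (leq_trans _ an)// /mdeg (bigD1 i)//= leq_addr.
move=> a b /miE[f ->] /miE[g ->].
have s0 : (0 <= schwartz_seminorm (mi f) (mi g) psi)%E.
  apply: (@le_trans _ _ (cmod ((monomial (mi f) 0)%:C * mderive (mi g) psi 0))%:E).
    by rewrite lee_fin cmod_ge0.
  by apply: ereal_sup_ubound; exists 0.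
rewrite -(fineK (_ : schwartz_seminorm (mi f) (mi g) psi \is a fin_num)); last by rewrite ge0_fin_numE.
rewrite lee_fin (bigD1 f)//= (bigD1 g)//= -addrA (le_trans (ler_norm _))// lerDl.
by rewrite addr_ge0// sumr_ge0// => *; rewrite sumr_ge0.
Qed.

Lemma schwartz_ctest m psi : schwartz psi -> exists2 K : R, 0 <= K & ctest m K psi.
Proof.
move=> spsi; have [r r0 Hr] := schwartz_bounded_seminorms (d.+1 + m) spsi.
exists (2 ^+ d.+1 * r); first by rewrite mulr_ge0// exprn_ge0.
by apply: schwartz_ctest_le; [case: spsi|exact: Hr].
Qed.

Lemma smoothB psi1 psi2 : smooth psi1 -> smooth psi2 ->
  (forall w x, partials w (fun x => psi1 x - psi2 x) x =
    partials w psi1 x - partials w psi2 x) /\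
  smooth (fun x => psi1 x - psi2 x).
Proof.
move=> s1 s2.
have E w : partials w (fun x => psi1 x - psi2 x) =
    (fun x => partials w psi1 x - partials w psi2 x).
  elim: w => //= i w ->; apply/funext => x; rewrite /partial_at.
  have [_ _ /(_ i x)[dr1 di1]] := s1 w; have [_ _ /(_ i x)[dr2 di2]] := s2 w.
  apply: complexP; rewrite ?reB ?imB/=.
    rewrite (_ : Re_fun _ = Re_fun (partials w psi1) \- Re_fun (partials w psi2)) ?deriveB//.
    by apply/funext => y; rewrite /Re_fun reB.
  rewrite (_ : Im_fun _ = Im_fun (partials w psi1) \- Im_fun (partials w psi2)) ?deriveB//.
  by apply/funext => y; rewrite /Im_fun imB.
split=> [w x|w]; first by rewrite E.
have [cr1 ci1 d1] := s1 w; have [cr2 ci2 d2] := s2 w; rewrite E.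
have -> : Re_fun (fun x => partials w psi1 x - partials w psi2 x) =
    Re_fun (partials w psi1) \- Re_fun (partials w psi2).
  by apply/funext => y; rewrite /Re_fun reB.
have -> : Im_fun (fun x => partials w psi1 x - partials w psi2 x) =
    Im_fun (partials w psi1) \- Im_fun (partials w psi2).
  by apply/funext => y; rewrite /Im_fun imB.
have subC (f g : 'rV[R]_d -> R) : continuous f -> continuous g -> continuous (f \- g).
  by move=> cf cg x; exact: (@cvgB _ _ _ (nbhs x) (nbhs_filter x) _ _ _ _ (cf x) (cg x)).
split; [exact: subC|exact: subC|move=> i x].
have [dr1 di1] := d1 i x; have [dr2 di2] := d2 i x.
by split; apply: derivableB.
Qed.

End schwartz_functions.

(** * Series of complex numbers and complex atoms *)

Section complex_series.
Context {R : realType}.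
Implicit Types (z : nat -> R[i]).

Definition csummable z := exists B : R, forall n, \sum_(i < n) cmod (z i) <= B.

Definition csum z : R[i] :=
  limn (fun n => complex.Re (\sum_(i < n) z i)) +i*
  limn (fun n => complex.Im (\sum_(i < n) z i)).

Lemma Re_sum (I : Type) (s : seq I) (F : I -> R[i]) :
  complex.Re (\sum_(i <- s) F i) = \sum_(i <- s) complex.Re (F i).
Proof. by elim: s => [|i s IH]; rewrite ?big_nil// !big_cons reD IH. Qed.

Lemma Im_sum (I : Type) (s : seq I) (F : I -> R[i]) :
  complex.Im (\sum_(i <- s) F i) = \sum_(i <- s) complex.Im (F i).
Proof. by elim: s => [|i s IH]; rewrite ?big_nil// !big_cons imD IH. Qed.

Lemma abs_summable_cvg (u : nat -> R) (B : R) :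
  (forall n, \sum_(i < n) `|u i| <= B) -> cvgn (fun n => \sum_(i < n) u i).
Proof.
move=> uB; rewrite (_ : (fun n => _) = series u); last first.
  by apply/funext => n; rewrite /series/= big_mkord.
apply: normed_cvg.
have E : [normed series u] = (fun n => \sum_(i < n) `|u i|).
  by apply/funext => n; rewrite /normed_series_of/= /series/= big_mkord.
rewrite E; apply: nondecreasing_is_cvgn.
  by apply/nondecreasing_seqP => n; rewrite big_ord_recr/= lerDl.
by exists B => _ [n _ <-]; exact: uB.
Qed.

Lemma csummable_Re z : csummable z -> cvgn (fun n => complex.Re (\sum_(i < n) z i)).
Proof.
move=> [B HB]; rewrite (_ : (fun n => _) = (fun n => \sum_(i < n) complex.Re (z i))); last first.
  by apply/funext => n; rewrite Re_sum.
apply: (@abs_summable_cvg (fun i => complex.Re (z i)) B) => n; apply: le_trans (HB n).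
by apply: ler_sum => i _; exact: Re_le_cmod.
Qed.

Lemma csummable_Im z : csummable z -> cvgn (fun n => complex.Im (\sum_(i < n) z i)).
Proof.
move=> [B HB]; rewrite (_ : (fun n => _) = (fun n => \sum_(i < n) complex.Im (z i))); last first.
  by apply/funext => n; rewrite Im_sum.
apply: (@abs_summable_cvg (fun i => complex.Im (z i)) B) => n; apply: le_trans (HB n).
by apply: ler_sum => i _; exact: Im_le_cmod.
Qed.

Lemma csum_linear (c : R[i]) z1 z2 : csummable z1 -> csummable z2 ->
  csum (fun i => c * z1 i + z2 i) = c * csum z1 + csum z2.
Proof.
move=> s1 s2.
have E n : \sum_(i < n) (c * z1 i + z2 i) = c * (\sum_(i < n) z1 i) + \sum_(i < n) z2 i.
  by rewrite big_split/= mulr_sumr.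
pose S1 n := \sum_(i < n) z1 i; pose S2 n := \sum_(i < n) z2 i.
have HRe : (fun n => complex.Re (\sum_(i < n) (c * z1 i + z2 i))) =
    (fun n => complex.Re c * complex.Re (S1 n) - complex.Im c * complex.Im (S1 n)
      + complex.Re (S2 n)).
  by apply/funext => n; rewrite E reD reM.
have HIm : (fun n => complex.Im (\sum_(i < n) (c * z1 i + z2 i))) =
    (fun n => complex.Re c * complex.Im (S1 n) + complex.Im c * complex.Re (S1 n)
      + complex.Im (S2 n)).
  by apply/funext => n; rewrite E imD imM.
rewrite /csum HRe HIm.
have cR1 := csummable_Re s1; have cI1 := csummable_Im s1.
have cR2 := csummable_Re s2; have cI2 := csummable_Im s2.
apply: complexP; rewrite ?reD ?reM ?imD ?imM/=; apply/cvg_lim => //.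
  apply: cvgD => //; apply: cvgB; (apply: cvgM; first exact: cvg_cst) => //.
apply: cvgD => //; apply: cvgD; (apply: cvgM; first exact: cvg_cst) => //.
Qed.

Lemma lim_dist_le (u : nat -> R) M (r : R) : cvgn u ->
  (forall n, (M <= n)%N -> `|u n - u M| <= r) -> `|limn u - u M| <= r.
Proof.
move=> cu H; rewrite ler_norml lerBlDr lerBrDr; apply/andP; split.
  apply: limr_ge => //; exists M => // n /H; rewrite ler_norml; lra.
apply: limr_le => //; exists M => // n /H; rewrite ler_norml; lra.
Qed.

Lemma sum_ord_sub (T : zmodType) (F : nat -> T) M n : (M <= n)%N ->
  \sum_(i < n) F i - \sum_(i < M) F i = \sum_(M <= i < n) F i.
Proof.
move=> Mn; rewrite -(big_mkord xpredT F) -(big_mkord xpredT F).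
by rewrite (big_cat_nat (leq0n M) Mn)/= addrAC subrr add0r.
Qed.

(** The factor 2 comes from treating real and imaginary parts separately. *)
Lemma csum_tail_le z M (D : \bar R) : csummable z ->
  (forall n, (\sum_(M <= i < n) cmod (z i))%:E <= D)%E ->
  ((cmod (csum z - \sum_(i < M) z i)%R)%:E <= 2%:E * D)%E.
Proof.
move=> sz; case: D => [r| |] H; last 2 first.
- by rewrite gt0_muley ?leey// lte_fin.
- by have := H M; rewrite leeNy_eq.
rewrite -EFinM lee_fin; apply: (le_trans (cmod_le_ReIm _)).
rewrite reB imB /= mulr_natl mulr2n; apply: lerD.
  apply: (lim_dist_le (csummable_Re sz)) => n Mn.
  rewrite -reB sum_ord_sub// -lee_fin; apply: le_trans (H n).
  by rewrite lee_fin (le_trans (Re_le_cmod _))// cmod_sum.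
apply: (lim_dist_le (csummable_Im sz)) => n Mn.
rewrite -imB sum_ord_sub// -lee_fin; apply: le_trans (H n).
by rewrite lee_fin (le_trans (Im_le_cmod _))// cmod_sum.
Qed.

End complex_series.

Section complex_integrals.
Context {R : realType} {d : nat}.
Implicit Types (f g psi : 'rV[R]_d -> R[i]).

Definition cintegrable f := lintegrable (Re_fun f) /\ lintegrable (Im_fun f).

Lemma cintegralE f : cintegral f = lint (Re_fun f) +i* lint (Im_fun f).
Proof. by []. Qed.

Lemma lintegrableB (f g : 'rV[R]_d -> R) : lintegrable f -> lintegrable g ->
  lintegrable (fun x => f x - g x).
Proof.
move=> If Ig; rewrite (_ : (fun x => _) = (fun x => f x + (-1) * g x)).
  by apply: lintegrableD => //; exact: lintegrableZ.
by apply/funext => x; rewrite mulN1r.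
Qed.

Lemma cintegrable0 : cintegrable (fun=> 0).
Proof.
have I0 : lintegrable (fun=> 0 : R).
  split; first exact: mfun_cst.
  under eq_integral do rewrite normr0.
  by rewrite integral0.
by split.
Qed.

Lemma cintegral0 : cintegral (fun _ : 'rV[R]_d => 0 : R[i]) = 0.
Proof. by rewrite cintegralE !lint0. Qed.

Lemma cintegrable_linear (c : R[i]) f g : cintegrable f -> cintegrable g ->
  cintegrable (fun x => c * f x + g x).
Proof.
move=> [If If'] [Ig Ig']; split.
  rewrite /Re_fun; under eq_fun do rewrite reD reM.
  apply: lintegrableD => //; apply: lintegrableB; exact: lintegrableZ.
rewrite /Im_fun; under eq_fun do rewrite imD imM.
apply: lintegrableD => //; apply: lintegrableD; exact: lintegrableZ.
Qed.

Lemma cintegral_linear (c : R[i]) f g : cintegrable f -> cintegrable g ->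
  cintegral (fun x => c * f x + g x) = c * cintegral f + cintegral g.
Proof.
move=> [If If'] [Ig Ig']; rewrite !cintegralE.
apply: complexP; rewrite ?reD ?reM ?imD ?imM/=.
  rewrite [Re_fun _](_ : _ = fun x => (complex.Re c * Re_fun f x - complex.Im c * Im_fun f x)
      + Re_fun g x); last by apply/funext => x; rewrite /Re_fun reD reM.
  rewrite lintD//; last by apply: lintegrableB; exact: lintegrableZ.
  by rewrite lintB ?lintZ//; exact: lintegrableZ.
rewrite [Im_fun _](_ : _ = fun x => (complex.Re c * Im_fun f x + complex.Im c * Re_fun f x)
    + Im_fun g x); last by apply/funext => x; rewrite /Im_fun imD imM.
rewrite lintD//; last by apply: lintegrableD; exact: lintegrableZ.
by rewrite lintD ?lintZ//; exact: lintegrableZ.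
Qed.

Definition cbounded psi (B : R) := [/\ mfun (Re_fun psi), mfun (Im_fun psi),
  (forall x, `|Re_fun psi x| <= B) & (forall x, `|Im_fun psi x| <= B)].

Definition catom m c l V f :=
  real_atom m c l V (Re_fun f) /\ real_atom m c l V (Im_fun f).

Section catom.
Variables (m : nat) (c : 'rV[R]_d) (l V : R) (a : 'rV[R]_d -> R[i]).
Hypotheses (l_gt0 : 0 < l) (V_ge0 : 0 <= V) (atom_a : catom m c l V a).

Lemma catom_integrable psi B : cbounded psi B -> cintegrable (fun x => a x * psi x).
Proof.
move=> [mr mi rB iB]; case: atom_a => ar ai.
have I (f h : 'rV[R]_d -> R) : real_atom m c l V f -> mfun h -> (forall x, `|h x| <= B) ->
    lintegrable (fun x => f x * h x).
  by move=> af mh hB; apply: (atom_integrable l_gt0 V_ge0 af mh (B := B)) => x _.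
split; rewrite /Re_fun /Im_fun.
  by under eq_fun do rewrite reM; apply: lintegrableB; exact: I.
by under eq_fun do rewrite imM; apply: lintegrableD; exact: I.
Qed.

(** The factor 4 counts the products of real and imaginary parts. *)
Lemma catom_pair_le psi B (K : R) : cbounded psi B ->
  (forall f : 'rV[R]_d -> R, real_atom m c l V f -> `|lint (fun x => f x * Re_fun psi x)| <= K) ->
  (forall f : 'rV[R]_d -> R, real_atom m c l V f -> `|lint (fun x => f x * Im_fun psi x)| <= K) ->
  cmod (dist_of a psi) <= 4 * K.
Proof.
move=> [mr mi rB iB] HR HI; case: atom_a => ar ai.
have I (f h : 'rV[R]_d -> R) : real_atom m c l V f -> mfun h -> (forall x, `|h x| <= B) ->
    lintegrable (fun x => f x * h x).
  by move=> af mh hB; apply: (atom_integrable l_gt0 V_ge0 af mh (B := B)) => x _.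
rewrite (le_trans (cmod_le_ReIm _))// /dist_of cintegralE /=.
have -> : Re_fun (fun x => a x * psi x) =
    (fun x => Re_fun a x * Re_fun psi x - Im_fun a x * Im_fun psi x).
  by apply/funext => x; rewrite /Re_fun reM.
have -> : Im_fun (fun x => a x * psi x) =
    (fun x => Re_fun a x * Im_fun psi x + Im_fun a x * Re_fun psi x).
  by apply/funext => x; rewrite /Im_fun imM.
rewrite lintB ?lintD; do ?exact: I.
have := HR _ ar; have := HR _ ai; have := HI _ ar; have := HI _ ai.
set x1 := lint _; set x2 := lint _; set x3 := lint _; set x4 := lint _ => h1 h2 h3 h4.
have := ler_normB x4 x1; have := ler_normD x2 x3; lra.
Qed.

End catom.
End complex_integrals.

Section atoms_of_sequences.
Context {R : realType} {d : nat}.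
Hypothesis d_gt0 : (0 < d)%N.
Implicit Types (a : 'rV[R]_d -> R[i]) (Q : set 'rV[R]_d) (c : 'rV[R]_d) (l q : R).

Lemma leb_setT_gt0 : (0 < leb R d setT)%E.
Proof.
have m1 : emfun (fun _ : 'rV[R]_d => 1%E) by apply: (emfun_EFin (f := fun=> 1)); exact: mfun_cst.
have := int_subset (mset_unit_cube 0) (@msetT R d) m1 (fun _ => lee01) (@subsetT _ _).
rewrite !int_cst; [|exact: msetT|exact: mset_unit_cube].
by rewrite !mul1e leb_unit_cube; apply: lt_le_trans; rewrite lte_fin.
Qed.

(** The size of an atom, which is also the inverse of the quasi-norm of the
    indicator of its cube. *)
Definition atom_size q l : R := (l ^+ d) `^ (- q^-1).

Lemma atom_size_ge0 q l : 0 <= atom_size q l. Proof. exact: powR_ge0. Qed.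

(** In positive dimension the cubes of volume below 1 are those of side below
    1. *)
Lemma local_atom_catom q (delta : int) a Q : 0 <= delta ->
  local_atom q +oo%E delta a Q ->
  exists c l, [/\ 0 < l, Q = cube c l & catom `|delta|.+1 c l (atom_size q l) a].
Proof.
move=> delta0 [[c [l [l0 QE]]] [mR mI] suppa norma moma].
have {}QE : Q = cube c l by [].
have volQ : volume Q = l ^+ d by rewrite /volume QE leb_cube// ltW.
exists c, l; split=> //.
have aeV : {ae leb R d, forall x : Rd R d, cmod (a x) <= atom_size q l}.
  move: norma; rewrite /Lr_norm unlock leb_setT_gt0 volQ.
  rewrite (_ : fine (+oo^-1)%E = 0 :> R); last by rewrite invey.
  rewrite sub0r => /ess_sup_inf.ess_supP.
  apply: (@filterS _ (almost_everywhere (leb R d)) (ae_filter_ringOfSetsType (leb R d))).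
  by move=> x /=; rewrite lee_fin ger0_norm// cmod_ge0.
have a0 x : ~ cube c l x -> a x = 0.
  move=> nx; apply/eqP/negPn/negP => ax; apply: nx; rewrite -QE; apply: suppa.
  exact: subset_closure.
have l1V : l < 1 -> volume Q < 1.
  by move=> l1; rewrite volQ exprn_ilt1 ?ltW// -lt0n.
have mom b : l < 1 -> (mdeg b < `|delta|.+1)%N ->
    cintegral (fun x => (monomial b x)%:C * a x) = 0.
  move=> l1 bm; apply: moma; first exact: l1V.
  by rewrite -(gez0_abs delta0) lez_nat -ltnS.
have aeF := ae_filter_ringOfSetsType (leb R d).
split; split.
- exact: mR.
- apply: (@filterS _ (almost_everywhere (leb R d)) aeF _ _ _ aeV) => x.
  exact: le_trans (Re_le_cmod _).
- by move=> x /a0; rewrite /Re_fun => ->.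
- move=> l1 b /(mom b l1); rewrite cintegralE => /(congr1 (@complex.Re R)) /= H.
  rewrite -[RHS]H; congr lint; apply/funext => x.
  by rewrite /Re_fun reM/= mul0r subr0.
- exact: mI.
- apply: (@filterS _ (almost_everywhere (leb R d)) aeF _ _ _ aeV) => x.
  exact: le_trans (Im_le_cmod _).
- by move=> x /a0; rewrite /Im_fun => ->.
- move=> l1 b /(mom b l1); rewrite cintegralE => /(congr1 (@complex.Im R)) /= H.
  rewrite -[RHS]H; congr lint; apply/funext => x.
  by rewrite /Im_fun imM/= mul0r addr0.
Qed.

Lemma char_norm_cube q c l : 0 < q -> 0 < l -> (char_norm q (cube c l))^-1 = atom_size q l.
Proof.
move=> q0 l0; rewrite /char_norm /Lr_norm unlock.
rewrite (eq_integral (fun x : Rd R d => (\1_(cube c l) x)%:E)); last first.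
  move=> x _; rewrite indicE; case: (x \in _); rewrite /= ?normr1 ?normr0.
    by rewrite powR1.
  by rewrite powR0// gt_eqF.
rewrite int_indicT; last exact: mset_cube.
by rewrite leb_cube ?ltW// poweR_EFin /= /atom_size powRN.
Qed.

End atoms_of_sequences.

Section functionals.
Context {R : realType} {d : nat}.
Hypothesis d_gt0 : (0 < d)%N.
Implicit Types (psi phi : 'rV[R]_d -> R[i]) (w : functional R d) (x y z : 'rV[R]_d).

Lemma ctest_cbounded m K psi : 0 <= K -> ctest m K psi -> cbounded psi K.
Proof.
move=> K0 [[mr [D [D0 _ HD]]] [mi [D' [D'0 _ HD']]]].
have KW y : K * weight y <= K by rewrite ler_piMr// weight_le1.
split=> // y.
  by rewrite -D0; apply: (le_trans _ (KW y)); apply: HD => //; left.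
by rewrite -D'0; apply: (le_trans _ (KW y)); apply: HD' => //; left.
Qed.

(** The size of a test function is controlled by finitely many seminorms, so
    that a bound in terms of this size is continuity on the Schwartz space. *)
Lemma tempered_of_bound m w (L : R) : 0 <= L ->
  (forall (c : R[i]) psi1 psi2 K1 K2, 0 <= K1 -> 0 <= K2 ->
     ctest m K1 psi1 -> ctest m K2 psi2 ->
     w (fun x => c * psi1 x + psi2 x) = c * w psi1 + w psi2) ->
  (forall K psi, 0 <= K -> ctest m K psi -> cmod (w psi) <= L * K) ->
  tempered w.
Proof.
move=> L0 wlin wL; split.
  move=> c psi1 psi2 /(schwartz_ctest d_gt0 m)[K1 K10 t1] /(schwartz_ctest d_gt0 m)[K2 K20 t2].
  exact: (wlin c _ _ K1 K2).
move=> psi spsi e e0.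
have C0 : 0 < L * 2 ^+ d.+1 + 1 by rewrite ltr_wpDl// mulr_ge0// exprn_ge0.
exists (d.+1 + m)%N, (e / (L * 2 ^+ d.+1 + 1) / 2); split; first by rewrite !divr_gt0.
set r := e / _ / 2 => psi' spsi' Hr.
have r0 : 0 < r by rewrite !divr_gt0.
have [s s'] : smooth psi /\ smooth psi' by case: spsi; case: spsi'.
have tdiff : ctest m (2 ^+ d.+1 * r) (fun x => psi' x - psi x).
  apply: schwartz_ctest_le => //; first exact: (smoothB s' s).2.
  by move=> a b am bm; apply/ltW; exact: Hr.
have [K1 K10 t1] := schwartz_ctest d_gt0 m spsi.
have [K2 K20 t2] := schwartz_ctest d_gt0 m spsi'.
have E : w psi' - w psi = w (fun x => psi' x - psi x).
  have := wlin (-1) psi psi' K1 K2 K10 K20 t1 t2.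
  rewrite (_ : (fun x => -1 * psi x + psi' x) = (fun x => psi' x - psi x)); last first.
    by apply/funext => x; rewrite mulN1r addrC.
  by move=> ->; rewrite mulN1r addrC.
rewrite E; have rK : 0 <= 2 ^+ d.+1 * r by rewrite mulr_ge0 ?exprn_ge0 ?ltW.
apply: (le_lt_trans (wL _ _ rK tdiff)).
apply: (@le_lt_trans _ _ (r * (L * 2 ^+ d.+1 + 1))).
  by rewrite mulrA [leLHS]mulrC ler_wpM2l ?ltW// ltrDl.
rewrite /r mulrAC divfK ?gt_eqF//; lra.
Qed.

(** Suprema of continuous functions are lower semicontinuous. *)
Lemma emfun_local_maximal phi w :
  (forall t x e, 0 < t -> t <= 1 -> 0 < e -> exists2 s, 0 < s & forall x', `|x - x'| < s ->
    cmod (convolution w (dilate phi t) x - convolution w (dilate phi t) x') < e) ->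
  emfun (local_maximal phi w).
Proof.
move=> cw; apply: rd_lower_semicontinuous_measurable => a.
rewrite openE => x /= /ereal_sup_gt[_ [t /= + <-]].
rewrite in_itv/= => /andP[t0 t1]; rewrite lte_fin => ax.
have ax0 : 0 < cmod (convolution w (dilate phi t) x) - a by rewrite subr_gt0.
have [s s0 Hs] := cw t x _ t0 t1 ax0.
apply/nbhs_ballP; exists s => //= x'; rewrite -ball_normE/= => /Hs H.
apply: (@lt_le_trans _ _ (cmod (convolution w (dilate phi t) x'))%:E).
  rewrite lte_fin.
  have := cmodD (convolution w (dilate phi t) x - convolution w (dilate phi t) x')
    (convolution w (dilate phi t) x').
  rewrite subrK; lra.
by apply: ereal_sup_ubound; exists t => //=; rewrite in_itv/= t0.
Qed.

Lemma local_maximal_ge0 phi w x : (0 <= local_maximal phi w x)%E.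
Proof.
apply: (@le_trans _ _ (cmod (convolution w (dilate phi 1) x))%:E).
  by rewrite lee_fin cmod_ge0.
by apply: ereal_sup_ubound; exists 1 => //=; rewrite in_itv/= ltr01 lexx.
Qed.

Lemma local_maximal_le phi w x (B : \bar R) :
  (forall t : R, 0 < t -> t <= 1 -> ((cmod (convolution w (dilate phi t) x))%:E <= B)%E) ->
  (local_maximal phi w x <= B)%E.
Proof.
move=> H; apply: ge_ereal_sup => _ [t /= + <-].
by rewrite in_itv/= => /andP[]; exact: H.
Qed.

(** The Taylor polynomial of order 1 is a constant. *)
Lemma family_lipschitz (D : seq 'I_d -> 'rV[R]_d -> R) (K : R) x y : 0 <= K ->
  (forall (w : seq 'I_d) i, line_deriv i (D w) (D (i :: w))) ->
  (forall i z, `|D [:: i] z| <= K) ->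
  `|D [::] x - D [::] y| <= 2 * (d%:R * K) * `|x - y|.
Proof.
move=> K0 HD DK; have [P pP HP] := taylor_polyfun y 1 HD.
have [p Pp] := polyfun1_cst pP.
have HK (w : seq 'I_d) : size w = 1%N -> increasing w -> forall z, `|z - y| <= `|x - y| -> `|D w z| <= K.
  by case: w => [|i []]//= _ _ z _; exact: DK.
have Hx := HP _ K (normr_ge0 _) K0 HK x (lexx _).
have Hy := HP _ K (normr_ge0 (x - y)) K0 HK y.
rewrite subrr normr0 in Hy; have {}Hy := Hy (normr_ge0 _).
rewrite !Pp expr1 in Hx Hy.
rewrite (_ : D [::] x - D [::] y = (D [::] x - p) - (D [::] y - p)); last by ring.
have := ler_normB (D [::] x - p) (D [::] y - p).
rewrite (_ : 2 * (d%:R * K) * `|x - y| = d%:R * `|x - y| * K + d%:R * `|x - y| * K); last by ring.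
lra.
Qed.

End functionals.

(** * Translates and dilates of the kernel *)

Section kernel_translates.
Context {R : realType} {d : nat}.
Hypothesis d_gt0 : (0 < d)%N.
Variables (phi : 'rV[R]_d -> R[i]) (m : nat) (K : R).
Hypotheses (phi_schwartz : schwartz phi) (phi_supp : support_of phi `<=` unit_ball)
  (m_gt0 : (0 < m)%N) (K_ge0 : 0 <= K)
  (phiK : forall w z, increasing w -> (size w <= m)%N ->
     cmod (partials w phi z) <= K * weight z).
Implicit Types (t : R) (x y z : 'rV[R]_d).

Lemma unit_ball_norm z : unit_ball z -> `|z| < 1.
Proof.
rewrite /unit_ball /= -[ltRHS]sqrtr1 ltr_sqrt ?ltr01// => z1.
have [i ->] := rV_norm_attained z d_gt0.
rewrite -(expr_lt1 (n := 2))// real_normK ?num_real//.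
by apply: le_lt_trans z1; rewrite (bigD1 i)//= lerDl sumr_ge0// => j _; exact: sqr_ge0.
Qed.

Lemma phi0 z : 1 <= `|z| -> phi z = 0.
Proof.
move=> z1; apply/eqP/negPn/negP => pz.
have /phi_supp/unit_ball_norm : support_of phi z by exact: subset_closure.
by rewrite ltNge z1.
Qed.

Lemma partials_le w z : increasing w -> (size w <= m)%N -> cmod (partials w phi z) <= K.
Proof.
move=> wi wm; apply: (le_trans (phiK z wi wm)).
by rewrite ler_piMr// weight_le1.
Qed.

Definition translate t x : 'rV[R]_d -> R[i] := fun y => dilate phi t (x - y).

Lemma Re_translate t x : Re_fun (translate t x) = scaled_kernel (Re_fun phi) t x.
Proof. by apply/funext => y; rewrite /Re_fun /translate /dilate reM/= mul0r subr0. Qed.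

Lemma Im_translate t x : Im_fun (translate t x) = scaled_kernel (Im_fun phi) t x.
Proof. by apply/funext => y; rewrite /Im_fun /translate /dilate imM/= mul0r addr0. Qed.

Section part.
Variables (r : 'rV[R]_d -> R) (D : seq 'I_d -> 'rV[R]_d -> R).
Hypotheses (r_continuous : continuous r) (D0 : D [::] = r)
  (HD : forall w i, line_deriv i (D w) (D (i :: w)))
  (DK : forall w z, increasing w -> (size w <= m)%N -> `|D w z| <= K * weight z).

Lemma scaled_kernel_test t x : 0 < t -> t <= 1 ->
  test_fun m (t^-1 ^+ (d + m) * K * (1 + `|x|) ^+ d.+1) (scaled_kernel r t x).
Proof.
move=> t0 t1; split; first by apply: mfun_continuous; exact: scaled_kernel_continuous.
have ti1 : 1 <= t^-1 by rewrite invf_ge1.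
have ti0 : 0 <= t^-1 by rewrite invr_ge0 ltW.
exists (scaled_family D t x); split.
- exact: scaled_family0.
- exact: scaled_family_deriv.
move=> w y wi sw; have wm : (size w <= m)%N by case: sw => ->.
rewrite /scaled_family !normrM !normrX normrN (ger0_norm ti0) -exprVn ger0_norm ?exprn_ge0//.
rewrite -exprD.
apply: (@le_trans _ _ (t^-1 ^+ (d + m) * (K * weight (t^-1 *: (x - y))))).
  apply: ler_pM; rewrite ?exprn_ge0//; last exact: DK.
  by apply: ler_weXn2l => //; rewrite leq_add2l.
rewrite -!mulrA ler_wpM2l ?exprn_ge0// ler_wpM2l//.
apply: (@le_trans _ _ (weight (x - y))).
  rewrite !weightE lef_pV2 ?posrE ?exprn_gt0 ?ltr_pwDl//.
  apply: lerXn2r; rewrite ?nnegrE ?addr_ge0// lerD2l normrZ (ger0_norm ti0).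
  by rewrite ler_peMl.
apply: (le_trans (weight_le (x - y) (- y))).
have -> : weight (- y) = weight y by rewrite !weightE normrN.
by rewrite opprK subrK.
Qed.

Lemma scaled_kernel_lipschitz t x x' y : 0 < t ->
  `|scaled_kernel r t x y - scaled_kernel r t x' y| <=
    t^-1 ^+ d * (2 * (d%:R * K)) * t^-1 * `|x - x'|.
Proof.
move=> t0; have ti0 : 0 <= t^-1 by rewrite invr_ge0 ltW.
rewrite /scaled_kernel -mulrBr normrM -exprVn ger0_norm ?exprn_ge0//.
rewrite -!mulrA ler_wpM2l ?exprn_ge0// -D0.
have DK1 i z : `|D [:: i] z| <= K.
  by apply: (le_trans (DK z _ _)) => //; rewrite ler_piMr// weight_le1.
apply: (le_trans (family_lipschitz (t^-1 *: (x - y)) (t^-1 *: (x' - y)) K_ge0 HD DK1)).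
by rewrite -scalerBr normrZ (ger0_norm ti0) opprB addrA subrK !mulrA.
Qed.

End part.

Let Re_cont : continuous (Re_fun phi). Proof. by case: phi_schwartz => /(_ [::])[]. Qed.
Let Im_cont : continuous (Im_fun phi). Proof. by case: phi_schwartz => /(_ [::])[]. Qed.
Let Re_D w i : line_deriv i (re_family phi w) (re_family phi (i :: w)).
Proof. by apply: re_family_deriv; case: phi_schwartz. Qed.
Let Im_D w i : line_deriv i (im_family phi w) (im_family phi (i :: w)).
Proof. by apply: im_family_deriv; case: phi_schwartz. Qed.
Let Re_K w z : increasing w -> (size w <= m)%N -> `|re_family phi w z| <= K * weight z.
Proof. by move=> wi wm; exact: le_trans (Re_le_cmod _) (phiK z wi wm). Qed.
Let Im_K w z : increasing w -> (size w <= m)%N -> `|im_family phi w z| <= K * weight z.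
Proof. by move=> wi wm; exact: le_trans (Im_le_cmod _) (phiK z wi wm). Qed.

(** The factor in [x] is the price for centring the weight at the origin instead
    of [x]. *)
Lemma translate_ctest t x : 0 < t -> t <= 1 ->
  ctest m (t^-1 ^+ (d + m) * K * (1 + `|x|) ^+ d.+1) (translate t x).
Proof.
move=> t0 t1; split; rewrite ?Re_translate ?Im_translate.
  exact: (scaled_kernel_test (D := re_family phi)).
exact: (scaled_kernel_test (D := im_family phi)).
Qed.

Lemma translate_cbounded t x : 0 < t -> t <= 1 -> exists B, cbounded (translate t x) B.
Proof.
move=> t0 t1; eexists; apply: (ctest_cbounded (m := m)) (translate_ctest x t0 t1).
by rewrite !mulr_ge0 ?exprn_ge0 ?addr_ge0// invr_ge0 ltW.
Qed.

Section atom.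
Variables (c : 'rV[R]_d) (l V : R) (a : 'rV[R]_d -> R[i]).
Hypotheses (l_gt0 : 0 < l) (V_ge0 : 0 <= V) (atom_a : catom m c l V a).

Definition conv_cst : R := 4 ^+ (d + m) * (d%:R ^+ m * K + 2 ^+ d * K).

Lemma conv_cst_ge0 : 0 <= conv_cst.
Proof. by rewrite mulr_ge0 ?addr_ge0 ?mulr_ge0 ?exprn_ge0. Qed.

Lemma atom_translate_le (k : 'rV[int]_d) t x : 0 < t -> t <= 1 -> unit_cube k x ->
  cmod (dist_of a (translate t x)) <= 4 * (V * conv_cst * cell_tail (d + m) k c l x).
Proof.
move=> t0 t1 kx; have [B bt] := translate_cbounded x t0 t1.
have phi_le z : cmod (phi z) <= K by exact: (@partials_le [::]).
apply: (catom_pair_le l_gt0 V_ge0 atom_a bt) => f af.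
- rewrite Re_translate.
  apply: (conv_cell (D := re_family phi) (K1 := K) _ _ _ _ _ _ l_gt0 V_ge0 af) => //.
  + by move=> z /phi0; rewrite /Re_fun => ->.
  + by move=> z; exact: le_trans (Re_le_cmod _) (phi_le z).
  + by move=> w z wm wi; apply: le_trans (Re_le_cmod _) _; apply: partials_le; rewrite ?wm.
- rewrite Im_translate.
  apply: (conv_cell (D := im_family phi) (K1 := K) _ _ _ _ _ _ l_gt0 V_ge0 af) => //.
  + by move=> z /phi0; rewrite /Im_fun => ->.
  + by move=> z; exact: le_trans (Im_le_cmod _) (phi_le z).
  + by move=> w z wm wi; apply: le_trans (Im_le_cmod _) _; apply: partials_le; rewrite ?wm.
Qed.

Lemma atom_ctest_le psi (L : R) : 0 <= L -> ctest m L psi ->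
  cmod (dist_of a psi) <= 4 * (V * L * @pairing_cst R d m * fine (halo_mass (d + m) c l)).
Proof.
move=> L0 tpsi; have bpsi := ctest_cbounded L0 tpsi.
have fin : halo_mass (d + m) c l \is a fin_num.
  exact: (halo_mass_fin (fun=> c) (d + m) (fun=> l_gt0) 0).
have [tr ti] := tpsi.
by apply: (catom_pair_le l_gt0 V_ge0 atom_a bpsi) => f af;
  rewrite -lee_fin [leRHS]EFinM fineK//; exact: (atom_test_le l_gt0 V_ge0 af L0).
Qed.

Lemma dist_of_linear psi1 psi2 (e : R[i]) B1 B2 : cbounded psi1 B1 -> cbounded psi2 B2 ->
  dist_of a (fun x => e * psi1 x + psi2 x) = e * dist_of a psi1 + dist_of a psi2.
Proof.
move=> b1 b2; rewrite /dist_of.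
rewrite (_ : (fun x => a x * (e * psi1 x + psi2 x)) =
  (fun x => e * (a x * psi1 x) + a x * psi2 x)); last by apply/funext => x; ring.
apply: cintegral_linear.
  exact: (catom_integrable l_gt0 V_ge0 atom_a b1).
exact: (catom_integrable l_gt0 V_ge0 atom_a b2).
Qed.

Lemma atom_translate_lipschitz t x x' : 0 < t -> t <= 1 ->
  cmod (dist_of a (translate t x) - dist_of a (translate t x')) <=
  4 * (V * (t^-1 ^+ d * (2 * (d%:R * K)) * t^-1 * `|x - x'| * l ^+ d)).
Proof.
move=> t0 t1; have [B bt] := translate_cbounded x t0 t1.
have [B' bt'] := translate_cbounded x' t0 t1.
have -> : dist_of a (translate t x) - dist_of a (translate t x') =
    dist_of a (fun y => (-1) * translate t x' y + translate t x y).
  by rewrite (dist_of_linear (-1) bt' bt) mulN1r addrC.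
have [mr mi rB iB] := bt; have [mr' mi' rB' iB'] := bt'.
have ReE : Re_fun (fun y => -1 * translate t x' y + translate t x y) =
    (fun y => Re_fun (translate t x) y - Re_fun (translate t x') y).
  by apply/funext => y; rewrite /Re_fun mulN1r addrC reB.
have ImE : Im_fun (fun y => -1 * translate t x' y + translate t x y) =
    (fun y => Im_fun (translate t x) y - Im_fun (translate t x') y).
  by apply/funext => y; rewrite /Im_fun mulN1r addrC imB.
have bdiff : cbounded (fun y => -1 * translate t x' y + translate t x y) (B + B').
  split; rewrite ?ReE ?ImE; [exact: mfunB|exact: mfunB| |] => y.
    by rewrite (le_trans (ler_normB _ _))// lerD.
  by rewrite (le_trans (ler_normB _ _))// lerD.
have L0 : 0 <= t^-1 ^+ d * (2 * (d%:R * K)) * t^-1 * `|x - x'|.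
  by rewrite !mulr_ge0 ?exprn_ge0// invr_ge0 ltW.
apply: (catom_pair_le l_gt0 V_ge0 atom_a bdiff) => f af; rewrite ?ReE ?ImE.
  apply: (@atom_int_le_measure R d m c l V f V_ge0 af _ (cube c l)).
  - exact: mfunB.
  - exact: L0.
  - exact: mset_cube.
  - by apply: leb_cube; exact: ltW.
  - move=> y cy; rewrite indicE mem_set// mulr1 !Re_translate.
    exact: (scaled_kernel_lipschitz (D := re_family phi)).
apply: (@atom_int_le_measure R d m c l V f V_ge0 af _ (cube c l)).
- exact: mfunB.
- exact: L0.
- exact: mset_cube.
- by apply: leb_cube; exact: ltW.
- move=> y cy; rewrite indicE mem_set// mulr1 !Im_translate.
  exact: (scaled_kernel_lipschitz (D := im_family phi)).
Qed.

End atom.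
End kernel_translates.


(** * Distributions given by atomic series *)

Section weighted_sums.
Context {R : realType} {d : nat}.

Lemma powR_sum_le (I : Type) (s : seq I) (x : I -> R) (r y : R) : 1 <= r ->
  (forall i, 0 <= x i) -> (forall i, x i <= y) -> \sum_(i <- s) x i <= y ->
  \sum_(i <- s) x i `^ r <= y `^ r.
Proof.
move=> r1 x0 xy sy.
have xr i : x i `^ r <= x i * y `^ (r - 1).
  have [xi0|xi0] := eqVneq (x i) 0; first by rewrite xi0 mul0r powR0// gt_eqF// (lt_le_trans _ r1).
  have -> : x i `^ r = x i * x i `^ (r - 1).
    by rewrite -{2}(powRr1 (x0 i)) -powRD ?xi0 ?implybT// addrC subrK.
  by rewrite ler_wpM2l// powR_le_base// subr_ge0.
apply: (@le_trans _ _ (\sum_(i <- s) x i * y `^ (r - 1))); first exact: ler_sum.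
rewrite -mulr_suml.
have y0 : 0 <= y by apply: le_trans sy; exact: sumr_ge0.
apply: (@le_trans _ _ (y * y `^ (r - 1))); first by rewrite ler_wpM2r// powR_ge0.
have [->|yn0] := eqVneq y 0; first by rewrite mul0r powR_ge0.
by rewrite -{1}(powRr1 y0) -powRD ?yn0 ?implybT// addrC subrK.
Qed.

(** The inclusion of the sequence space of exponent [eta] in the space of
    summable sequences. *)
Lemma nneseries_le_poweR (u : nat -> R) (eta : R) : 0 < eta -> eta <= 1 ->
  (forall n, 0 <= u n) ->
  (\sum_(0 <= n <oo) (u n)%:E <= (\sum_(0 <= n <oo) (u n `^ eta)%:E) `^ eta^-1)%E.
Proof.
move=> e0 e1 u0; set Y := (X in (X `^ _)%E).
have Y0 : (0 <= Y)%E by apply: nneseries_ge0 => n _ _; rewrite lee_fin powR_ge0.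
have partial_le n : ((\sum_(i < n) u i `^ eta)%:E <= Y)%E.
  by apply: (@nneseries_ge R (fun i => u i `^ eta)) => i; exact: powR_ge0.
case: Y Y0 partial_le => [y| |]//; last first.
  by rewrite poweRyr ?invr_eq0 ?gt_eqF// => *; exact: leey.
rewrite lee_fin => y0 partial_le; apply: nneseries_EFin_le => // n.
rewrite poweR_EFin lee_fin.
have term_le i : u i `^ eta <= y.
  have := partial_le i.+1; rewrite lee_fin big_ord_recr/=; apply: le_trans.
  by rewrite lerDr sumr_ge0// => j _; exact: powR_ge0.
rewrite (eq_bigr (fun i : 'I_n => (u i `^ eta) `^ eta^-1)); last first.
  by move=> i _; rewrite powRK// gt_eqF.
apply: powR_sum_le => //; first by rewrite invf_ge1.
- by move=> i; exact: powR_ge0.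
- by have := partial_le n; rewrite lee_fin.
Qed.

Variables (q p eta : R) (cor : nat -> 'rV[R]_d) (len : nat -> R) (lam : nat -> R[i])
  (Q : nat -> set 'rV[R]_d).
Hypotheses (q_gt0 : 0 < q) (p_gt0 : 0 < p) (eta_gt0 : 0 < eta) (eta_le1 : eta <= 1)
  (len_gt0 : forall n, 0 < len n) (QE : forall n, Q n = cube (cor n) (len n)).

Definition coefficient n : R := cmod (lam n) * @atom_size R d q (len n).

Lemma coefficient_ge0 n : 0 <= coefficient n.
Proof. by rewrite mulr_ge0 ?cmod_ge0 ?atom_size_ge0. Qed.

Lemma weighted_sumE x : weighted_sum q eta lam Q x =
  (\sum_(0 <= n <oo) ((coefficient n * \1_(cube (cor n) (len n)) x) `^ eta)%:E)%E.
Proof.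
apply: eq_eseriesr => n _; rewrite QE char_norm_cube// -/(coefficient n).
congr EFin; rewrite !indicE; case: (x \in _); first by rewrite !mulr1.
by rewrite !mulr0 powR0// gt_eqF.
Qed.

Lemma weighted_sum_ge0 x : (0 <= weighted_sum q eta lam Q x)%E.
Proof. by rewrite weighted_sumE; apply: nneseries_ge0 => n _ _; rewrite lee_fin powR_ge0. Qed.

Lemma emfun_weighted_sum : emfun (weighted_sum q eta lam Q).
Proof.
rewrite (funext weighted_sumE); apply: emfun_series => [n x|n].
  by rewrite lee_fin powR_ge0.
apply: emfun_EFin; apply: mfun_powR; apply: mfunZ; apply: mfun_indic; exact: mset_cube.
Qed.

Lemma cube_series_le_weighted x :
  (cube_series cor len coefficient x <= weighted_sum q eta lam Q x `^ eta^-1)%E.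
Proof.
rewrite weighted_sumE; apply: nneseries_le_poweR => // n.
by rewrite mulr_ge0// coefficient_ge0.
Qed.

(** The passage from the exponent [eta] to 1 is made at each point, before any
    integration. *)
Lemma esum_cell_mass_le_weighted :
  ((\esum_(k in [set: 'rV[int]_d]) (cell_mass cor len coefficient q k `^ (p / q))) `^ p^-1 <=
   amalgam_norm (q / eta)%:E (p / eta)%:E (weighted_sum q eta lam Q) `^ eta^-1)%E.
Proof.
rewrite amalgam_normE ?divr_gt0//; last exact: weighted_sum_ge0.
rewrite -poweRrM -invfM divfK ?gt_eqF//.
have -> : p / eta / (q / eta) = p / q by field; rewrite !gt_eqF.
apply: poweR_le_base; first by rewrite invr_ge0 ltW.
  by apply: esum_ge0 => k _; exact: poweR_ge0.
apply: le_esum => k _; apply: poweR_le_base.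
- by rewrite divr_ge0// ltW.
- exact: cell_mass_ge0.
apply: int_le; [exact: mset_unit_cube|by move=> x; exact: poweR_ge0| | |].
- by apply: emfun_poweR; apply: emfun_cube_series; exact: coefficient_ge0.
- by apply: emfun_poweR; exact: emfun_weighted_sum.
move=> x _; rewrite [q / eta]mulrC poweRrM; apply: poweR_le_base; first exact: ltW.
  by apply: cube_series_ge0; exact: coefficient_ge0.
exact: cube_series_le_weighted.
Qed.

End weighted_sums.


Section atomic_series.
Context {R : realType} {d : nat}.
Hypothesis d_gt0 : (0 < d)%N.
Variables (m : nat) (cor : nat -> 'rV[R]_d) (len V : nat -> R)
  (a : nat -> 'rV[R]_d -> R[i]) (lam : nat -> R[i]).
Hypotheses (len_gt0 : forall n, 0 < len n) (V_ge0 : forall n, 0 <= V n)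
  (atom_a : forall n, catom m (cor n) (len n) (V n) (a n)).
Implicit Types (psi : 'rV[R]_d -> R[i]) (M n : nat).

Let cf n := cmod (lam n) * V n.
Let cf_ge0 n : 0 <= cf n. Proof. by rewrite mulr_ge0 ?cmod_ge0. Qed.

Definition pairing psi n : R[i] := lam n * dist_of (a n) psi.

(** Meaningful on test functions, against which the pairings are absolutely
    summable. *)
Definition atomic_sum : functional R d := fun psi => csum (pairing psi).

Lemma dist_of_partial_sum M psi b : cbounded psi b ->
  dist_of (partial_sum lam a M) psi = \sum_(i < M) pairing psi i.
Proof.
move=> bp.
suff [] : cintegrable (fun x => partial_sum lam a M x * psi x) /\
  dist_of (partial_sum lam a M) psi = \sum_(i < M) pairing psi i by [].
rewrite /dist_of; elim: M => [|M [IH1 IH2]].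
  have -> : (fun x => partial_sum lam a 0 x * psi x) = fun=> 0.
    by apply/funext => x; rewrite /partial_sum big_ord0 mul0r.
  by rewrite big_ord0 cintegral0; split=> //; exact: cintegrable0.
have -> : (fun x => partial_sum lam a M.+1 x * psi x) =
    (fun x => lam M * (a M x * psi x) + partial_sum lam a M x * psi x).
  by apply/funext => x; rewrite /partial_sum big_ord_recr/= mulrDl mulrA addrC.
have Ia := catom_integrable (len_gt0 M) (V_ge0 M) (atom_a M) bp.
split; first exact: cintegrable_linear.
by rewrite cintegral_linear// IH2 big_ord_recr/= addrC.
Qed.

Lemma pairing_linear psi1 psi2 (e : R[i]) B1 B2 n : cbounded psi1 B1 -> cbounded psi2 B2 ->
  pairing (fun x => e * psi1 x + psi2 x) n = e * pairing psi1 n + pairing psi2 n.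
Proof.
move=> b1 b2.
rewrite /pairing (dist_of_linear (len_gt0 n) (V_ge0 n) (atom_a n) e b1 b2).
by rewrite mulrDr mulrCA.
Qed.

Lemma cbounded_linear psi1 psi2 (e : R[i]) B1 B2 : cbounded psi1 B1 -> cbounded psi2 B2 ->
  exists B, cbounded (fun x => e * psi1 x + psi2 x) B.
Proof.
move=> [mr1 mi1 r1 i1] [mr2 mi2 r2 i2]; exists (cmod e * B1 *+ 2 + B2).
have ReE : Re_fun (fun x => e * psi1 x + psi2 x) = (fun x =>
    (complex.Re e * Re_fun psi1 x - complex.Im e * Im_fun psi1 x) + Re_fun psi2 x).
  by apply/funext => x; rewrite /Re_fun reD reM.
have ImE : Im_fun (fun x => e * psi1 x + psi2 x) = (fun x =>
    (complex.Re e * Im_fun psi1 x + complex.Im e * Re_fun psi1 x) + Im_fun psi2 x).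
  by apply/funext => x; rewrite /Im_fun imD imM.
have le1 (u v : R) : `|u| <= cmod e -> `|v| <= B1 -> `|u * v| <= cmod e * B1.
  by move=> ue vB; rewrite normrM ler_pM.
have Re_e := Re_le_cmod e; have Im_e := Im_le_cmod e.
split; rewrite ?ReE ?ImE.
- by apply: mfunD => //; apply: mfunB; exact: mfunZ.
- by apply: mfunD => //; apply: mfunD; exact: mfunZ.
- move=> x; apply: (le_trans (ler_normD _ _)); rewrite mulr2n lerD//.
  by apply: (le_trans (ler_normB _ _)); apply: lerD; exact: le1.
- move=> x; apply: (le_trans (ler_normD _ _)); rewrite mulr2n lerD//.
  by apply: (le_trans (ler_normD _ _)); apply: lerD; exact: le1.
Qed.

Definition halo_term n : R := cf n * fine (halo_mass (d + m) (cor n) (len n)).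

Lemma halo_term_ge0 n : 0 <= halo_term n.
Proof. by rewrite mulr_ge0// fine_ge0//; exact: (halo_mass_ge0 cor). Qed.

Lemma pairing_ctest_le psi (L : R) n : 0 <= L -> ctest m L psi ->
  cmod (pairing psi n) <= 4 * (L * @pairing_cst R d m) * halo_term n.
Proof.
move=> L0 tpsi; rewrite cmodM.
have := atom_ctest_le (len_gt0 n) (V_ge0 n) (atom_a n) L0 tpsi.
move/(ler_wpM2l (cmod_ge0 (lam n))) => /le_trans; apply.
by rewrite le_eqVlt; apply/orP; left; apply/eqP; rewrite /halo_term /cf; ring.
Qed.

Section summable.
Variable B : R.
Hypothesis halo_sum_le : forall n, \sum_(i < n) halo_term i <= B.

Let pc_ge0 : 0 <= @pairing_cst R d m. Proof. by apply: addr_ge0 => //; apply: mulr_ge0; apply: exprn_ge0. Qed.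

Lemma sum_pairing_le psi (L T : R) M n : 0 <= L -> ctest m L psi ->
  \sum_(M <= i < n) halo_term i <= T ->
  \sum_(M <= i < n) cmod (pairing psi i) <= 4 * (L * @pairing_cst R d m) * T.
Proof.
move=> L0 tpsi HT.
apply: (@le_trans _ _ (4 * (L * @pairing_cst R d m) * \sum_(M <= i < n) halo_term i)).
  by rewrite mulr_sumr; apply: ler_sum => i _; exact: pairing_ctest_le.
by rewrite ler_wpM2l// !mulr_ge0.
Qed.

Lemma pairing_summable psi (L : R) : 0 <= L -> ctest m L psi -> csummable (pairing psi).
Proof.
move=> L0 tpsi; exists (4 * (L * @pairing_cst R d m) * B) => n.
rewrite -(big_mkord xpredT (fun i => cmod (pairing psi i))).
by apply: sum_pairing_le => //; rewrite big_mkord.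
Qed.

Lemma atomic_sum_tail_le psi (L T : R) M : 0 <= L -> ctest m L psi ->
  (forall n, \sum_(M <= i < n) halo_term i <= T) ->
  cmod (atomic_sum psi - dist_of (partial_sum lam a M) psi) <=
  8 * (L * @pairing_cst R d m) * T.
Proof.
move=> L0 tpsi HT; rewrite (dist_of_partial_sum M (ctest_cbounded L0 tpsi)).
have : forall n, ((\sum_(M <= i < n) cmod (pairing psi i))%:E <=
    (4 * (L * @pairing_cst R d m) * T)%:E)%E.
  by move=> n; rewrite lee_fin; exact: sum_pairing_le.
move/(csum_tail_le (pairing_summable L0 tpsi)); rewrite -EFinM lee_fin.
by move=> /le_trans; apply; rewrite le_eqVlt; apply/orP; left; apply/eqP; ring.
Qed.

Lemma tempered_partial_sum M : tempered (dist_of (partial_sum lam a M)).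
Proof.
have B0 : 0 <= B by have := halo_sum_le 0; rewrite big_ord0.
apply: (tempered_of_bound d_gt0 (m := m) (L := 4 * @pairing_cst R d m * B)).
- by rewrite !mulr_ge0.
- move=> c psi1 psi2 K1 K2 K10 K20 /(ctest_cbounded K10) b1 /(ctest_cbounded K20) b2.
  rewrite (dist_of_partial_sum M b1) (dist_of_partial_sum M b2).
  have [b b12] : exists b, cbounded (fun x => c * psi1 x + psi2 x) b by exact: (cbounded_linear c b1 b2).
  rewrite (dist_of_partial_sum M b12) mulr_sumr -big_split/=.
  by apply: eq_bigr => i _; exact: (pairing_linear c i b1 b2).
move=> K psi K0 tpsi; rewrite (dist_of_partial_sum M (ctest_cbounded K0 tpsi)).
apply: (le_trans (cmod_sum _ _ _)).
rewrite -(big_mkord xpredT (fun i => cmod (pairing psi i))).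
rewrite (_ : _ * B * K = 4 * (K * @pairing_cst R d m) * B); last by ring.
by apply: sum_pairing_le => //; rewrite big_mkord.
Qed.

Lemma atomic_sum_linear (c : R[i]) psi1 psi2 K1 K2 : 0 <= K1 -> 0 <= K2 ->
  ctest m K1 psi1 -> ctest m K2 psi2 ->
  atomic_sum (fun x => c * psi1 x + psi2 x) = c * atomic_sum psi1 + atomic_sum psi2.
Proof.
move=> K10 K20 t1 t2.
rewrite -(csum_linear c (pairing_summable K10 t1) (pairing_summable K20 t2)).
congr csum; apply/funext => i.
exact: (pairing_linear c i (ctest_cbounded K10 t1) (ctest_cbounded K20 t2)).
Qed.

Lemma atomic_sum_le psi (L : R) : 0 <= L -> ctest m L psi ->
  cmod (atomic_sum psi) <= 8 * @pairing_cst R d m * B * L.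
Proof.
move=> L0 tpsi.
have := @atomic_sum_tail_le psi L B 0 L0 tpsi.
rewrite (dist_of_partial_sum 0 (ctest_cbounded L0 tpsi)) big_ord0 subr0.
rewrite (_ : 8 * (L * _) * B = 8 * @pairing_cst R d m * B * L); last by ring.
by apply=> n; rewrite big_mkord.
Qed.

Lemma tempered_atomic_sum : tempered atomic_sum.
Proof.
have B0 : 0 <= B by have := halo_sum_le 0; rewrite big_ord0.
apply: (tempered_of_bound d_gt0 (m := m) (L := 8 * @pairing_cst R d m * B)).
- by rewrite !mulr_ge0.
- exact: atomic_sum_linear.
- by move=> K psi K0 tpsi; exact: atomic_sum_le.
Qed.

Lemma halo_tail_small (e : R) : 0 < e ->
  exists M, forall M', (M <= M')%N -> forall n, \sum_(M' <= i < n) halo_term i <= e.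
Proof.
move=> e0.
have fin : (\sum_(0 <= i <oo) (halo_term i)%:E < +oo)%E.
  apply: (@le_lt_trans _ _ B%:E); last exact: ltry.
  by apply: nneseries_EFin_le => n; [exact: halo_term_ge0|rewrite lee_fin].
have /cvg_vanishing/(_ e e0)[M HM] : (\sum_(N <= i <oo) (halo_term i)%:E)%E @[N --> \oo] --> 0%E.
  by apply: nneseries_tail_cvg => // n _; rewrite lee_fin halo_term_ge0.
exists M => M' MM' n; rewrite -lee_fin; apply: le_trans (HM _ MM').
rewrite -sumEFin; apply: (@nneseries_lim_ge R (fun i => (halo_term i)%:E) xpredT M' n).
by move=> i _ _; rewrite lee_fin halo_term_ge0.
Qed.

Lemma atomic_sum_approx psi (L e : R) : 0 <= L -> ctest m L psi -> 0 < e ->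
  exists M, forall M', (M <= M')%N ->
    cmod (atomic_sum psi - dist_of (partial_sum lam a M') psi) <= L * e.
Proof.
move=> L0 tpsi e0; have D0 : 0 < 8 * @pairing_cst R d m + 1 by rewrite ltr_wpDl// mulr_ge0.
have [M HM] := halo_tail_small (divr_gt0 e0 D0).
exists M => M' MM'; apply: (le_trans (atomic_sum_tail_le L0 tpsi (HM _ MM'))).
set D := (X in e / X) in D0 *.
rewrite (_ : 8 * _ * _ = L * e * (8 * @pairing_cst R d m / D)); last by ring.
rewrite ler_piMr ?mulr_ge0 ?(ltW e0)// ler_pdivrMr// mul1r.
by rewrite /D lerDl.
Qed.

Lemma weakstar_atomic_sum :
  weakstar_cvg (fun M => dist_of (partial_sum lam a M)) atomic_sum.
Proof.
move=> psi /(schwartz_ctest d_gt0 m)[K K0 tpsi].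
apply/cvgrPdist_le => e e0.
have K1 : 0 < K + 1 by rewrite ltr_wpDl.
have [M HM] := atomic_sum_approx K0 tpsi (divr_gt0 e0 K1).
exists M => // n Mn; pose z := dist_of (partial_sum lam a n) psi - atomic_sum psi.
change (`|0 - cmod z| <= e); have -> : `|0 - cmod z| = cmod (- z).
  by rewrite sub0r normrN cmodN ger0_norm ?cmod_ge0.
rewrite /z opprB; apply: (le_trans (HM _ Mn)).
by rewrite mulrCA ler_piMr ?(ltW e0)// ler_pdivrMr// mul1r lerDl.
Qed.

End summable.
End atomic_series.


Section maximal_function.
Context {R : realType} {d : nat}.
Hypothesis d_gt0 : (0 < d)%N.
Variables (phi : 'rV[R]_d -> R[i]) (m : nat) (K : R).
Hypotheses (phi_schwartz : schwartz phi) (phi_supp : support_of phi `<=` unit_ball)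
  (m_gt0 : (0 < m)%N) (K_ge0 : 0 <= K)
  (phiK : forall w z, increasing w -> (size w <= m)%N ->
     cmod (partials w phi z) <= K * weight z).
Variables (cor : nat -> 'rV[R]_d) (len V : nat -> R)
  (a : nat -> 'rV[R]_d -> R[i]) (lam : nat -> R[i]).
Hypotheses (len_gt0 : forall n, 0 < len n) (V_ge0 : forall n, 0 <= V n)
  (atom_a : forall n, catom m (cor n) (len n) (V n) (a n)).
Variable B : R.
Hypothesis halo_sum_le : forall n, \sum_(i < n) halo_term m cor len V lam i <= B.
Implicit Types (t : R) (x : 'rV[R]_d) (w : functional R d) (M n : nat) (k : 'rV[int]_d).

Let cf n := cmod (lam n) * V n.
Let cf_ge0 n : 0 <= cf n. Proof. by rewrite mulr_ge0 ?cmod_ge0. Qed.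
Let cc : R := @conv_cst R d m K.
Let cc_ge0 : 0 <= cc. Proof. exact: conv_cst_ge0. Qed.
Let U M := dist_of (partial_sum lam a M).
Let F := atomic_sum a lam.

Lemma ctest_le (K1 K2 : R) (psi : 'rV[R]_d -> R[i]) : K1 <= K2 -> ctest m K1 psi -> ctest m K2 psi.
Proof.
move=> K12 [tr ti]; have le_test (h : 'rV[R]_d -> R) : test_fun m K1 h -> test_fun m K2 h.
  move=> [mh [D [D0 HD DK]]]; split=> //; exists D; split=> // w y wi sw.
  by apply: (le_trans (DK w y wi sw)); rewrite ler_wpM2r// ltW// weight_gt0.
by split; exact: le_test.
Qed.

Definition translate_continuous w := forall t x e, 0 < t -> t <= 1 -> 0 < e ->
  exists2 s, 0 < s & forall x', `|x - x'| < s ->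
    cmod (w (translate phi t x) - w (translate phi t x')) < e.

Lemma emfun_translate_continuous w : translate_continuous w -> emfun (local_maximal phi w).
Proof. by move=> wc; apply: emfun_local_maximal => t x e; exact: wc. Qed.

Lemma partial_sum_translate M t x : 0 < t -> t <= 1 ->
  U M (translate phi t x) = \sum_(i < M) pairing a lam (translate phi t x) i.
Proof.
move=> t0 t1; have [b bt] := translate_cbounded phi_schwartz K_ge0 phiK x t0 t1.
exact: (dist_of_partial_sum lam len_gt0 V_ge0 atom_a M bt).
Qed.

Lemma partial_sum_translate_continuous M : translate_continuous (U M).
Proof.
move=> t x e t0 t1 e0; have ti0 : 0 <= t^-1 by rewrite invr_ge0 ltW.
pose H i : R := cmod (lam i) * (4 * (V i * (t^-1 ^+ d * (2 * (d%:R * K)) * t^-1 * len i ^+ d))).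
have H0 i : 0 <= H i.
  by rewrite !mulr_ge0 ?cmod_ge0 ?exprn_ge0// (ltW (len_gt0 i)).
have S0 : 0 < \sum_(i < M) H i + 1 by rewrite ltr_wpDl// sumr_ge0.
exists (e / (\sum_(i < M) H i + 1)); first exact: divr_gt0.
move=> x'; rewrite ltr_pdivlMr// => xx'; apply: le_lt_trans xx'.
rewrite !partial_sum_translate// -sumrB; apply: (le_trans (cmod_sum _ _ _)).
apply: (@le_trans _ _ (\sum_(i < M) H i * `|x - x'|)); last first.
  by rewrite -mulr_suml mulrC ler_wpM2l// lerDl.
apply: ler_sum => i _; rewrite /pairing -mulrBr cmodM.
have := atom_translate_lipschitz phi_schwartz m_gt0 K_ge0 phiK (len_gt0 i) (V_ge0 i)
  (atom_a i) x x' t0 t1.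
move/(ler_wpM2l (cmod_ge0 (lam i))) => /le_trans; apply.
by rewrite le_eqVlt; apply/orP; left; apply/eqP; rewrite /H; ring.
Qed.

(** The translates by the points near [x] have a common size as test functions,
    so that the partial sums converge uniformly there. *)
Lemma atomic_sum_translate_continuous : translate_continuous F.
Proof.
move=> t x e t0 t1 e0; have ti0 : 0 <= t^-1 by rewrite invr_ge0 ltW.
pose L : R := t^-1 ^+ (d + m) * K * (2 + `|x|) ^+ d.+1.
have L0 : 0 <= L by rewrite !mulr_ge0 ?exprn_ge0 ?addr_ge0.
have tL x' : `|x - x'| <= 1 -> ctest m L (translate phi t x').
  move=> xx'; apply: ctest_le (translate_ctest phi_schwartz K_ge0 phiK x' t0 t1).
  rewrite /L ler_wpM2l ?mulr_ge0 ?exprn_ge0//.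
  apply: lerXn2r; rewrite ?nnegrE ?addr_ge0//.
  have := ler_distD x 0 x'; rewrite !sub0r !normrN; lra.
pose D : R := 8 * (L * @pairing_cst R d m).
have pc0 : 0 <= @pairing_cst R d m by apply: addr_ge0 => //; apply: mulr_ge0; apply: exprn_ge0.
have D0 : 0 <= D by apply: mulr_ge0 => //; exact: mulr_ge0.
have D1 : 0 < D + 1 by rewrite ltr_wpDl.
have T0 : 0 < e / 4 / (D + 1) by rewrite !divr_gt0.
have [M HM] := halo_tail_small len_gt0 V_ge0 halo_sum_le T0.
have near_le x' : `|x - x'| <= 1 -> cmod (F (translate phi t x') - U M (translate phi t x')) <= e / 4.
  move=> /tL tx'.
  apply: (le_trans (atomic_sum_tail_le len_gt0 V_ge0 atom_a halo_sum_le L0 tx' (HM _ (leqnn M)))).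
  rewrite -/D mulrCA ler_piMr ?divr_ge0 ?(ltW e0)// ler_pdivrMr// mul1r.
  by rewrite lerDl.
have e4 : 0 < e / 4 by rewrite divr_gt0.
have [s s0 Hs] := @partial_sum_translate_continuous M t x (e / 4) t0 t1 e4.
exists (Num.min s 1); first by rewrite lt_min s0 ltr01.
move=> x'; rewrite lt_min => /andP[xs x1].
have h1 := near_le x' (ltW x1).
have h2 : cmod (F (translate phi t x) - U M (translate phi t x)) <= e / 4.
  by apply: near_le; rewrite subrr normr0.
have h3 := Hs _ xs.
move: h1 h2 h3; move: (F (translate phi t x)) (F (translate phi t x')).
move: (U M (translate phi t x)) (U M (translate phi t x')) => u u' f f' h1 h2 h3.
have -> : f - f' = (f - u) + (u - u') + (- (f' - u')) by ring.
have := cmodD (f - u + (u - u')) (- (f' - u')); have := cmodD (f - u) (u - u').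
rewrite cmodN; lra.
Qed.

Lemma remainder_translate_continuous M : translate_continuous (fun psi => U M psi - F psi).
Proof.
move=> t x e t0 t1 e0; have e2 : 0 < e / 2 by rewrite divr_gt0.
have [s s0 Hs] := @partial_sum_translate_continuous M t x _ t0 t1 e2.
have [r r0 Hr] := @atomic_sum_translate_continuous t x _ t0 t1 e2.
exists (Num.min s r); first by rewrite lt_min s0.
move=> x'; rewrite lt_min => /andP[/Hs hs /Hr hr].
move: hs hr; move: (F (translate phi t x)) (F (translate phi t x')).
move: (U M (translate phi t x)) (U M (translate phi t x')) => u u' f f' hs hr.
have -> : u - f - (u' - f') = (u - u') + (- (f - f')) by ring.
have := cmodD (u - u') (- (f - f')); rewrite cmodN; lra.
Qed.

Lemma sum_pairing_translate_le M n k t x : 0 < t -> t <= 1 -> unit_cube k x ->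
  ((\sum_(M <= i < n) cmod (pairing a lam (translate phi t x) i))%:E <=
   (4 * cc)%:E * cell_series cor len (from_index M cf) (d + m) k x)%E.
Proof.
move=> t0 t1 kx; pose u i : R := cf i * cell_tail (d + m) k (cor i) (len i) x.
have u0 i : 0 <= u i by rewrite mulr_ge0// cell_tail_ge0.
have -> : cell_series cor len (from_index M cf) (d + m) k x = (\sum_(M <= i <oo) (u i)%:E)%E.
  rewrite -nneseries_from_index; apply: eq_eseriesr => i _.
  by rewrite /from_index /u; case: ifP => // _; rewrite mul0r.
apply: (@le_trans _ _ (4 * cc * \sum_(M <= i < n) u i)%:E).
  rewrite lee_fin mulr_sumr; apply: ler_sum => i _; rewrite /pairing cmodM.
  have := atom_translate_le d_gt0 phi_schwartz phi_supp K_ge0 phiK (len_gt0 i) (V_ge0 i)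
    (atom_a i) t0 t1 kx.
  move/(ler_wpM2l (cmod_ge0 (lam i))) => /le_trans; apply.
  by rewrite le_eqVlt; apply/orP; left; apply/eqP; rewrite /u /cf /cc; ring.
have cc4 : 0 <= 4 * cc by apply: mulr_ge0.
rewrite [leLHS]EFinM lee_wpmul2l ?lee_fin// -sumEFin.
apply: (@nneseries_lim_ge R (fun i => (u i)%:E) xpredT M n) => i _ _.
by rewrite lee_fin.
Qed.

Lemma translate_summable t x : 0 < t -> t <= 1 -> csummable (pairing a lam (translate phi t x)).
Proof.
move=> t0 t1; have := translate_ctest phi_schwartz K_ge0 phiK x t0 t1.
apply: (pairing_summable len_gt0 V_ge0 atom_a halo_sum_le).
by rewrite !mulr_ge0 ?exprn_ge0 ?addr_ge0// invr_ge0 ltW.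
Qed.

Lemma maximal_remainder_le M k x : unit_cube k x ->
  (local_maximal phi (fun psi => U M psi - F psi)%R x <=
   (8 * cc)%:E * cell_series cor len (from_index M cf) (d + m) k x)%E.
Proof.
move=> kx; apply: local_maximal_le => t t0 t1.
rewrite (_ : convolution _ _ x = - (F (translate phi t x) - U M (translate phi t x))); last first.
  by rewrite opprB.
rewrite cmodN partial_sum_translate//.
rewrite (_ : 8 * cc = 2 * (4 * cc)); last by ring.
rewrite EFinM -muleA; apply: (csum_tail_le (translate_summable x t0 t1)) => n.
exact: sum_pairing_translate_le.
Qed.

Let from_index0 : from_index 0 cf = cf.
Proof. by apply/funext => n. Qed.

Lemma maximal_atomic_sum_le k x : unit_cube k x ->
  (local_maximal phi F x <= (8 * cc)%:E * cell_series cor len cf (d + m) k x)%E.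
Proof.
move=> kx; apply: local_maximal_le => t t0 t1.
have := maximal_remainder_le 0 kx; rewrite from_index0; apply: le_trans.
apply: ereal_sup_ubound; exists t; first by rewrite /= in_itv/= t0.
congr EFin; rewrite -[LHS]cmodN opprB; congr cmod.
rewrite [X in _ - X](_ : _ = U 0 (translate phi t x))//.
by rewrite partial_sum_translate// big_ord0 subr0.
Qed.

Lemma maximal_partial_sum_le M k x : unit_cube k x ->
  (local_maximal phi (U M) x <= (8 * cc)%:E * cell_series cor len cf (d + m) k x)%E.
Proof.
move=> kx; apply: local_maximal_le => t t0 t1.
rewrite (_ : convolution _ _ x = U M (translate phi t x))// partial_sum_translate//.
have := @sum_pairing_translate_le 0 M k t x t0 t1 kx.
rewrite from_index0 big_mkord => H.
apply: (@le_trans _ _ ((4 * cc)%:E * cell_series cor len cf (d + m) k x)%E).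
  by apply: le_trans H; rewrite lee_fin; exact: cmod_sum.
apply: lee_wpmul2r; last by rewrite lee_fin ler_wpM2r// ler_nat.
by apply: nneseries_ge0 => n _ _; rewrite lee_fin mulr_ge0// cell_tail_ge0.
Qed.

End maximal_function.


Section Hloc_norm_bound.
Context {R : realType} {d : nat}.
Variables (cor : nat -> 'rV[R]_d) (len b : nat -> R) (N : nat) (q C p K : R).
Hypotheses (len_gt0 : forall n, 0 < len n) (b_ge0 : forall n, 0 <= b n)
  (q_gt0 : 0 < q) (C_ge0 : 0 <= C)
  (tail_sum_le : forall s : seq (R * ('rV[R]_d * R)), proper_family s ->
    (\int[leb R d]_x (tail_sum N s x `^ q)%:E <=
      C%:E * \int[leb R d]_x (cube_sum s x `^ q)%:E)%E)
  (p_gt0 : 0 < p) (K_ge0 : 0 <= K).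

Definition amalgam_cst : R :=
  ((K `^ q * C) `^ (p / q) *
   (#|{ffun 'I_d -> 'I_6}|%:R `^ (p / q) * #|{ffun 'I_d -> 'I_6}|%:R)) `^ p^-1.

Lemma Hloc_norm_le phi (w : functional R d) : emfun (local_maximal phi w) ->
  (forall k x, unit_cube k x ->
     local_maximal phi w x <= K%:E * cell_series cor len b N k x)%E ->
  (Hloc_norm phi q p w <= amalgam_cst%:E *
     (\esum_(k in [set: 'rV[int]_d]) (cell_mass cor len b q k `^ (p / q))) `^ p^-1)%E.
Proof.
move=> mw wK; have w0 := local_maximal_ge0 phi w.
rewrite /Hloc_norm amalgam_normE// /amalgam_cst -poweR_EFin.
have e0 : (0 <= \esum_(k in [set: 'rV[int]_d]) (cell_mass cor len b q k `^ (p / q)))%E.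
  by apply: esum_ge0 => k _; exact: poweR_ge0.
rewrite -poweRM//; last first.
  by rewrite lee_fin mulr_ge0 ?powR_ge0// mulr_ge0 ?powR_ge0.
apply: poweR_le_base; first by rewrite invr_ge0 ltW.
  by apply: esum_ge0 => k _; exact: poweR_ge0.
exact: (amalgam_power_le len_gt0 b_ge0 q_gt0 C_ge0 tail_sum_le p_gt0 K_ge0 w0 mw wK).
Qed.

End Hloc_norm_bound.

(** The number of vanishing moments makes the power [q] of the tails
    integrable. *)
Lemma floor_moments (R : realType) (d : nat) (q : R) (delta : int) : (0 < d)%N ->
  0 < q -> q <= 1 -> Num.floor (d%:R * (q^-1 - 1)) <= delta ->
  0 <= delta /\ d%:R < (d + `|delta|.+1)%:R * q.
Proof.
move=> d0 q0 q1 fd.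
have z0 : 0 <= d%:R * (q^-1 - 1) by rewrite mulr_ge0// subr_ge0 invf_ge1.
have delta0 : 0 <= delta by apply: le_trans fd; rewrite floor_ge0.
split=> //; rewrite natrD mulrDl -ltrBlDl.
have : d%:R * (q^-1 - 1) < `|delta|.+1%:R.
  apply: (lt_le_trans (floorD1_gt _)).
  have dE : delta%:~R = `|delta|%:R :> R by rewrite -{1}(gez0_abs delta0).
  by rewrite intrD -natr1 -dE lerD2r ler_int.
rewrite -(ltr_pM2r q0); apply: le_lt_trans.
by rewrite -mulrA mulrBl mul1r mulVf ?gt_eqF// mulrBr mulr1.
Qed.

Lemma big_mass_bounded (R : realType) (d : nat) (cor : nat -> 'rV[R]_d) (len cf : nat -> R)
    (q r : R) : 0 < q -> 0 < r -> (forall n, 0 <= cf n) ->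
  (\esum_(k in [set: 'rV[int]_d]) (cell_mass cor len cf q k `^ r) < +oo)%E ->
  exists A : R, forall k, (big_mass cor len cf q k <= A%:E)%E.
Proof.
move=> q0 r0 cf0; set E := (X in (X < _)%E) => Efin.
have E0 : (0 <= E)%E by apply: esum_ge0 => k _; exact: poweR_ge0.
have Er : (E `^ r^-1)%E \is a fin_num.
  by rewrite ge0_fin_numE ?poweR_ge0// poweR_lty.
exists (#|{ffun 'I_d -> 'I_6}|%:R * fine (E `^ r^-1)%E) => k.
apply: (le_trans (big_mass_le cor len q cf0 k)).
rewrite EFinM fineK//.
apply: (@le_trans _ _ (\sum_(e : {ffun 'I_d -> 'I_6}) E `^ r^-1)%E); last first.
  by rewrite sumr_const mule_natl.
apply: lee_sum => e _.
rewrite -[leLHS](@poweRK _ r) ?gt_eqF ?cell_mass_ge0//; apply: poweR_le_base.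
- by rewrite invr_ge0 ltW.
- exact: poweR_ge0.
apply: (esum_ge_term (a := fun k => (cell_mass cor len cf q k `^ r)%E)) => i.
exact: poweR_ge0.
Qed.

Theorem theorem3p2 (R : realType) (d : nat) (phi : 'rV[R]_d -> R[i])
    (q p eta : R) (delta : int) :
  (0 < d)%N -> admissible phi ->
  0 < q -> q <= 1 -> q <= p -> 0 < eta -> eta <= 1 ->
  Num.floor (d%:R * (q^-1 - 1)) <= delta ->
  exists C : R, 0 < C /\
    forall (a : nat -> 'rV[R]_d -> R[i]) (Q : nat -> set 'rV[R]_d)
           (lam : nat -> R[i]),
      (forall n, local_atom q +oo%E delta (a n) (Q n)) ->
      (amalgam_norm (q / eta)%:E (p / eta)%:E (weighted_sum q eta lam Q)
         < +oo)%E ->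
      exists f : functional R d,
        [/\ tempered f,
            weakstar_cvg (fun N => dist_of (partial_sum lam a N)) f,
            Hloc_cvg phi q p (fun N => dist_of (partial_sum lam a N)) f &
            (Hloc_norm phi q p f <=
               C%:E * amalgam_norm (q / eta)%:E (p / eta)%:E
                        (weighted_sum q eta lam Q) `^ eta^-1)%E].
Proof.
move=> d0 [phiS phiB _] q0 q1 qp e0 e1 /(floor_moments d0 q0 q1)[delta0 Nq].
have p0 : 0 < p by exact: lt_le_trans qp.
have pq0 : 0 < p / q by exact: divr_gt0.
set m := `|delta|.+1 in Nq; have m0 : (0 < m)%N by [].
have [C C0 tailC] := @integral_tail_sum_le R d (d + m) q q0 q1 Nq.
have [r r0 phir] := schwartz_bounded_seminorms (d.+1 + m) phiS.
pose K : R := 2 ^+ d.+1 * r.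
have K0 : 0 <= K by rewrite mulr_ge0 ?exprn_ge0.
have phiK (w : seq 'I_d) (z : 'rV[R]_d) : increasing w -> (size w <= m)%N ->
    cmod (partials w phi z) <= K * weight z.
  by move=> wi wm; exact: (partials_weight_le d0 z phir wi wm).
(* 4 from the pairing with one atom, 2 from the summation of the series *)
pose K8 : R := 8 * @conv_cst R d m K.
have K80 : 0 <= K8 by apply: mulr_ge0 => //; exact: conv_cst_ge0.
pose G := @amalgam_cst R d q C p K8.
have G0 : 0 <= G by exact: powR_ge0.
exists (1 + G); split; first by rewrite ltr_pwDl.
move=> a Q lam atoms finW; set W := amalgam_norm _ _ _ in finW *.
have /choice[cor /choice[len Hcl]] n := local_atom_catom d0 delta0 (atoms n).
have len0 n : 0 < len n by case: (Hcl n).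
have QE n : Q n = cube (cor n) (len n) by case: (Hcl n).
pose V n := @atom_size R d q (len n).
have V0 n : 0 <= V n by exact: atom_size_ge0.
have catoms n : catom m (cor n) (len n) (V n) (a n) by case: (Hcl n).
pose cf := @coefficient R d q len lam.
have cf0 n : 0 <= cf n by exact: coefficient_ge0.
pose mass (b : nat -> R) : \bar R :=
  (\esum_(k in [set: 'rV[int]_d]) (cell_mass cor len b q k `^ (p / q)))%E.
have mass0 b : (0 <= mass b)%E by apply: esum_ge0 => k _; exact: poweR_ge0.
have massW : (mass cf `^ p^-1 <= W `^ eta^-1)%E.
  exact: (esum_cell_mass_le_weighted lam q0 p0 e0 e1 len0 QE).
have mass_fin : (mass cf < +oo)%E.
  apply: (@lty_poweRy R _ p^-1); first by rewrite invr_eq0 gt_eqF.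
  by apply: le_lt_trans massW _; exact: poweR_lty.
have [A HA] := big_mass_bounded q0 pq0 cf0 mass_fin.
have [B HB] := halo_mass_sum_le len0 cf0 q0 (ltW C0) tailC HA.
have HB' n : \sum_(i < n) halo_term m cor len V lam i <= B by exact: HB.
pose U M := dist_of (partial_sum lam a M); pose F := atomic_sum a lam.
have contU M : translate_continuous phi (U M).
  exact: (partial_sum_translate_continuous phiS m0 K0 phiK).
have contF : translate_continuous phi F.
  exact: (atomic_sum_translate_continuous phiS m0 K0 phiK len0 V0 catoms HB').
have contD M : translate_continuous phi (fun psi => U M psi - F psi).
  exact: (remainder_translate_continuous phiS m0 K0 phiK len0 V0 catoms HB').
have normF : (Hloc_norm phi q p F <= G%:E * mass cf `^ p^-1)%E.
  apply: (Hloc_norm_le len0 cf0 q0 (ltW C0) tailC p0 K80).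
    exact: emfun_translate_continuous.
  by move=> k x; exact: (maximal_atomic_sum_le d0 phiS phiB K0 phiK len0 V0 catoms HB').
have normU M : (Hloc_norm phi q p (U M) <= G%:E * mass cf `^ p^-1)%E.
  apply: (Hloc_norm_le len0 cf0 q0 (ltW C0) tailC p0 K80).
    exact: emfun_translate_continuous.
  by move=> k x; exact: (maximal_partial_sum_le d0 phiS phiB K0 phiK lam len0 V0 catoms).
have normD M : (Hloc_norm phi q p (fun psi => U M psi - F psi)%R <=
    G%:E * mass (from_index M cf) `^ p^-1)%E.
  apply: (Hloc_norm_le len0 (from_index_ge0 cf0 M) q0 (ltW C0) tailC p0 K80).
    exact: emfun_translate_continuous.
  by move=> k x; exact: (maximal_remainder_le d0 phiS phiB K0 phiK len0 V0 catoms HB').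
have fin : (G%:E * mass cf `^ p^-1 < +oo)%E.
  apply: lte_mul_pinfty; [by rewrite lee_fin|by []|exact: poweR_lty].
have tempF : tempered F by exact: (tempered_atomic_sum d0 len0 V0 catoms HB').
exists F; split; first exact: tempF.
- exact: (weakstar_atomic_sum d0 len0 V0 catoms HB').
- split.
  + move=> M; split; first exact: (tempered_partial_sum d0 len0 V0 catoms HB').
    split; first exact: (emfun_translate_continuous (contU M)).
    exact: le_lt_trans (normU M) fin.
  + split; first exact: tempF.
    split; first exact: (emfun_translate_continuous contF).
    exact: le_lt_trans normF fin.
  + apply: vanishing_cvg => [M|]; first exact: poweR_ge0.
    apply: (vanishing_le normD); apply: vanishingZ; [exact: G0|by move=> M; exact: poweR_ge0|].
    apply: vanishing_poweR; [by rewrite invr_gt0|by move=> M; exact: mass0|].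
    exact: (esum_cell_mass_from_vanishing cf0 q0 pq0 mass_fin).
apply: (le_trans normF); apply: (@le_trans _ _ (G%:E * W `^ eta^-1)%E).
  by apply: lee_wpmul2l massW; rewrite lee_fin.
by apply: lee_wpmul2r; [exact: poweR_ge0|rewrite lee_fin lerDr].
Qed.
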